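(* For all $\gamma>0$, there is a one-to-one correspondence between kernels $h\in\mathcal{Z}_{\gamma-1/2}'$ and their sigma-functions $\sigma\in\mathcal{Z}_{1/2-\gamma}'$, that is, $$h\in\mathcal{Z}_{\gamma-1/2}'\iff\sigma=(\mathsf{L}^* )^{-1}h\in\mathcal{Z}_{1/2-\gamma}'.$$ (In other words, $\mathsf{L}^*:\mathcal{Z}_{1/2-\gamma}'\to\mathcal{Z}_{\gamma-1/2}'$ is a bijection.)
   Context: $\mathbb{R}_+=(0,\infty)$. The space $\mathcal{Z}=\mathcal{Z}(\mathbb{R})$ is the subset of the Schwartz space $\mathcal{S}(\mathbb{R})$ consisting of functions $\varphi(x)$ that admit analytic continuation to entire functions satisfying, for all $z\in\mathbb{C}$, the bounds $|\varphi(z)|\le C_\varkappa(1+|z|)^{-\varkappa}e^{r|\operatorname{Im}z|}$ for some $r=r(\varphi)>0$ and all $\varkappa$. By definition, $\varphi_k\to0$ in $\mathcal{Z}$ if all $\varphi_k$ satisfy these bounds with the same constants $r$, $C_\varkappa$ and $\varphi_k\to0$ uniformly on compact subsets of $\mathbb{C}$. For $\gamma\in\mathbb{R}$, $\mathcal{Z}_\gamma$ is the space of functions $f$ on $\mathbb{R}_+$ of the form $f(t)=t^{\gamma-1/2}F(\ln t)$ with $F\in\mathcal{Z}$; its topology is induced by that of $\mathcal{Z}$ via $f\mapsto F$. $\mathcal{Z}_\gamma'$ is the dual space of continuous antilinear functionals on $\mathcal{Z}_\gamma$; the duality $\langle h,F\rangle$ is linear in the first and antilinear in the second argument. The Laplace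 transform is $(\mathsf{L}f)(\lambda)=\int_0^\infty e^{-t\lambda}f(t)\,dt$. For $\gamma>0$ it maps $\mathcal{Z}_{\gamma-1/2}$ to $\mathcal{Z}_{1/2-\gamma}$ continuously, and $\mathsf{L}^*:\mathcal{Z}_{1/2-\gamma}'\to\mathcal{Z}_{\gamma-1/2}'$ is defined by $\langle\mathsf{L}^*\sigma,F\rangle=\langle\sigma,\mathsf{L}F\rangle$. The sigma-function of $h$ is the $\sigma$ satisfying $h=\mathsf{L}^*\sigma$. *)

(* Defs.v *)
From Stdlib Require Export Reals List.
From Coquelicot Require Export Coquelicot.
Open Scope R_scope.

Definition entire (Phi : C -> C) : Prop :=
  forall z : C, ex_derive (K := C_AbsRing) (V := C_NormedModule) Phi z.

Definition schwartz_R (u : R -> R) : Prop :=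
  (forall (n : nat) (x : R), ex_derive_n u n x) /\
  (forall m n : nat, exists M : R,
     forall x : R, Rabs x ^ m * Rabs (Derive_n u n x) <= M).

Definition schwartz (phi : R -> C) : Prop :=
  schwartz_R (fun x => Re (phi x)) /\ schwartz_R (fun x => Im (phi x)).

(* |Phi z| <= C_kappa (1 + |z|)^(-kappa) e^(r |Im z|) for all z and all real
   kappa; the constants are passed explicitly because convergence in Z requires
   the same ones along a whole sequence. *)
Definition Z_bound (r : R) (M : R -> R) (Phi : C -> C) : Prop :=
  forall (kappa : R) (z : C),
    Cmod (Phi z) <=
      M kappa * Rpower (1 + Cmod z) (- kappa) * exp (r * Rabs (Im z)).

Definition analytic_continuation (Phi : C -> C) (phi : R -> C) : Prop :=
  entire Phi /\ forall x : R, Phi (RtoC x) = phi x.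

Definition Z_space (phi : R -> C) : Prop :=
  schwartz phi /\
  exists Phi : C -> C,
    analytic_continuation Phi phi /\
    exists (r : R) (M : R -> R), 0 < r /\ Z_bound r M Phi.

Definition compact_set (K : C -> Prop) : Prop :=
  forall (I : Type) (U : I -> C -> Prop),
    (forall i, open (U i)) ->
    (forall z, K z -> exists i, U i z) ->
    exists l : list I, forall z, K z -> exists i, In i l /\ U i z.

Definition cvg0_unif_compact (Phi : nat -> C -> C) : Prop :=
  forall K : C -> Prop, compact_set K ->
  forall eps : R, 0 < eps ->
  exists N : nat, forall k : nat, (N <= k)%nat ->
  forall z : C, K z -> Cmod (Phi k z) < eps.

(* phi_k -> 0 in Z; the uniform convergence on compact subsets of C is that of
   the analytic continuations. *)
Definition Z_cvg0 (phi : nat -> R -> C) : Prop :=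
  (forall k, Z_space (phi k)) /\
  exists Phi : nat -> C -> C,
    (forall k, analytic_continuation (Phi k) (phi k)) /\
    (exists (r : R) (M : R -> R),
       0 < r /\ forall k, Z_bound r M (Phi k)) /\
    cvg0_unif_compact Phi.

(* Functions on (0, oo) have type posreal -> C.  The next definition is the
   relation f(t) = t^(gamma - 1/2) F(ln t) for t > 0; since ln is onto R, it
   determines F from f. *)
Definition Zg_repr (gamma : R) (f : posreal -> C) (F : R -> C) : Prop :=
  forall t : posreal,
    f t = Cmult (RtoC (Rpower t (gamma - 1 / 2))) (F (ln t)).

Definition Zg (gamma : R) : Type :=
  { f : posreal -> C | exists F : R -> C, Z_space F /\ Zg_repr gamma f F }.

Definition Zg_fun (gamma : R) (f : Zg gamma) : posreal -> C := proj1_sig f.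
Coercion Zg_fun : Zg >-> Funclass.

Definition Zg_cvg0 (gamma : R) (f : nat -> Zg gamma) : Prop :=
  exists F : nat -> R -> C,
    (forall k, Zg_repr gamma (f k) (F k)) /\ Z_cvg0 F.

(* Z_gamma is a linear space, so any combination a f + b g of its elements is
   again some element s of it. *)
Definition antilinear (gamma : R) (h : Zg gamma -> C) : Prop :=
  forall (a b : C) (f g s : Zg gamma),
    (forall t : posreal, s t = Cplus (Cmult a (f t)) (Cmult b (g t))) ->
    h s = Cplus (Cmult (Cconj a) (h f)) (Cmult (Cconj b) (h g)).

(* Continuity refers to the notion of convergence to 0 by which the topology
   of Z is given, so it is sequential; for antilinear h, continuity at 0 is
   continuity everywhere. *)
Definition continuous_functional (gamma : R) (h : Zg gamma -> C) : Prop :=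
  forall f : nat -> Zg gamma, Zg_cvg0 gamma f ->
    filterlim (fun k => h (f k)) eventually (locally (RtoC 0)).

Definition Zg_dual (gamma : R) : Type :=
  { h : Zg gamma -> C | antilinear gamma h /\ continuous_functional gamma h }.

Definition pairing (gamma : R) (h : Zg_dual gamma) (f : Zg gamma) : C :=
  proj1_sig h f.
Arguments pairing {gamma} h f.

Definition extend0 (f : posreal -> C) (t : R) : C :=
  match Rlt_dec 0 t with
  | left Ht => f (mkposreal t Ht)
  | right _ => RtoC 0
  end.

(* g = L f: for every lambda > 0 the improper integral of e^(-t lambda) f(t)
   over (0, oo) converges, at both endpoints, to g(lambda). *)
Definition is_Laplace (f g : posreal -> C) : Prop :=
  forall lambda : posreal,
    is_RInt_gen (V := C_R_NormedModule)
      (fun t : R => Cmult (RtoC (exp (- (t * lambda)))) (extend0 f t))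
      (at_right 0) (Rbar_locally p_infty) (g lambda).

(* h = L^* sigma, that is <h, F> = <sigma, L F> for all F in Z_(gamma - 1/2);
   the element LF of Z_(1/2 - gamma) is determined by F. *)
Definition is_sigma_function (gamma : R)
    (h : Zg_dual (gamma - 1 / 2)) (sigma : Zg_dual (1 / 2 - gamma)) : Prop :=
  forall F : Zg (gamma - 1 / 2),
  exists LF : Zg (1 / 2 - gamma),
    is_Laplace F LF /\ pairing h F = pairing sigma LF.

(* Main.v *)
(* Substituting t = e^x / lambda, the Laplace transform of t^(g-1) F(ln t) is
   lambda^(-g) (A_g F)(- ln lambda), where
     (A_g F)(z) = int e^(g x - e^x) F(z + x) dx
   is the convolution operator with Fourier multiplier Gamma(g + i s).  Hence
   everything reduces to A_g being a homeomorphism of Z.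

   All bounds are weighted sup norms over C, with weights varying at most
   exponentially under translations; by Cauchy's estimate differentiation D is
   then bounded.  Integration by parts gives A_(g+1) = A_g (g + D), so A_g is
   onto if A_(g+1) is, and A_g F = 0 on R implies A_(g+1) F = 0 on R.  For large
   g the probability density e^(g x - e^x) / Gamma(g) concentrates at x = ln g,
   so that A_g / Gamma(g) is a translation by ln g up to an operator of norm at
   most 1/2, and it is inverted by a Neumann series.

   The derivatives of an entire function and the Cauchy estimates are obtained
   from Goursat's lemma for triangles, primitives, and the mean value property. *)
Require Import Defs.
From Stdlib Require Import ZArith Lra Lia Psatz.
From Stdlib Require Import ClassicalEpsilon FunctionalExtensionality Classical_Prop ProofIrrelevance.

(** * Continuity and integration of complex functions of a real variable *)

(** On the Fourier side the claim is transparent: Z corresponds to smooth functions of compact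
    support, and Gamma(g + i s) is smooth without zeros. But 1 / Gamma grows exponentially, so the
    inverse of A_g is not convolution with an integrable kernel, and bounds for it would have to
    come through Paley-Wiener theory. The Neumann series avoids this: on functions of exponential
    type r, differentiation is bounded by a constant depending on r, so A_g is close to a multiple
    of a translation once g is large compared with that constant. The threshold thus depends on r,
    and the exact recursion in g is what removes it. A preimage must keep the decay of every order,
    and a convergent sequence must keep common constants. Hence the preimage is built once and then
    bounded in each weight separately, by a factor that does not depend on the weight. Injectivity
    is stated for values on the real line, since these are all that the Laplace transform sees; no
    identity theorem is invoked. *)

Notation CN := C_R_CompleteNormedModule.

Ltac cring := match goal with |- @eq _ ?a ?b => change (@eq C a b) end; ring.

(** The predicate [is_derive] asks for the little-o estimate at every point to which [locally x]
    converges; by separation x is the only one. *)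
Lemma is_derive_locally {K : AbsRing} {V : NormedModule K} (f : K -> V) (x : K) (l : V) :
  is_derive f x l <->
  (forall eps : posreal, locally x (fun y =>
     norm (minus (minus (f y) (f x)) (scal (minus y x) l)) <= eps * norm (minus y x))).
Proof.
  split.
  - intros [_ H]. intros eps. exact (H x (fun P HP => HP) eps).
  - intros H. split. { apply is_linear_scal_l. }
    intros y Hy eps. apply (is_filter_lim_locally_unique (V := AbsRing_NormedModule K)) in Hy. subst y. apply H.
Qed.

(** Written in the increment h, so that the complex estimates below are free of filters; the
    non-strict bound admits h = 0. *)
Definition cderiv (f : C -> C) (z l : C) : Prop :=
  forall eps, 0 < eps -> exists delta, 0 < delta /\ forall h : C, Cmod h < delta ->
    Cmod (f (z + h) - f z - l * h)%C <= eps * Cmod h.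

Lemma cderiv_is_derive (f : C -> C) (z l : C) :
  cderiv f z l <-> is_derive (K := C_AbsRing) (V := C_NormedModule) f z l.
Proof.
  rewrite is_derive_locally. split.
  - intros H eps. destruct (H eps (cond_pos eps)) as [d [Hd H1]].
    exists (mkposreal d Hd). intros y Hy. change C in (type of y).
    change (Cmod (y - z)%C < d) in Hy.
    specialize (H1 _ Hy).
    change (Cmod ((f y - f z) - (y - z) * l)%C <= eps * Cmod (y - z)%C).
    replace (z + (y - z))%C with y in H1 by cring.
    replace (f y - f z - (y - z) * l)%C with (f y - f z - l * (y - z))%C by cring.
    exact H1.
  - intros H eps He. destruct (H (mkposreal eps He)) as [d Hd].
    exists d. split. apply cond_pos. intros h Hh.
    specialize (Hd (z + h)%C).
    replace (f (z + h) - f z - l * h)%C with ((f (z + h) - f z) - (z + h - z) * l)%C by cring.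
    replace (Cmod h) with (Cmod (z + h - z)%C) by (f_equal; cring).
    apply Hd. change (Cmod (z + h - z)%C < d). replace (z + h - z)%C with h by cring. exact Hh.
Qed.

Lemma rderiv_is_derive (f : R -> C) (x : R) (l : C) :
  is_derive (V := C_R_NormedModule) f x l <->
  (forall eps, 0 < eps -> exists delta, 0 < delta /\ forall h : R, Rabs h < delta ->
    Cmod (f (x + h)%R - f x - RtoC h * l)%C <= eps * Rabs h).
Proof.
  rewrite is_derive_locally. split.
  - intros H eps He. destruct (H (mkposreal eps He)) as [d Hd].
    exists d. split. apply cond_pos. intros h Hh. specialize (Hd (x + h)).
    rewrite <- Cmod_norm in Hd.
    replace (f (x + h)%R - f x - RtoC h * l)%C with (minus (minus (f (x + h)) (f x)) (scal (minus (x + h) x) l) : C).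
    replace (Rabs h) with (norm (minus (x + h) x)).
    apply Hd. change (Rabs (x + h - x) < d). replace (x + h - x) with h by ring. exact Hh.
    change (Rabs (x + h - x) = Rabs h). f_equal; ring.
    change (minus (x + h) x) with (x + h - x). replace (x + h - x) with h by ring.
    rewrite scal_R_Cmult. reflexivity.
  - intros H eps. destruct (H eps (cond_pos eps)) as [d [Hd H1]].
    exists (mkposreal d Hd). intros y Hy. change R in (type of y). change (Rabs (y - x) < d) in Hy.
    specialize (H1 _ Hy). replace (x + (y - x)) with y in H1 by ring.
    rewrite <- Cmod_norm. rewrite scal_R_Cmult. exact H1.
Qed.

Definition contRC (f : R -> C) : Prop :=
  forall x, continuous (T := R_UniformSpace) (U := C_UniformSpace) f x.
Definition contRR (f : R -> R) : Prop :=
  forall x, continuous (T := R_UniformSpace) (U := R_UniformSpace) f x.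
Definition contCC (f : C -> C) : Prop :=
  forall z, continuous (T := C_UniformSpace) (U := C_UniformSpace) f z.

Lemma contRC_pair (f g : R -> R) : contRR f -> contRR g -> contRC (fun x => (f x, g x)).
Proof.
  intros Hf Hg x. apply (continuous_comp_2 f g (fun a b => (a, b) : C)); [apply Hf|apply Hg|].
  apply continuous_ext with (fun x => x). intros [a b]; reflexivity. apply continuous_id.
Qed.

Lemma contRR_Re (f : R -> C) : contRC f -> contRR (fun x => Re (f x)).
Proof. intros H x. apply (continuous_comp f (fun z => fst z)). apply H. apply continuous_fst. Qed.

Lemma contRR_Im (f : R -> C) : contRC f -> contRR (fun x => Im (f x)).
Proof. intros H x. apply (continuous_comp f (fun z => snd z)). apply H. apply continuous_snd. Qed.

Lemma contRR_plus f g : contRR f -> contRR g -> contRR (fun x => f x + g x).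
Proof. intros Hf Hg x. apply (continuous_plus f g); auto. Qed.
Lemma contRR_minus f g : contRR f -> contRR g -> contRR (fun x => f x - g x).
Proof. intros Hf Hg x. apply (continuous_minus f g); auto. Qed.
Lemma contRR_mult f g : contRR f -> contRR g -> contRR (fun x => f x * g x).
Proof. intros Hf Hg x. apply (continuous_mult f g); auto. Qed.
Lemma contRR_const c : contRR (fun _ => c).
Proof. intros x. apply continuous_const. Qed.
Lemma contRR_id : contRR (fun x => x).
Proof. intros x. apply continuous_id. Qed.
Lemma contRR_derivable (f : R -> R) : (forall x, ex_derive f x) -> contRR f.
Proof. intros H x. apply (ex_derive_continuous f). apply H. Qed.

Lemma contRC_ext (f g : R -> C) : (forall x, f x = g x) -> contRC f -> contRC g.
Proof. intros H Hf x. apply continuous_ext with f; auto. Qed.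
Lemma contRC_const c : contRC (fun _ => c).
Proof. intros x. apply continuous_const. Qed.
Lemma contRC_RtoC f : contRR f -> contRC (fun x => RtoC (f x)).
Proof. intros H. apply contRC_pair. exact H. apply contRR_const. Qed.
Lemma contRC_plus (f g : R -> C) : contRC f -> contRC g -> contRC (fun x => f x + g x)%C.
Proof. intros Hf Hg. apply contRC_pair; apply contRR_plus; [now apply contRR_Re | now apply contRR_Re | now apply contRR_Im | now apply contRR_Im]. Qed.
Lemma contRC_minus (f g : R -> C) : contRC f -> contRC g -> contRC (fun x => f x - g x)%C.
Proof.
  intros Hf Hg. apply contRC_ext with (fun x => (Re (f x) - Re (g x), Im (f x) - Im (g x))). reflexivity.
  apply contRC_pair; apply contRR_minus; [now apply contRR_Re | now apply contRR_Re | now apply contRR_Im | now apply contRR_Im].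
Qed.
Lemma contRC_mult (f g : R -> C) : contRC f -> contRC g -> contRC (fun x => f x * g x)%C.
Proof.
  intros Hf Hg. apply contRC_pair; [apply contRR_minus|apply contRR_plus]; apply contRR_mult;
    first [apply contRR_Re; assumption | apply contRR_Im; assumption].
Qed.
Lemma contRC_comp (F : C -> C) (p : R -> C) : contCC F -> contRC p -> contRC (fun x => F (p x)).
Proof. intros HF Hp x. apply (continuous_comp p F). apply Hp. apply HF. Qed.
Lemma contRC_shift (f : R -> C) (g : R -> R) : contRC f -> contRR g -> contRC (fun x => f (g x)).
Proof. intros HF Hp x. apply (continuous_comp g f). apply Hp. apply HF. Qed.

Create HintDb cont.
#[export] Hint Resolve contRC_const contRC_RtoC contRC_plus contRC_minus contRC_mult contRC_comp contRR_plus contRR_minus contRR_mult contRR_const contRR_id : cont.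

Lemma Cmod_ball (x y : C) eps : Cmod (y - x)%C < eps -> ball (M := C_UniformSpace) x eps y.
Proof. apply C_NormedModule_mixin_compat1. Qed.

(** Balls of the product structure on C are squares, whence the factor sqrt 2. *)
Lemma ball_Cmod (x y : C) (eps : posreal) : ball (M := C_UniformSpace) x eps y -> Cmod (y - x)%C < sqrt 2 * eps.
Proof. apply (C_NormedModule_mixin_compat2 x y eps). Qed.

Lemma contCC_eps (f : C -> C) : contCC f <-> (forall z eps, 0 < eps -> exists delta, 0 < delta /\
   forall h, Cmod h < delta -> Cmod (f (z + h) - f z)%C < eps).
Proof.
  split.
  - intros H z eps He. specialize (H z). unfold continuous in H.
    rewrite filterlim_locally in H.
    assert (Hs : 0 < sqrt 2) by (apply sqrt_lt_R0; lra).
    assert (He' : 0 < eps / sqrt 2) by (apply Rdiv_lt_0_compat; lra).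
    destruct (H (mkposreal _ He')) as [d Hd]. exists d. split. apply cond_pos.
    intros h Hh. specialize (Hd (z + h)%C).
    assert (Hb : ball (M := C_UniformSpace) z d (z + h)%C).
    { apply Cmod_ball. replace (z + h - z)%C with h by ring. exact Hh. }
    specialize (Hd Hb). apply ball_Cmod in Hd. simpl in Hd.
    replace (sqrt 2 * (eps / sqrt 2)) with eps in Hd by (field; lra). exact Hd.
  - intros H z. unfold continuous. rewrite filterlim_locally. intros eps.
    destruct (H z eps (cond_pos eps)) as [d [Hd Hd2]].
    assert (Hs : 0 < sqrt 2) by (apply sqrt_lt_R0; lra).
    assert (He' : 0 < d / sqrt 2) by (apply Rdiv_lt_0_compat; lra).
    exists (mkposreal _ He'). intros y Hy. change C in (type of y).
    apply ball_Cmod in Hy. simpl in Hy. replace (sqrt 2 * (d / sqrt 2)) with d in Hy by (field; lra).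
    apply Cmod_ball. specialize (Hd2 _ Hy). replace (z + (y - z))%C with y in Hd2 by ring. exact Hd2.
Qed.

Lemma Cmod_triangle_minus (x y : C) : Cmod (x - y)%C <= Cmod x + Cmod y.
Proof. unfold Cminus. rewrite <- (Cmod_opp y). apply Cmod_triangle. Qed.

Lemma Cmod_triangle' (x y : C) : Cmod x <= Cmod (x - y)%C + Cmod y.
Proof. replace x with ((x - y) + y)%C at 1 by ring. apply Cmod_triangle. Qed.

Lemma cderiv_cc (f : C -> C) (df : C -> C) : (forall z, cderiv f z (df z)) -> contCC f.
Proof.
  intros H. apply contCC_eps. intros z eps He. destruct (H z 1 Rlt_0_1) as [d [Hd H1]].
  set (L := 1 + Cmod (df z)).
  assert (HL : 0 < L) by (unfold L; generalize (Cmod_ge_0 (df z)); lra).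
  assert (HeL : 0 < eps / L) by (apply Rdiv_lt_0_compat; lra).
  exists (Rmin d (eps / L)). split. apply Rmin_pos; lra.
  intros h Hh. specialize (H1 h (Rlt_le_trans _ _ _ Hh (Rmin_l _ _))).
  assert (Hh2 : Cmod h < eps / L) by (eapply Rlt_le_trans; [exact Hh|apply Rmin_r]).
  generalize (Cmod_triangle' (f (z + h) - f z) (df z * h))%C. rewrite Cmod_mult.
  intros Ht. apply Rle_lt_trans with (L * Cmod h). unfold L; lra.
  apply Rmult_lt_compat_l with (r := L) in Hh2; auto.
  replace (L * (eps / L)) with eps in Hh2 by (field; lra). exact Hh2.
Qed.

Definition CInt (f : R -> C) (a b : R) : C := RInt (V := CN) f a b.

Lemma CInt_correct f a b : contRC f -> is_RInt (V := C_R_NormedModule) f a b (CInt f a b).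
Proof. intros H. apply (RInt_correct (V := CN) f). apply (ex_RInt_continuous (V := CN)). intros; apply H. Qed.

Lemma CInt_unique f a b l : is_RInt (V := C_R_NormedModule) f a b l -> CInt f a b = l.
Proof. intros H. apply (is_RInt_unique (V := CN)). exact H. Qed.

Lemma CInt_ext f g a b : (forall x, f x = g x) -> CInt f a b = CInt g a b.
Proof. intros H. apply (RInt_ext (V := CN)). intros; apply H. Qed.

Lemma CInt_plus f g a b : contRC f -> contRC g -> CInt (fun x => f x + g x)%C a b = (CInt f a b + CInt g a b)%C.
Proof. intros Hf Hg. apply CInt_unique. apply (is_RInt_plus (V := C_R_NormedModule)); now apply CInt_correct. Qed.

Lemma CInt_minus f g a b : contRC f -> contRC g -> CInt (fun x => f x - g x)%C a b = (CInt f a b - CInt g a b)%C.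
Proof. intros Hf Hg. apply CInt_unique. apply (is_RInt_minus (V := C_R_NormedModule)); now apply CInt_correct. Qed.

Lemma is_RInt_Cmult (c : C) (f : R -> C) a b l : is_RInt (V := C_R_NormedModule) f a b l ->
  is_RInt (V := C_R_NormedModule) (fun x => c * f x)%C a b (c * l)%C.
Proof.
  intros H.
  assert (H1 := is_RInt_fct_extend_fst (U := R_NormedModule) (V := R_NormedModule) _ _ _ _ H).
  assert (H2 := is_RInt_fct_extend_snd (U := R_NormedModule) (V := R_NormedModule) _ _ _ _ H).
  apply (is_RInt_fct_extend_pair (U := R_NormedModule) (V := R_NormedModule)).
  - apply (is_RInt_minus (V := R_NormedModule)); apply (is_RInt_scal (V := R_NormedModule)); assumption.
  - apply (is_RInt_plus (V := R_NormedModule)); apply (is_RInt_scal (V := R_NormedModule)); assumption.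
Qed.

Lemma CInt_mult c f a b : contRC f -> CInt (fun x => c * f x)%C a b = (c * CInt f a b)%C.
Proof. intros Hf. apply CInt_unique. apply is_RInt_Cmult. now apply CInt_correct. Qed.

Lemma CInt_Chasles f a b c : contRC f -> (CInt f a b + CInt f b c)%C = CInt f a c.
Proof. intros Hf. symmetry. apply CInt_unique. apply (is_RInt_Chasles (V := C_R_NormedModule)) with b; now apply CInt_correct. Qed.

Lemma CInt_swap f a b : contRC f -> (CInt f b a = - CInt f a b)%C.
Proof. intros Hf. apply CInt_unique. apply (is_RInt_swap (V := C_R_NormedModule)). now apply CInt_correct. Qed.

Lemma CInt_lin f u v a b : contRC f -> CInt (fun t => RtoC u * f (u * t + v)%R)%C a b = CInt f (u * a + v) (u * b + v).
Proof.
  intros Hf. rewrite (CInt_ext _ (fun t => scal u (f (u * t + v) : C_R_NormedModule))).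
  2: { intros x. rewrite scal_R_Cmult. reflexivity. }
  apply CInt_unique. apply (is_RInt_comp_lin (V := C_R_NormedModule)). now apply CInt_correct.
Qed.

Lemma CInt_const c a b : CInt (fun _ => c) a b = (RtoC (b - a) * c)%C.
Proof.
  apply CInt_unique. rewrite <- scal_R_Cmult. apply (is_RInt_const (V := C_R_NormedModule)).
Qed.

Lemma CInt_bound f a b M : contRC f -> a <= b -> (forall x, a <= x <= b -> Cmod (f x) <= M) -> Cmod (CInt f a b) <= (b - a) * M.
Proof.
  intros Hf Hab HM. rewrite Cmod_norm. apply (norm_RInt_le_const (V := C_R_NormedModule) f); auto.
  intros x Hx. rewrite <- Cmod_norm. auto. now apply CInt_correct.
Qed.

Lemma CInt_FTC (f df : R -> C) a b : (forall x, is_derive (V := C_R_NormedModule) f x (df x)) -> contRC df ->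
  CInt df a b = (f b - f a)%C.
Proof. intros H Hd. apply CInt_unique. apply (is_RInt_derive (V := CN)); auto. Qed.

(** With k the increment of p, the error is that of F at k plus l times that of p, each held to eps
    / 2. [L] bounds Cmod k by a multiple of |h|; the summand 1 in [L] and [m] keeps the divisions
    legal. *)
Lemma rderiv_chain (F : C -> C) (p : R -> C) (x : R) (l dp : C) :
  cderiv F (p x) l -> is_derive (V := C_R_NormedModule) p x dp ->
  is_derive (V := C_R_NormedModule) (fun t => F (p t)) x (dp * l)%C.
Proof.
  intros HF Hp. rewrite rderiv_is_derive in *. intros eps He.
  set (L := 1 + Cmod dp). assert (HL : 0 < L) by (unfold L; generalize (Cmod_ge_0 dp); lra).
  set (m := 1 + Cmod l). assert (Hm : 0 < m) by (unfold m; generalize (Cmod_ge_0 l); lra).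
  assert (He1 : 0 < eps / 2 / L) by (repeat apply Rdiv_lt_0_compat; lra).
  assert (He2 : 0 < Rmin 1 (eps / 2 / m)) by (apply Rmin_pos; repeat apply Rdiv_lt_0_compat; lra).
  destruct (HF _ He1) as [d1 [Hd1 H1]]. destruct (Hp _ He2) as [d2 [Hd2 H2]].
  assert (HdL : 0 < d1 / L) by (apply Rdiv_lt_0_compat; lra).
  exists (Rmin d2 (d1 / L)). split. apply Rmin_pos; lra.
  intros h Hh. assert (Hh2 : Rabs h < d2) by (eapply Rlt_le_trans; [exact Hh|apply Rmin_l]).
  assert (Hh1 : Rabs h < d1 / L) by (eapply Rlt_le_trans; [exact Hh|apply Rmin_r]).
  specialize (H2 _ Hh2). set (k := (p (x + h)%R - p x)%C) in *.
  generalize (Rabs_pos h); intros Hh0.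
  assert (Hk : Cmod k <= L * Rabs h).
  { generalize (Cmod_triangle' k (RtoC h * dp)). rewrite Cmod_mult, Cmod_R. intros.
    assert (Rmin 1 (eps / 2 / m) * Rabs h <= 1 * Rabs h) by (apply Rmult_le_compat_r; auto; apply Rmin_l).
    unfold L. lra. }
  assert (Hk1 : Cmod k < d1).
  { apply Rle_lt_trans with (1 := Hk). apply Rmult_lt_compat_l with (r := L) in Hh1; auto.
    replace (L * (d1 / L)) with d1 in Hh1 by (field; lra). exact Hh1. }
  specialize (H1 _ Hk1). replace (p x + k)%C with (p (x + h)) in H1 by (unfold k; ring).
  replace (F (p (x + h)%R) - F (p x) - RtoC h * (dp * l))%C with
    ((F (p (x + h)%R) - F (p x) - l * k) + l * (k - RtoC h * dp))%C by ring.
  eapply Rle_trans. apply Cmod_triangle. rewrite Cmod_mult.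
  assert (eps / 2 / L * Cmod k <= eps / 2 * Rabs h).
  { apply Rmult_le_compat_l with (r := eps / 2 / L) in Hk; [|lra].
    replace (eps / 2 / L * (L * Rabs h)) with (eps / 2 * Rabs h) in Hk by (field; lra). exact Hk. }
  assert (Cmod l * Cmod (k - RtoC h * dp)%C <= eps / 2 * Rabs h).
  { apply Rle_trans with (m * (Rmin 1 (eps / 2 / m) * Rabs h)).
    - apply Rmult_le_compat; auto using Cmod_ge_0. unfold m; lra.
    - apply Rle_trans with (m * (eps / 2 / m * Rabs h)).
      apply Rmult_le_compat_l; [lra|]. apply Rmult_le_compat_r; auto. apply Rmin_r.
      right. field. lra. }
  lra.
Qed.

(** * Goursat's lemma and primitives *)

(** The contour integral of f along the segment from a to b. *)
Definition segI (f : C -> C) (a b : C) : C :=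
  ((b - a) * CInt (fun t => f (a + RtoC t * (b - a))) 0 1)%C.

Lemma contRC_path (a v : C) : contRC (fun t => a + RtoC t * v)%C.
Proof. auto with cont. Qed.

Lemma contRC_line (f : C -> C) (a v : C) : contCC f -> contRC (fun t => f (a + RtoC t * v)%C).
Proof. intros Hf. apply contRC_comp. exact Hf. apply contRC_path. Qed.
#[export] Hint Resolve contRC_line contRC_path : cont.

Lemma is_derive_line (a v : C) (x : R) : is_derive (V := C_R_NormedModule) (fun t => a + RtoC t * v)%C x v.
Proof.
  apply rderiv_is_derive. intros eps He. exists 1. split. lra. intros h _.
  replace (a + RtoC (x + h) * v - (a + RtoC x * v) - RtoC h * v)%C with (RtoC 0).
  rewrite Cmod_0. apply Rmult_le_pos. lra. apply Rabs_pos.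
  rewrite RtoC_plus. ring.
Qed.

Lemma RtoC_m1 : RtoC (-1) = (- RtoC 1)%C.
Proof. apply injective_projections; simpl; ring. Qed.

Lemma segI_rev f a b : contCC f -> (segI f b a = - segI f a b)%C.
Proof.
  intros Hf. unfold segI.
  assert (H := CInt_lin (fun t => f (a + RtoC t * (b - a))%C) (-1) 1 0 1 (contRC_line f a (b - a)%C Hf)).
  replace (-1 * 0 + 1) with 1 in H by ring. replace (-1 * 1 + 1) with 0 in H by ring.
  rewrite (CInt_swap _ 0 1) in H by auto with cont.
  rewrite CInt_mult in H.
  2: { apply (contRC_shift (fun t => f (a + RtoC t * (b - a)))%C); auto with cont. }
  rewrite (CInt_ext (fun t => f (b + RtoC t * (a - b))%C) (fun t => f (a + RtoC (-1 * t + 1) * (b - a))%C)).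
  - transitivity ((b - a) * (RtoC (-1) * CInt (fun t : R => f (a + RtoC (-1 * t + 1) * (b - a))%C) 0 1))%C.
    rewrite RtoC_m1. ring. rewrite H. ring.
  - intros t. f_equal. rewrite RtoC_plus, RtoC_mult, RtoC_m1. ring.
Qed.

Definition mid (a b : C) : C := (RtoC (/ 2) * (a + b))%C.

Lemma mid_l (a b : C) : (mid a b - a = RtoC (/2) * (b - a))%C.
Proof. unfold mid. replace a with ((RtoC (/ 2) + RtoC (/ 2)) * a)%C at 2. ring. rewrite <- RtoC_plus. replace (/ 2 + / 2) with 1 by field. ring. Qed.
Lemma mid_r (a b : C) : (b - mid a b = RtoC (/2) * (b - a))%C.
Proof. unfold mid. replace b with ((RtoC (/ 2) + RtoC (/ 2)) * b)%C at 1. ring. rewrite <- RtoC_plus. replace (/ 2 + / 2) with 1 by field. ring. Qed.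
Lemma segI_mid f a b : contCC f -> (segI f a b = segI f a (mid a b) + segI f (mid a b) b)%C.
Proof.
  intros Hf. unfold segI. rewrite mid_l, mid_r.
  set (g := fun t => f (a + RtoC t * (b - a))%C).
  assert (Hg : contRC g) by (unfold g; auto with cont).
  rewrite <- (CInt_Chasles g 0 (/2) 1) by auto.
  assert (H1 := CInt_lin g (/2) 0 0 1 Hg). assert (H2 := CInt_lin g (/2) (/2) 0 1 Hg).
  rewrite CInt_mult in H1, H2; try (apply (contRC_shift g); auto with cont).
  replace (/2 * 0 + 0) with 0 in H1 by ring. replace (/2 * 1 + 0) with (/2) in H1 by ring.
  replace (/2 * 0 + /2) with (/2) in H2 by ring. replace (/2 * 1 + /2) with 1 in H2 by field.
  rewrite <- H1, <- H2.
  rewrite (CInt_ext (fun t => f (a + RtoC t * (RtoC (/2) * (b - a)))%C) (fun t => g (/2 * t + 0))).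
  rewrite (CInt_ext (fun t => f (mid a b + RtoC t * (RtoC (/2) * (b - a)))%C) (fun t => g (/2 * t + /2))).
  ring.
  - intros t. unfold g. f_equal. rewrite RtoC_plus, RtoC_mult.
    replace (mid a b) with (a + (mid a b - a))%C by ring. rewrite mid_l. ring.
  - intros t. unfold g. f_equal. rewrite RtoC_plus, RtoC_mult. ring.
Qed.

Lemma segI_bound f a b M : contCC f -> (forall t, 0 <= t <= 1 -> Cmod (f (a + RtoC t * (b - a))%C) <= M) ->
  Cmod (segI f a b) <= Cmod (b - a)%C * M.
Proof.
  intros Hf HM. unfold segI. rewrite Cmod_mult. apply Rmult_le_compat_l. apply Cmod_ge_0.
  apply Rle_trans with ((1 - 0) * M); [|right; ring]. apply CInt_bound; auto with cont. lra.
Qed.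

Lemma segI_FTC (F f : C -> C) a b : (forall z, cderiv F z (f z)) -> contCC f -> segI f a b = (F b - F a)%C.
Proof.
  intros HF Hf. unfold segI. rewrite <- CInt_mult by auto with cont.
  rewrite (CInt_FTC (fun t => F (a + RtoC t * (b - a)))%C (fun t => (b - a) * f (a + RtoC t * (b - a)))%C).
  - f_equal; [|f_equal]; f_equal; ring.
  - intros x. apply rderiv_chain. apply HF. apply is_derive_line.
  - auto with cont.
Qed.

Lemma segI_minus f g a b : contCC f -> contCC g -> segI (fun z => f z - g z)%C a b = (segI f a b - segI g a b)%C.
Proof. intros Hf Hg. unfold segI. rewrite (CInt_minus (fun t => f (a + RtoC t * (b - a))%C) (fun t => g (a + RtoC t * (b - a))%C)); auto with cont. ring. Qed.

Lemma cderiv_ext f g z l : (forall x, f x = g x) -> cderiv f z l -> cderiv g z l.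
Proof. intros H Hf eps He. destruct (Hf eps He) as [d [Hd H1]]. exists d; split; auto. intros h Hh. rewrite <- !H. auto. Qed.

Lemma cderiv_const c z : cderiv (fun _ => c) z 0.
Proof.
  intros eps He. exists 1. split. lra. intros h _.
  replace (c - c - 0 * h)%C with (RtoC 0) by ring. rewrite Cmod_0. apply Rmult_le_pos. lra. apply Cmod_ge_0.
Qed.
Lemma cderiv_id z : cderiv (fun z => z) z 1.
Proof.
  intros eps He. exists 1. split. lra. intros h _.
  replace (z + h - z - 1 * h)%C with (RtoC 0) by ring. rewrite Cmod_0. apply Rmult_le_pos. lra. apply Cmod_ge_0.
Qed.
Lemma cderiv_plus f g z l m : cderiv f z l -> cderiv g z m -> cderiv (fun z => f z + g z)%C z (l + m)%C.
Proof.
  intros Hf Hg eps He. destruct (Hf (eps / 2)) as [d [Hd H1]]. lra. destruct (Hg (eps / 2)) as [d' [Hd' H2]]. lra.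
  exists (Rmin d d'). split. now apply Rmin_pos. intros h Hh.
  specialize (H1 h (Rlt_le_trans _ _ _ Hh (Rmin_l _ _))). specialize (H2 h (Rlt_le_trans _ _ _ Hh (Rmin_r _ _))).
  replace (f (z + h) + g (z + h) - (f z + g z) - (l + m) * h)%C with
    ((f (z + h) - f z - l * h) + (g (z + h) - g z - m * h))%C by ring.
  eapply Rle_trans. apply Cmod_triangle. lra.
Qed.
Lemma cderiv_scal c f z l : cderiv f z l -> cderiv (fun z => c * f z)%C z (c * l)%C.
Proof.
  intros Hf eps He. assert (Hc := Cmod_ge_0 c).
  destruct (Hf (eps / (1 + Cmod c))) as [d [Hd H1]]. apply Rdiv_lt_0_compat; lra.
  exists d. split; auto. intros h Hh. specialize (H1 h Hh).
  replace (c * f (z + h) - c * f z - c * l * h)%C with (c * (f (z + h) - f z - l * h))%C by ring.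
  rewrite Cmod_mult. eapply Rle_trans. apply Rmult_le_compat_l; [exact Hc|exact H1].
  apply Rle_trans with ((1 + Cmod c) * (eps / (1 + Cmod c) * Cmod h)).
  apply Rmult_le_compat_r. apply Rmult_le_pos. left; apply Rdiv_lt_0_compat; lra. apply Cmod_ge_0. lra.
  right; field; lra.
Qed.
Lemma cderiv_minus f g z l m : cderiv f z l -> cderiv g z m -> cderiv (fun z => f z - g z)%C z (l - m)%C.
Proof.
  intros Hf Hg. apply (cderiv_ext (fun z => f z + (-1) * g z)%C). intros; ring.
  replace (l - m)%C with (l + (-1) * m)%C by ring. apply cderiv_plus; auto. now apply cderiv_scal.
Qed.
Lemma cderiv_shift f a z l : cderiv f (z + a)%C l -> cderiv (fun z => f (z + a)%C) z l.
Proof.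
  intros Hf eps He. destruct (Hf eps He) as [d [Hd H1]]. exists d. split; auto. intros h Hh.
  replace (z + h + a)%C with (z + a + h)%C by ring. auto.
Qed.
Lemma cderiv_unique f z l m : cderiv f z l -> cderiv f z m -> l = m.
Proof.
  intros Hf Hg. apply cderiv_is_derive in Hf, Hg. rewrite <- (is_C_derive_unique f z l), <- (is_C_derive_unique f z m); auto.
Qed.

Lemma contCC_const c : contCC (fun _ => c).
Proof. apply cderiv_cc with (fun _ => RtoC 0). intros; apply cderiv_const. Qed.
Lemma contCC_minus f g : contCC f -> contCC g -> contCC (fun z => f z - g z)%C.
Proof. intros Hf Hg z. apply (continuous_minus (V := C_R_NormedModule) f g); auto. Qed.
Lemma contCC_plus f g : contCC f -> contCC g -> contCC (fun z => f z + g z)%C.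
Proof. intros Hf Hg z. apply (continuous_plus (V := C_R_NormedModule) f g); auto. Qed.
Lemma contCC_shift f a : contCC f -> contCC (fun z => f (z + a)%C).
Proof.
  intros Hf. rewrite contCC_eps in *. intros z eps He. destruct (Hf (z + a)%C eps He) as [d [Hd H]].
  exists d. split; auto. intros h Hh. replace (z + h + a)%C with (z + a + h)%C by ring. auto.
Qed.

Definition triI f a b c : C := (segI f a b + segI f b c + segI f c a)%C.

Lemma triI_split f a b c : contCC f ->
  (triI f a b c = triI f a (mid a b) (mid c a) + triI f (mid a b) b (mid b c) +
   triI f (mid c a) (mid b c) c + triI f (mid a b) (mid b c) (mid c a))%C.
Proof.
  intros Hf. unfold triI. rewrite (segI_mid f a b Hf), (segI_mid f b c Hf), (segI_mid f c a Hf).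
  rewrite (segI_rev f (mid a b) (mid b c) Hf), (segI_rev f (mid b c) (mid c a) Hf), (segI_rev f (mid c a) (mid a b) Hf).
  ring.
Qed.

Definition T3 : Type := (C * C * C)%type.
Definition trin f (T : T3) : C := let '(a, b, c) := T in triI f a b c.
(** Comparing with x by [Rle_dec] makes the nested triangles the iterates of a function, without any
    choice. The fallback T4 qualifies whenever the other three fail, by [pick4_big]. *)
Definition pick4 f (T1 T2 T3 T4 : T3) (x : R) :=
  if Rle_dec x (Cmod (trin f T1)) then T1 else
  if Rle_dec x (Cmod (trin f T2)) then T2 else
  if Rle_dec x (Cmod (trin f T3)) then T3 else T4.
(* One of the four halved triangles carries at least a quarter of the integral. *)
Definition tstep f (T : T3) : T3 :=
  let '(a, b, c) := T in
  pick4 f (a, mid a b, mid c a) (mid a b, b, mid b c) (mid c a, mid b c, c) (mid a b, mid b c, mid c a)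
    (Cmod (triI f a b c) / 4).
Definition tvert (T : T3) : C := let '(a, b, c) := T in a.
Definition tsmall (T : T3) (d : R) : Prop :=
  let '(a, b, c) := T in Cmod (b - a)%C <= d /\ Cmod (c - b)%C <= d /\ Cmod (a - c)%C <= d.

Lemma pick4_big f T1 T2 T3 T4 x :
  4 * x <= Cmod (trin f T1) + Cmod (trin f T2) + Cmod (trin f T3) + Cmod (trin f T4) ->
  x <= Cmod (trin f (pick4 f T1 T2 T3 T4 x)).
Proof.
  intros H. unfold pick4.
  destruct (Rle_dec x (Cmod (trin f T1))) as [H1|H1]; [exact H1|].
  destruct (Rle_dec x (Cmod (trin f T2))) as [H2|H2]; [exact H2|].
  destruct (Rle_dec x (Cmod (trin f T3))) as [H3|H3]; [exact H3|]. lra.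
Qed.

Lemma pick4_ind f T1 T2 T3' T4 x (P : T3 -> Prop) :
  P T1 -> P T2 -> P T3' -> P T4 -> P (pick4 f T1 T2 T3' T4 x).
Proof.
  intros. unfold pick4. destruct (Rle_dec x (Cmod (trin f T1))); auto.
  destruct (Rle_dec x (Cmod (trin f T2))); auto. destruct (Rle_dec x (Cmod (trin f T3'))); auto.
Qed.

Lemma tstep_big f T : contCC f -> Cmod (trin f T) / 4 <= Cmod (trin f (tstep f T)).
Proof.
  intros Hf. destruct T as [[a b] c]. apply pick4_big. simpl.
  assert (H := triI_split f a b c Hf).
  assert (Cmod (triI f a b c) <= Cmod (triI f a (mid a b) (mid c a)) + Cmod (triI f (mid a b) b (mid b c)) +
     Cmod (triI f (mid c a) (mid b c) c) + Cmod (triI f (mid a b) (mid b c) (mid c a))).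
  { rewrite H at 1. eapply Rle_trans. apply Cmod_triangle. apply Rplus_le_compat_r.
    eapply Rle_trans. apply Cmod_triangle. apply Rplus_le_compat_r. apply Cmod_triangle. }
  lra.
Qed.

Lemma Cmod_half (x y : C) d : (x = RtoC (/2) * y)%C -> Cmod y <= d -> Cmod x <= d / 2.
Proof. intros -> H. rewrite Cmod_mult, Cmod_R, Rabs_right by lra. lra. Qed.
Lemma Cmod_sym (x y : C) : Cmod (x - y)%C = Cmod (y - x)%C.
Proof. rewrite <- Cmod_opp. f_equal. ring. Qed.

Lemma mid_diff a b c : (mid b c - mid a b = RtoC (/ 2) * (c - a))%C.
Proof. unfold mid; ring. Qed.

Lemma tstep_small f T d : tsmall T d ->
  tsmall (tstep f T) (d / 2) /\ Cmod (tvert (tstep f T) - tvert T)%C <= d / 2.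
Proof.
  destruct T as [[a b] c]. unfold tsmall at 1. intros [H1 [H2 H3]].
  assert (H0 : 0 <= d) by (eapply Rle_trans; [apply Cmod_ge_0|exact H1]).
  assert (M1 := mid_l a b). assert (M2 := mid_r a b). assert (M3 := mid_l b c). assert (M4 := mid_r b c).
  assert (M5 := mid_l c a). assert (M6 := mid_r c a).
  assert (D1 := mid_diff a b c). assert (D2 := mid_diff b c a). assert (D3 := mid_diff c a b).
  assert (Z : Cmod (a - a)%C <= d / 2) by (replace (a - a)%C with (RtoC 0) by ring; rewrite Cmod_0; lra).
  assert (S1 : Cmod (c - a)%C <= d) by (rewrite Cmod_sym; auto).
  assert (S2 : Cmod (a - b)%C <= d) by (rewrite Cmod_sym; auto).
  assert (S3 : Cmod (b - c)%C <= d) by (rewrite Cmod_sym; auto).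
  assert (A1 : Cmod (mid a b - a)%C <= d / 2) by (eapply Cmod_half; eauto).
  assert (A2 : Cmod (mid c a - a)%C <= d / 2) by (rewrite Cmod_sym; eapply Cmod_half; eauto).
  unfold tstep. apply (pick4_ind f _ _ _ _ _ (fun T' => tsmall T' (d / 2) /\ Cmod (tvert T' - tvert (a, b, c))%C <= d / 2));
  simpl; repeat split; auto;
  first [ eapply Cmod_half; [eassumption|assumption] | rewrite Cmod_sym; eapply Cmod_half; [eassumption|assumption] ].
Qed.

Lemma half_pow_lim (K eps : R) : 0 < eps -> exists n, forall m, (n <= m)%nat -> K * (/ 2) ^ m < eps.
Proof.
  intros He. assert (HK : 0 < Rabs K + 1) by (generalize (Rabs_pos K); lra).
  destruct (pow_lt_1_zero (/2) ltac:(rewrite Rabs_right; lra) (eps / (Rabs K + 1))) as [n Hn].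
  apply Rdiv_lt_0_compat; lra. exists n. intros m Hm. specialize (Hn m Hm).
  assert (0 < (/2) ^ m) by (apply pow_lt; lra). rewrite Rabs_right in Hn by lra.
  apply Rle_lt_trans with ((Rabs K + 1) * (/ 2) ^ m). apply Rmult_le_compat_r. lra. generalize (Rle_abs K); lra.
  apply Rmult_lt_compat_l with (r := Rabs K + 1) in Hn; auto.
  replace ((Rabs K + 1) * (eps / (Rabs K + 1))) with eps in Hn by (field; lra). exact Hn.
Qed.

(** Defined for every sequence because [Lim_seq] is total; it is the limit only where both parts
    converge. *)
Definition Clim (s : nat -> C) : C := (real (Lim_seq (fun n => Re (s n))), real (Lim_seq (fun n => Im (s n)))).

Lemma geom_dist (s : nat -> C) K : (forall n, Cmod (s (S n) - s n)%C <= K * (/2) ^ n) ->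
  forall n m, (n <= m)%nat -> Cmod (s m - s n)%C <= 2 * K * ((/ 2) ^ n - (/ 2) ^ m).
Proof.
  intros H n m Hm. induction Hm.
  - replace (s n - s n)%C with (RtoC 0) by ring. rewrite Cmod_0. lra.
  - replace (s (S m) - s n)%C with ((s (S m) - s m) + (s m - s n))%C by ring.
    eapply Rle_trans. apply Cmod_triangle. specialize (H m). simpl. lra.
Qed.

Lemma real_geom_lim (s : nat -> R) K : (forall n m, (n <= m)%nat -> Rabs (s m - s n) <= K * (/2) ^ n) ->
  forall n, Rabs (real (Lim_seq s) - s n) <= K * (/2) ^ n.
Proof.
  intros H.
  assert (HK : 0 <= K) by (specialize (H O O (Nat.le_refl _)); simpl in H; generalize (Rabs_pos (s O - s O)); lra).
  assert (Hc : ex_lim_seq_cauchy s).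
  { intros eps. destruct (half_pow_lim K (eps / 2)) as [N HN]. destruct eps; simpl; lra.
    exists N. intros n m Hn Hm.
    assert (A := H N n Hn). assert (B := H N m Hm). specialize (HN N (Nat.le_refl _)).
    replace (s n - s m) with ((s n - s N) - (s m - s N)) by ring.
    eapply Rle_lt_trans. apply Rabs_triang. rewrite Rabs_Ropp. lra. }
  apply ex_lim_seq_cauchy_corr in Hc. apply Lim_seq_correct' in Hc.
  intros n.
  assert (Hl : is_lim_seq (fun m => Rabs (s m - s n)) (Rabs (real (Lim_seq s) - s n))).
  { apply (is_lim_seq_abs _ (Finite (real (Lim_seq s) - s n))). apply is_lim_seq_minus'; auto. apply is_lim_seq_const. }
  apply (is_lim_seq_le_loc (fun m => Rabs (s m - s n)) (fun _ => K * (/2)^n) (Rabs (real (Lim_seq s) - s n)) (K * (/2)^n)); auto.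
  - exists n. intros m Hm. apply H. lia.
  - apply is_lim_seq_const.
Qed.

(** The geometric tail gives 2 K for each of the real and imaginary parts; recombining them costs
    sqrt 2, rounded up to 2. *)
Lemma geom_lim (s : nat -> C) K : (forall n, Cmod (s (S n) - s n)%C <= K * (/2) ^ n) ->
  forall n, Cmod (Clim s - s n)%C <= 4 * K * (/2) ^ n.
Proof.
  intros H. assert (Hd := geom_dist s K H).
  assert (HK : 0 <= K) by (specialize (H O); simpl in H; generalize (Cmod_ge_0 (s 1%nat - s O)%C); lra).
  assert (Hd' : forall n m, (n <= m)%nat -> Cmod (s m - s n)%C <= 2 * K * (/2) ^ n).
  { intros n m Hm. eapply Rle_trans. apply Hd; auto. assert (0 < (/2)^m) by (apply pow_lt; lra). nra. }
  intros n.
  assert (H1 := real_geom_lim (fun n => Re (s n)) (2 * K)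
     (fun n m Hm => Rle_trans _ _ _ (re_le_Cmod (s m - s n)%C) (Hd' n m Hm)) n).
  assert (Him : forall c : C, Rabs (Im c) <= Cmod c) by (intros c; eapply Rle_trans; [|apply Rmax_Cmod]; apply Rmax_r).
  assert (H2 := real_geom_lim (fun n => Im (s n)) (2 * K)
     (fun n m Hm => Rle_trans _ _ _ (Him (s m - s n)%C) (Hd' n m Hm)) n).
  eapply Rle_trans. apply Cmod_2Rmax. 
  assert (Hm : Rmax (Rabs (fst (Clim s - s n)%C)) (Rabs (snd (Clim s - s n)%C)) <= 2 * K * (/2)^n).
  { apply Rmax_lub; [exact H1|exact H2]. }
  assert (Hs : sqrt 2 <= 2). { rewrite <- (sqrt_square 2) at 2 by lra. apply sqrt_le_1_alt. lra. }
  assert (0 < sqrt 2) by (apply sqrt_lt_R0; lra).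
  assert (0 <= Rmax (Rabs (fst (Clim s - s n)%C)) (Rabs (snd (Clim s - s n)%C))).
  { eapply Rle_trans. apply Rabs_pos. apply Rmax_l. }
  nra.
Qed.

Lemma triI_FTC F f a b c : (forall z, cderiv F z (f z)) -> contCC f -> triI f a b c = 0.
Proof. intros HF Hf. unfold triI. rewrite !(segI_FTC F f _ _ HF Hf). ring. Qed.

Lemma cderiv_sq z : cderiv (fun z => z * z)%C z (2 * z)%C.
Proof.
  intros eps He. exists eps. split; auto. intros h Hh.
  replace ((z + h) * (z + h) - z * z - 2 * z * h)%C with (h * h)%C by ring. rewrite Cmod_mult.
  apply Rmult_le_compat_r. apply Cmod_ge_0. lra.
Qed.

Lemma cderiv_affine l m z0 z : cderiv (fun z => l + m * (z - z0))%C z m.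
Proof.
  intros eps He. exists 1. split. lra. intros h _.
  replace (l + m * (z + h - z0) - (l + m * (z - z0)) - m * h)%C with (RtoC 0) by ring.
  rewrite Cmod_0. apply Rmult_le_pos. lra. apply Cmod_ge_0.
Qed.

(** A polynomial primitive makes the integral vanish, so that [goursat] may subtract the
    linearisation of f at no cost. *)
Lemma triI_affine z0 l m a b c : triI (fun z => l + m * (z - z0))%C a b c = 0.
Proof.
  apply (triI_FTC (fun z => (l - m * z0) * z + (m * RtoC (/2)) * (z * z))%C).
  - intros z. replace (l + m * (z - z0))%C with ((l - m * z0) * 1 + (m * RtoC (/2)) * (2 * z))%C.
    apply cderiv_plus. apply cderiv_scal, cderiv_id. apply cderiv_scal, cderiv_sq.
    replace (m * RtoC (/2) * (2 * z))%C with (m * (RtoC (/2) * 2) * z)%C by ring.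
    rewrite <- RtoC_mult. replace (/2 * 2) with 1 by field. ring.
  - apply cderiv_cc with (fun _ => m). intros; apply cderiv_affine.
Qed.

Lemma triI_minus f g a b c : contCC f -> contCC g -> triI (fun z => f z - g z)%C a b c = (triI f a b c - triI g a b c)%C.
Proof. intros Hf Hg. unfold triI. rewrite !segI_minus by auto. ring. Qed.

Lemma on_seg_dist (a b z : C) d t : 0 <= t <= 1 -> Cmod (a - z)%C <= d -> Cmod (b - z)%C <= d -> Cmod (a + RtoC t * (b - a) - z)%C <= d.
Proof.
  intros Ht Ha Hb. replace (a + RtoC t * (b - a) - z)%C with (RtoC (1 - t) * (a - z) + RtoC t * (b - z))%C by (rewrite RtoC_minus; ring).
  eapply Rle_trans. apply Cmod_triangle. rewrite !Cmod_mult, !Cmod_R, !Rabs_right by lra. nra.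
Qed.

Lemma goursat f df a b c : (forall z, cderiv f z (df z)) -> triI f a b c = 0.
Proof.
  intros H. assert (Hf : contCC f) by (eapply cderiv_cc; eauto).
  set (T := fun n => Nat.iter n (tstep f) (a, b, c)).
  set (d := Rmax (Cmod (b - a)%C) (Rmax (Cmod (c - b)%C) (Cmod (a - c)%C))).
  assert (Hd : 0 <= d) by (eapply Rle_trans; [apply (Cmod_ge_0 (b - a)%C)|apply Rmax_l]).
  assert (Hs : forall n, tsmall (T n) (d * (/2) ^ n)).
  { induction n. simpl. rewrite Rmult_1_r. unfold d. repeat split. apply Rmax_l.
    eapply Rle_trans; [|apply Rmax_r]. apply Rmax_l. eapply Rle_trans; [|apply Rmax_r]. apply Rmax_r.
    change (T (S n)) with (tstep f (T n)). replace (d * (/2) ^ S n) with (d * (/2)^n / 2) by (simpl; field).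
    now apply tstep_small. }
  assert (Hv : forall n, Cmod (tvert (T (S n)) - tvert (T n))%C <= d * (/2) ^ n).
  { intros n. change (T (S n)) with (tstep f (T n)). destruct (tstep_small f (T n) _ (Hs n)) as [_ B].
    assert (0 < (/2) ^ n) by (apply pow_lt; lra). nra. }
  assert (Hl := geom_lim (fun n => tvert (T n)) d Hv). set (z0 := Clim _) in Hl.
  assert (Hb : forall n, Cmod (triI f a b c) * (/4)^n <= Cmod (trin f (T n))).
  { induction n. simpl. lra. change (T (S n)) with (tstep f (T n)).
    eapply Rle_trans; [|apply tstep_big; exact Hf]. simpl. lra. }
  apply Cmod_eq_0. apply Rle_antisym; [|apply Cmod_ge_0]. apply Rnot_lt_le. intros Hpos.
  (* The three sides contribute at most 15 d^2 eps q^2, against at least q^2 times the modulus of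
     the original integral; this eps makes the former at most half the latter. The summand 1 covers
     d = 0. *)
  set (eps := Cmod (triI f a b c) / (15 * d * d + 1) / 2).
  assert (He : 0 < eps) by (unfold eps; repeat apply Rdiv_lt_0_compat; nra).
  destruct (H z0 eps He) as [delta [Hdelta HD]].
  destruct (half_pow_lim (5 * d) delta Hdelta) as [n Hn]. specialize (Hn n (Nat.le_refl _)).
  specialize (Hb n). specialize (Hs n). specialize (Hl n). cbv beta in Hl. destruct (T n) as [[a' b'] c']. simpl in *.
  destruct Hs as [S1 [S2 S3]]. set (q := (/2) ^ n) in *. assert (Hq : 0 < q) by (apply pow_lt; lra).
  (* By [geom_lim] the point [z0] is within 4 d q of the vertex, and the sides have length at most d
     q: together 5 d q. *)
  assert (Hz : forall w, Cmod (w - a')%C <= d * q -> Cmod (w - z0)%C <= 5 * d * q).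
  { intros w Hw. replace (w - z0)%C with ((w - a') + - (z0 - a'))%C by ring. eapply Rle_trans. apply Cmod_triangle.
    rewrite Cmod_opp. lra. }
  assert (Za : Cmod (a' - z0)%C <= 5 * d * q).
  { apply Hz. replace (a' - a')%C with (RtoC 0) by ring. rewrite Cmod_0. nra. }
  assert (Zb := Hz b' S1). assert (Zc : Cmod (c' - z0)%C <= 5 * d * q) by (apply Hz; rewrite Cmod_sym; auto).
  set (L := fun z => (f z0 + df z0 * (z - z0))%C).
  assert (HcL : contCC L).
  { apply cderiv_cc with (fun _ => df z0). intros; apply cderiv_affine. }
  assert (Ht : triI f a' b' c' = triI (fun z => f z - L z)%C a' b' c').
  { rewrite triI_minus by auto. unfold L. rewrite triI_affine. ring. }
  assert (Hw : forall w, Cmod (w - z0)%C <= 5 * d * q -> Cmod (f w - L w)%C <= eps * (5 * d * q)).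
  { intros w Hw. eapply Rle_trans; [|apply Rmult_le_compat_l; [lra|exact Hw]].
    specialize (HD (w - z0)%C (Rle_lt_trans _ _ _ Hw Hn)). replace (z0 + (w - z0))%C with w in HD by ring.
    replace (f w - L w)%C with (f w - f z0 - df z0 * (w - z0))%C by (unfold L; ring). exact HD. }
  assert (Hseg : forall u v, Cmod (u - z0)%C <= 5 * d * q -> Cmod (v - z0)%C <= 5 * d * q -> Cmod (v - u)%C <= d * q ->
     Cmod (segI (fun z => f z - L z)%C u v) <= (d * q) * (eps * (5 * d * q))).
  { intros u v Hu Hv' Huv. eapply Rle_trans. apply segI_bound with (M := eps * (5 * d * q)). apply contCC_minus; auto.
    intros t Ht'. apply Hw. apply on_seg_dist; auto.
    apply Rmult_le_compat_r; auto. apply Rmult_le_pos. lra. assert (0 <= d * q) by nra. nra. }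
  assert (Hfin : Cmod (triI f a' b' c') <= 3 * ((d * q) * (eps * (5 * d * q)))).
  { rewrite Ht. unfold triI. assert (A := Hseg a' b' Za Zb S1). assert (B := Hseg b' c' Zb Zc S2). assert (D := Hseg c' a' Zc Za S3).
    eapply Rle_trans. apply Cmod_triangle. eapply Rle_trans. apply Rplus_le_compat_r. apply Cmod_triangle. lra. }
  replace ((/4)^n) with (q * q) in Hb by (unfold q; rewrite <- Rpow_mult_distr; f_equal; field).
  assert (Hqq : 0 < q * q) by nra.
  assert (Hfin2 : Cmod (triI f a b c) * (q * q) <= (eps * (15 * d * d)) * (q * q)) by nra.
  apply Rmult_le_reg_r in Hfin2; auto. unfold eps in Hfin2.
  set (X := Cmod (triI f a b c)) in *.
  assert (HX : X / (15 * d * d + 1) / 2 * (15 * d * d) <= X / 2).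
  { replace (X / 2) with (X / (15 * d * d + 1) / 2 * (15 * d * d + 1)) by (field; nra).
    apply Rmult_le_compat_l. apply Rlt_le; exact He. lra. }
  lra.
Qed.

(** By Goursat the increment of the integral from 0 is the integral over the segment from z to z +
    h, which continuity of f compares with f z times h. *)
Lemma primitive f df : (forall z, cderiv f z (df z)) -> forall z, cderiv (segI f 0) z (f z).
Proof.
  intros H. assert (Hf : contCC f) by (eapply cderiv_cc; eauto). intros z eps He.
  destruct (proj1 (contCC_eps f) Hf z eps He) as [d [Hd H1]]. exists d. split; auto. intros h Hh.
  assert (Hg := goursat f df 0 z (z + h)%C H). unfold triI in Hg. rewrite (segI_rev f 0 (z + h)%C Hf) in Hg.
  assert (E : (segI f 0 (z + h) - segI f 0 z)%C = segI f z (z + h)%C).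
  { transitivity (segI f z (z + h) - (segI f 0 z + segI f z (z + h) + - segI f 0 (z + h)))%C. ring. rewrite Hg. ring. }
  rewrite E. 
  assert (E2 : (f z * h)%C = segI (fun _ => f z) z (z + h)%C). { unfold segI. rewrite CInt_const. rewrite Rminus_0_r. ring. }
  rewrite E2, <- segI_minus by (auto; apply contCC_const).
  replace (Cmod h) with (Cmod (z + h - z)%C) by (f_equal; ring). rewrite Rmult_comm.
  apply (segI_bound (fun w => f w - f z)%C). apply contCC_minus; auto; apply contCC_const.
  intros t Ht. left. apply H1. replace (z + h - z)%C with h by ring. rewrite Cmod_mult, Cmod_R, Rabs_right by lra.
  generalize (Cmod_ge_0 h). nra.
Qed.

(** * Cauchy estimates *)

Lemma im_Cmod_le (c : C) : Rabs (Im c) <= Cmod c.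
Proof. eapply Rle_trans; [|apply Rmax_Cmod]; apply Rmax_r. Qed.
Lemma Cmod_le_re_im (c : C) : Cmod c <= Rabs (Re c) + Rabs (Im c).
Proof.
  replace (Cmod c) with (Cmod (RtoC (Re c) + Ci * RtoC (Im c))%C).
  eapply Rle_trans. apply Cmod_triangle. rewrite Cmod_mult, Cmod_Ci, !Cmod_R. lra.
  f_equal. destruct c; apply injective_projections; simpl; ring.
Qed.

Lemma contCC_2d (f : C -> C) (g : C -> R) x y : contCC f -> (forall c d, Rabs (g c - g d) <= Cmod (c - d)%C) ->
  continuity_2d_pt (fun x y => g (f (x, y))) x y.
Proof.
  intros Hf Hg eps. rewrite contCC_eps in Hf. destruct (Hf (x, y) eps (cond_pos eps)) as [d [Hd H]].
  assert (Hd2 : 0 < d / 2) by lra.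
  exists (mkposreal _ Hd2). intros u v Hu Hv. simpl in *.
  eapply Rle_lt_trans. apply Hg. specialize (H ((u, v) - (x, y))%C).
  replace ((x, y) + ((u, v) - (x, y)))%C with ((u, v) : C) in H by (apply injective_projections; simpl; ring).
  apply H. eapply Rle_lt_trans. apply Cmod_le_re_im. simpl. unfold Rminus in *. lra.
Qed.

(** Both parts are uniformly continuous on the square of half-side L + 1, which contains z + h once
    Cmod h < 1. *)
Lemma contCC_unif f : contCC f -> forall L eps, 0 < eps -> exists delta, 0 < delta /\
  forall z h, Cmod z <= L -> Cmod h < delta -> Cmod (f (z + h) - f z)%C < eps.
Proof.
  intros Hf L eps He. assert (He2 : 0 < eps / 2) by lra.
  destruct (uniform_continuity_2d (fun x y => Re (f (x, y))) (-(L+1)) (L+1) (-(L+1)) (L+1)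
    (fun x y _ _ => contCC_2d f Re x y Hf (fun c d => re_le_Cmod (c - d)%C)) (mkposreal _ He2)) as [d1 H1].
  destruct (uniform_continuity_2d (fun x y => Im (f (x, y))) (-(L+1)) (L+1) (-(L+1)) (L+1)
    (fun x y _ _ => contCC_2d f Im x y Hf (fun c d => im_Cmod_le (c - d)%C)) (mkposreal _ He2)) as [d2 H2].
  exists (Rmin 1 (Rmin d1 d2)). split. repeat apply Rmin_pos; try apply cond_pos; lra.
  intros z h Hz Hh.
  assert (Hh0 : Cmod h < 1) by (eapply Rlt_le_trans; [exact Hh|apply Rmin_l]).
  assert (Hh1 : Cmod h < d1) by (eapply Rlt_le_trans; [exact Hh|eapply Rle_trans; [apply Rmin_r|apply Rmin_l]]).
  assert (Hh2 : Cmod h < d2) by (eapply Rlt_le_trans; [exact Hh|eapply Rle_trans; [apply Rmin_r|apply Rmin_r]]).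
  assert (A1 := re_le_Cmod z). assert (A2 := im_Cmod_le z). assert (A3 := re_le_Cmod h). assert (A4 := im_Cmod_le h).
  destruct z as [x y]. destruct h as [u v]. unfold Re, Im in *. simpl in *.
  apply Rabs_le_between in A1, A2, A3, A4.
  assert (Hx : forall t, Rabs t < 1 + L -> - (L + 1) <= t <= L + 1) by (intros t Ht; apply Rabs_lt_between in Ht; lra).
  eapply Rle_lt_trans. apply Cmod_le_re_im.
  assert (B1 := H1 x y (x + u) (y + v)). assert (B2 := H2 x y (x + u) (y + v)). simpl in B1, B2.
  change ((x, y) + (u, v))%C with ((x + u, y + v) : C).
  assert (C1 : Rabs (x + u - x) < d1). { replace (x + u - x) with u by ring. eapply Rle_lt_trans; [apply (re_le_Cmod (u, v))|auto]. }
  assert (C2 : Rabs (y + v - y) < d1). { replace (y + v - y) with v by ring. eapply Rle_lt_trans; [apply (im_Cmod_le (u, v))|auto]. }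
  assert (C3 : Rabs (x + u - x) < d2). { replace (x + u - x) with u by ring. eapply Rle_lt_trans; [apply (re_le_Cmod (u, v))|auto]. }
  assert (C4 : Rabs (y + v - y) < d2). { replace (y + v - y) with v by ring. eapply Rle_lt_trans; [apply (im_Cmod_le (u, v))|auto]. }
  specialize (B1 ltac:(lra) ltac:(lra) ltac:(lra) ltac:(lra) C1 C2).
  specialize (B2 ltac:(lra) ltac:(lra) ltac:(lra) ltac:(lra) C3 C4).
  simpl. unfold Rminus in *. lra.
Qed.

Lemma C1_unif F f : (forall z, cderiv F z (f z)) -> contCC f -> forall L eps, 0 < eps -> exists delta, 0 < delta /\
  forall z h, Cmod z <= L -> Cmod h < delta -> Cmod (F (z + h) - F z - f z * h)%C <= eps * Cmod h.
Proof.
  intros HF Hf L eps He. destruct (contCC_unif f Hf L eps He) as [d [Hd H]]. exists d. split; auto.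
  intros z h Hz Hh. rewrite <- (segI_FTC F f z (z + h)%C HF Hf).
  assert (E2 : (f z * h)%C = segI (fun _ => f z) z (z + h)%C). { unfold segI. rewrite CInt_const. rewrite Rminus_0_r. ring. }
  rewrite E2, <- segI_minus by (auto; apply contCC_const).
  replace (Cmod h) with (Cmod (z + h - z)%C) by (f_equal; ring). rewrite Rmult_comm.
  apply (segI_bound (fun w => f w - f z)%C). apply contCC_minus; auto; apply contCC_const.
  intros t Ht. left. apply H; auto. replace (z + h - z)%C with h by ring. rewrite Cmod_mult, Cmod_R, Rabs_right by lra.
  generalize (Cmod_ge_0 h). nra.
Qed.

(** Differentiation under the integral, with a free path p, direction v and factor q. Taking v =
    [cis] differentiates a circle integral in its radius; taking p = [cis] and v = 1 differentiates
    it in its centre. *)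
Lemma param_deriv F f (p v q : R -> C) L a b : (forall z, cderiv F z (f z)) -> contCC f -> contRC p -> contRC v -> contRC q -> a <= b ->
  (forall t, Cmod (p t) <= L) -> (forall t, Cmod (v t) <= 1) -> (forall t, Cmod (q t) <= 1) ->
  forall h0, cderiv (fun h => CInt (fun t => F (p t + h * v t) * q t) a b)%C h0 (CInt (fun t => f (p t + h0 * v t) * (v t * q t)) a b)%C.
Proof.
  intros HF Hf Hp Hv Hq Hab HL Hv1 Hq1 h0 eps He.
  assert (HcF : contCC F) by (eapply cderiv_cc; eauto).
  assert (He2 : 0 < eps / (b - a + 1)) by (apply Rdiv_lt_0_compat; lra).
  destruct (C1_unif F f HF Hf (L + Cmod h0) _ He2) as [d [Hd H]]. exists d. split; auto. intros h Hh.
  rewrite <- CInt_minus by auto with cont. 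
  replace (CInt (fun t => f (p t + h0 * v t) * (v t * q t)) a b * h)%C with
     (CInt (fun t => h * (f (p t + h0 * v t) * (v t * q t))) a b)%C by (rewrite CInt_mult by auto with cont; ring).
  rewrite <- CInt_minus by auto 8 with cont.
  apply Rle_trans with ((b - a) * (eps / (b - a + 1) * Cmod h)).
  - apply CInt_bound; auto 10 with cont. intros t _.
    replace (F (p t + (h0 + h) * v t) * q t - F (p t + h0 * v t) * q t - h * (f (p t + h0 * v t) * (v t * q t)))%C with
      ((F (p t + h0 * v t + h * v t) - F (p t + h0 * v t) - f (p t + h0 * v t) * (h * v t)) * q t)%C.
    2: { replace (p t + (h0 + h) * v t)%C with (p t + h0 * v t + h * v t)%C by ring. ring. }
    assert (Hhv : Cmod (h * v t)%C <= Cmod h). { rewrite Cmod_mult. specialize (Hv1 t). generalize (Cmod_ge_0 h). nra. }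
    rewrite Cmod_mult. specialize (H (p t + h0 * v t)%C (h * v t)%C).
    assert (B : Cmod (p t + h0 * v t)%C <= L + Cmod h0).
    { eapply Rle_trans. apply Cmod_triangle. rewrite Cmod_mult. specialize (HL t). specialize (Hv1 t). generalize (Cmod_ge_0 h0). nra. }
    specialize (H B ltac:(lra)).
    set (X := Cmod _) in *. specialize (Hq1 t). assert (0 <= X) by apply Cmod_ge_0.
    apply Rle_trans with (X * 1). apply Rmult_le_compat_l; auto. rewrite Rmult_1_r. eapply Rle_trans. exact H.
    apply Rmult_le_compat_l; lra.
  - apply Rle_trans with ((b - a + 1) * (eps / (b - a + 1) * Cmod h)).
    apply Rmult_le_compat_r. apply Rmult_le_pos. lra. apply Cmod_ge_0. lra. right; field; lra.
Qed.

(* Polarization reduces the product rule to the chain rule for [z * z]. *)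
Lemma is_derive_Cmult (f g : R -> C) x df dg :
  is_derive (V := C_R_NormedModule) f x df -> is_derive (V := C_R_NormedModule) g x dg ->
  is_derive (V := C_R_NormedModule) (fun t => f t * g t)%C x (df * g x + f x * dg)%C.
Proof.
  intros Hf Hg.
  assert (Hp := is_derive_plus (V := C_R_NormedModule) _ _ _ _ _ Hf Hg).
  assert (Hm := is_derive_minus (V := C_R_NormedModule) _ _ _ _ _ Hf Hg).
  assert (Hp2 := rderiv_chain _ _ _ _ _ (cderiv_scal (RtoC (/4)) _ _ _ (cderiv_sq _)) Hp).
  assert (Hm2 := rderiv_chain _ _ _ _ _ (cderiv_scal (RtoC (/4)) _ _ _ (cderiv_sq _)) Hm).
  assert (H := is_derive_minus (V := C_R_NormedModule) _ _ _ _ _ Hp2 Hm2).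
  assert (E4 : (RtoC (/4) * RtoC 4)%C = RtoC 1) by (rewrite <- RtoC_mult; f_equal; field).
  assert (E : forall X Y : C, (RtoC (/4) * ((X + Y) * (X + Y)) - RtoC (/4) * ((X - Y) * (X - Y)))%C = (X * Y)%C).
  { intros X Y. transitivity ((RtoC (/4) * RtoC 4) * (X * Y))%C. ring. rewrite E4; ring. }
  replace (df * g x + f x * dg)%C with
    ((df + dg) * (RtoC (/4) * (2 * (f x + g x))) - (df - dg) * (RtoC (/4) * (2 * (f x - g x))))%C.
  - eapply is_derive_ext; [|exact H]. intros t. apply (E (f t) (g t)).
  - transitivity ((RtoC (/4) * RtoC 4) * (df * g x + f x * dg))%C. ring. rewrite E4; ring.
Qed.

(** * Circle averages and Cauchy's formula for the derivative *)

Definition cis (t : R) : C := (cos t, sin t).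

Lemma is_derive_pair (f g : R -> R) x df dg : is_derive f x df -> is_derive g x dg ->
  is_derive (V := C_R_NormedModule) (fun t => (f t, g t)) x ((df, dg) : C).
Proof.
  intros Hf Hg. apply rderiv_is_derive. intros eps He. assert (He2 : 0 < eps / 2) by lra.
  rewrite is_derive_locally in Hf, Hg.
  destruct (Hf (mkposreal _ He2)) as [d1 H1]. destruct (Hg (mkposreal _ He2)) as [d2 H2].
  exists (Rmin d1 d2). split. apply Rmin_pos; apply cond_pos.
  intros h Hh. assert (Hh1 : Rabs (x + h - x) < d1).
  { replace (x + h - x) with h by ring. eapply Rlt_le_trans; [exact Hh|apply Rmin_l]. }
  assert (Hh2 : Rabs (x + h - x) < d2).
  { replace (x + h - x) with h by ring. eapply Rlt_le_trans; [exact Hh|apply Rmin_r]. }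
  specialize (H1 _ Hh1). specialize (H2 _ Hh2).
  change (Rabs (f (x + h) - f x - (x + h - x) * df) <= eps / 2 * Rabs (x + h - x)) in H1.
  change (Rabs (g (x + h) - g x - (x + h - x) * dg) <= eps / 2 * Rabs (x + h - x)) in H2.
  replace (x + h - x) with h in H1, H2 by ring.
  eapply Rle_trans. apply Cmod_le_re_im. simpl.
  replace (f (x + h) + - f x + - (h * df - 0 * dg)) with (f (x + h) - f x - h * df) by ring.
  replace (g (x + h) + - g x + - (h * dg + 0 * df)) with (g (x + h) - g x - h * dg) by ring.
  lra.
Qed.

Lemma cis_derive t : is_derive (V := C_R_NormedModule) cis t (Ci * cis t)%C.
Proof.
  replace (Ci * cis t)%C with ((- sin t, cos t) : C) by (apply injective_projections; simpl; ring).
  apply is_derive_pair; auto_derive; auto; ring.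
Qed.
Lemma cisN_derive t : is_derive (V := C_R_NormedModule) (fun t => Cconj (cis t)) t (- (Ci * Cconj (cis t)))%C.
Proof.
  replace (- (Ci * Cconj (cis t)))%C with ((- sin t, - cos t) : C) by (apply injective_projections; simpl; ring).
  apply (is_derive_pair cos (fun t => - sin t)); auto_derive; auto; ring.
Qed.
Lemma contRC_cis : contRC cis.
Proof. apply contRC_pair; apply contRR_derivable; intros; auto_derive; auto. Qed.
Lemma contRC_cisN : contRC (fun t => Cconj (cis t)).
Proof. apply (contRC_pair cos (fun t => - sin t)); apply contRR_derivable; intros; auto_derive; auto. Qed.
#[export] Hint Resolve contRC_cis contRC_cisN : cont.
Lemma Cmod_cis t : Cmod (cis t) = 1.
Proof. unfold Cmod, cis. simpl. rewrite !Rmult_1_r. rewrite <- sqrt_1 at 1. f_equal. generalize (sin2_cos2 t). unfold Rsqr. lra. Qed.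
Lemma cis_conj t : (cis t * Cconj (cis t) = 1)%C.
Proof. apply injective_projections; simpl. generalize (sin2_cos2 t). unfold Rsqr. lra. ring. Qed.
Lemma cis_2PI : cis (2 * PI) = cis 0.
Proof. unfold cis. now rewrite sin_2PI, cos_2PI, sin_0, cos_0. Qed.
Lemma rderiv_eq (f : R -> C) (x : R) (l m : C) : is_derive (V := C_R_NormedModule) f x l -> l = m ->
  is_derive (V := C_R_NormedModule) f x m.
Proof. intros H <-. exact H. Qed.

Lemma two_pi_pos : 0 < 2 * PI.
Proof. generalize PI_RGT_0; lra. Qed.

(** Up to the factor Ci * rho the integrand is the t-derivative of F (z + rho cis t), which is
    periodic; rho = 0 is treated apart. The trailing factor 1 matches what [param_deriv]
    produces. *)
Lemma circle_avg_0 F f : (forall z, cderiv F z (f z)) -> contCC f -> forall z rho, 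
  (CInt (fun t => f (z + RtoC rho * cis t) * (cis t * 1)) 0 (2 * PI) = 0)%C.
Proof.
  intros HF Hf z rho.
  assert (Hci : forall X, (Ci * X = 0 -> X = 0)%C).
  { intros X HX. replace X with ((- Ci) * (Ci * X))%C. rewrite HX; ring.
    transitivity (- (Ci * Ci) * X)%C. ring. rewrite <- (Cmult_1_l X) at 2. f_equal. apply injective_projections; simpl; ring. }
  destruct (Req_dec rho 0) as [->|Hr].
  - rewrite (CInt_ext _ (fun t => f z * cis t)%C). 2: { intros t. replace (z + 0 * cis t)%C with z by ring. ring. }
    apply Hci. rewrite <- CInt_mult by auto with cont.
    rewrite (CInt_FTC (fun t => f z * cis t)%C).
    + rewrite cis_2PI. ring.
    + intros t. apply rderiv_eq with (0 * cis t + f z * (Ci * cis t))%C; [|ring].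
      apply (is_derive_Cmult (fun _ => f z)). apply (is_derive_const (V := C_R_NormedModule)). apply cis_derive.
    + auto with cont.
  - apply Hci. 
    assert (Hr' : forall X, (RtoC rho * X = 0 -> X = 0)%C).
    { intros X HX. replace X with (RtoC (/ rho) * (RtoC rho * X))%C. rewrite HX; ring.
      rewrite Cmult_assoc, <- RtoC_mult, Rinv_l, Cmult_1_l; auto. }
    apply Hr'. rewrite <- CInt_mult by auto with cont. rewrite <- CInt_mult by auto 8 with cont.
    rewrite (CInt_FTC (fun t => F (z + RtoC rho * cis t)%C)).
    + rewrite cis_2PI. ring.
    + intros t. apply rderiv_eq with (((0 + (0 * cis t + RtoC rho * (Ci * cis t)))) * f (z + RtoC rho * cis t))%C; [|ring].
      apply (rderiv_chain F (fun t => z + RtoC rho * cis t)%C). apply HF.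
      apply (is_derive_plus (V := C_R_NormedModule) (fun _ => z)). apply (is_derive_const (V := C_R_NormedModule)).
      apply (is_derive_Cmult (fun _ => RtoC rho)). apply (is_derive_const (V := C_R_NormedModule)). apply cis_derive.
    + auto 10 with cont.
Qed.

(** The circle integral has derivative 0 in the radius by [circle_avg_0], so its values at radius 0
    and radius 1 agree. *)
Lemma mean_value F f : (forall z, cderiv F z (f z)) -> contCC f -> forall z, 
  (RtoC (2 * PI) * F z = CInt (fun t => F (z + cis t)) 0 (2 * PI))%C.
Proof.
  intros HF Hf z. assert (HcF : contCC F) by (eapply cderiv_cc; eauto).
  set (m := fun rho : R => CInt (fun t => F (z + RtoC rho * cis t) * 1)%C 0 (2 * PI)).
  assert (Hm : m 0 = m 1).
  { apply (eq_is_derive (V := C_R_NormedModule)); [|lra]. intros rho _.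
    assert (H := param_deriv F f (fun _ => z) cis (fun _ => RtoC 1) (Cmod z) 0 (2 * PI) HF Hf (contRC_const z) contRC_cis (contRC_const 1) (Rlt_le _ _ two_pi_pos)
      (fun _ => Rle_refl _) (fun t => Req_le _ _ (Cmod_cis t)) (fun _ => Req_le _ _ Cmod_1) (0 + RtoC rho * 1)%C).
    assert (H2 := rderiv_chain _ (fun t => 0 + RtoC t * 1)%C rho _ _ H (is_derive_line 0 1 rho)). cbv beta in H2.
    replace (0 + RtoC rho * 1)%C with (RtoC rho) in H2 by ring. rewrite (circle_avg_0 F f HF Hf z rho) in H2.
    replace (1 * 0)%C with (RtoC 0) in H2 by ring. eapply is_derive_ext; [|exact H2].
    intros t. unfold m. cbv beta. replace (0 + RtoC t * 1)%C with (RtoC t) by ring. reflexivity. }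
  unfold m in Hm. 
  rewrite (CInt_ext _ (fun _ => F z)) in Hm. 2: { intros t. replace (z + 0 * cis t)%C with z by ring. ring. }
  rewrite CInt_const, Rminus_0_r in Hm. rewrite Hm. apply CInt_ext. intros t. replace (z + 1 * cis t)%C with (z + cis t)%C by ring. ring.
Qed.

Lemma mean_value_deriv F f : (forall z, cderiv F z (f z)) -> contCC f -> forall z, 
  (RtoC (2 * PI) * f z = CInt (fun t => f (z + cis t)) 0 (2 * PI))%C.
Proof.
  intros HF Hf z.
  assert (H := param_deriv F f cis (fun _ => RtoC 1) (fun _ => RtoC 1) 1 0 (2 * PI) HF Hf contRC_cis (contRC_const 1) (contRC_const 1) (Rlt_le _ _ two_pi_pos)
      (fun t => Req_le _ _ (Cmod_cis t)) (fun _ => Req_le _ _ Cmod_1) (fun _ => Req_le _ _ Cmod_1) z).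
  apply (cderiv_ext _ (fun z => RtoC (2 * PI) * F z)%C) in H.
  2: { intros x. rewrite (mean_value F f HF Hf). apply CInt_ext. intros t. replace (cis t + x * 1)%C with (x + cis t)%C by ring. ring. }
  rewrite (cderiv_unique _ _ _ _ (cderiv_scal (RtoC (2 * PI)) _ _ _ (HF z)) H).
  apply CInt_ext. intros t. replace (cis t + z * 1)%C with (z + cis t)%C by ring. ring.
Qed.

(** Integration by parts on the circle: the t-derivative of F (z + cis t) times the conjugate of cis
    t is Ci times the difference of the two integrands, up to sign conventions already absorbed by
    the mean value of f. *)
Lemma deriv_formula F f : (forall z, cderiv F z (f z)) -> contCC f -> forall z, 
  (RtoC (2 * PI) * f z = CInt (fun t => F (z + cis t) * Cconj (cis t)) 0 (2 * PI))%C.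
Proof.
  intros HF Hf z. assert (HcF : contCC F) by (eapply cderiv_cc; eauto).
  rewrite (mean_value_deriv F f HF Hf z). apply Ceq_minus.
  rewrite <- CInt_minus by auto with cont.
  assert (H : CInt (fun t => Ci * (f (z + cis t) - F (z + cis t) * Cconj (cis t)))%C 0 (2 * PI) = 0).
  { rewrite (CInt_FTC (fun t => F (z + cis t) * Cconj (cis t)))%C.
    - rewrite cis_2PI. ring.
    - intros t. apply rderiv_eq with
        (((0 + Ci * cis t) * f (z + cis t)) * Cconj (cis t) + F (z + cis t) * (- (Ci * Cconj (cis t))))%C.
      2: { transitivity (Ci * (f (z + cis t) * (cis t * Cconj (cis t)) - F (z + cis t) * Cconj (cis t)))%C. ring. rewrite cis_conj. ring. }
      apply is_derive_Cmult; [|apply cisN_derive]. apply (rderiv_chain F (fun t => z + cis t)%C). apply HF.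
      apply (is_derive_plus (V := C_R_NormedModule) (fun _ => z)). apply (is_derive_const (V := C_R_NormedModule)). apply cis_derive.
    - auto 10 with cont. }
  rewrite CInt_mult in H by auto with cont.
  set (X := CInt _ _ _) in *. replace X with ((- Ci) * (Ci * X))%C. rewrite H; ring.
  transitivity (- (Ci * Ci) * X)%C. ring. rewrite <- (Cmult_1_l X) at 2. f_equal. apply injective_projections; simpl; ring.
Qed.

(** [deriv_formula] is differentiated under the integral, which involves only F and f. With F a
    primitive of f, this becomes Cauchy's formula for a merely differentiable f. *)
Lemma C1_deriv_formula F f df : (forall z, cderiv F z (f z)) -> contCC f -> (forall z, cderiv f z (df z)) -> forall z,
  (RtoC (2 * PI) * df z = CInt (fun t => f (z + cis t) * Cconj (cis t)) 0 (2 * PI))%C.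
Proof.
  intros HF Hf Hdf z.
  assert (H := param_deriv F f cis (fun _ => RtoC 1) (fun t => Cconj (cis t)) 1 0 (2 * PI) HF Hf contRC_cis (contRC_const 1) contRC_cisN (Rlt_le _ _ two_pi_pos)
      (fun t => Req_le _ _ (Cmod_cis t)) (fun _ => Req_le _ _ Cmod_1) (fun t => Req_le _ _ (eq_trans (Cmod_conj (cis t)) (Cmod_cis t))) z).
  apply (cderiv_ext _ (fun z => RtoC (2 * PI) * f z)%C) in H.
  2: { intros x. rewrite (deriv_formula F f HF Hf). apply CInt_ext. intros t. replace (cis t + x * 1)%C with (x + cis t)%C by ring. ring. }
  rewrite (cderiv_unique _ _ _ _ (cderiv_scal (RtoC (2 * PI)) _ _ _ (Hdf z)) H).
  apply CInt_ext. intros t. replace (cis t + z * 1)%C with (z + cis t)%C by ring. ring.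
Qed.

Lemma Cmult_2pi_cancel (x y : C) : (RtoC (2 * PI) * x = RtoC (2 * PI) * y)%C -> x = y.
Proof.
  intros H. assert (Hp := two_pi_pos).
  assert (E : forall w, (RtoC (/ (2 * PI)) * (RtoC (2 * PI) * w))%C = w).
  { intros w. rewrite Cmult_assoc, <- RtoC_mult, Rinv_l by lra. ring. }
  rewrite <- (E x), <- (E y), H. reflexivity.
Qed.

Section Entire.
Variables (f df : C -> C).
Hypothesis Hdf : forall z, cderiv f z (df z).

Lemma entire_cc : contCC f.
Proof. eapply cderiv_cc; eauto. Qed.

Lemma cauchy_formula z : (RtoC (2 * PI) * df z = CInt (fun t => f (z + cis t) * Cconj (cis t)) 0 (2 * PI))%C.
Proof. apply (C1_deriv_formula (segI f 0) f df); auto. eapply primitive; eauto. apply entire_cc. Qed.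

Lemma cauchy_bound z M : (forall h, Cmod h = 1 -> Cmod (f (z + h)%C) <= M) -> Cmod (df z) <= M.
Proof.
  intros HM. assert (Hp := two_pi_pos). assert (Hc := entire_cc).
  apply Rmult_le_reg_l with (2 * PI); auto.
  replace (2 * PI * Cmod (df z)) with (Cmod (RtoC (2 * PI) * df z)%C).
  2: { rewrite Cmod_mult, Cmod_R, Rabs_right by lra. reflexivity. }
  rewrite cauchy_formula. replace (2 * PI * M) with ((2 * PI - 0) * M) by ring.
  apply CInt_bound; auto with cont. lra. intros t _. rewrite Cmod_mult, Cmod_conj, Cmod_cis, Rmult_1_r.
  apply HM. apply Cmod_cis.
Qed.

(** Cauchy's formula expresses df by values of f on unit circles, where f is uniformly
    continuous. *)
Lemma deriv_cc : contCC df.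
Proof.
  apply contCC_eps. intros z eps He. assert (Hp := two_pi_pos). assert (Hc := entire_cc).
  destruct (contCC_unif f Hc (Cmod z + 1) (eps / 2) ltac:(lra)) as [d [Hd H]].
  exists d. split; auto. intros h Hh. apply Rmult_lt_reg_l with (2 * PI); auto.
  replace (2 * PI * Cmod (df (z + h) - df z)%C) with (Cmod (RtoC (2 * PI) * df (z + h) - RtoC (2 * PI) * df z)%C).
  2: { replace (RtoC (2 * PI) * df (z + h) - RtoC (2 * PI) * df z)%C with (RtoC (2 * PI) * (df (z + h) - df z))%C by ring.
       rewrite Cmod_mult, Cmod_R, Rabs_right by lra. reflexivity. }
  rewrite !cauchy_formula. rewrite <- CInt_minus by auto with cont.
  apply Rle_lt_trans with ((2 * PI - 0) * (eps / 2)); [|nra]. apply CInt_bound. auto 10 with cont. lra.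
  intros t _. replace (f (z + h + cis t) * Cconj (cis t) - f (z + cis t) * Cconj (cis t))%C with
    ((f (z + cis t + h) - f (z + cis t)) * Cconj (cis t))%C by (replace (z + h + cis t)%C with (z + cis t + h)%C by ring; ring).
  rewrite Cmod_mult, Cmod_conj, Cmod_cis, Rmult_1_r. left. apply H; auto.
  eapply Rle_trans. apply Cmod_triangle. rewrite Cmod_cis. lra.
Qed.

(** Now that df is known to be continuous, [param_deriv] applies to f itself and differentiates
    Cauchy's formula in the centre. *)
Lemma deriv_deriv : exists ddf, forall z, cderiv df z (ddf z).
Proof.
  set (ddf := fun z => (RtoC (/ (2 * PI)) * CInt (fun t => df (cis t + z * 1) * (1 * Cconj (cis t))) 0 (2 * PI))%C).
  assert (Hp := two_pi_pos). exists ddf. intros z.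
  assert (H := param_deriv f df cis (fun _ => RtoC 1) (fun t => Cconj (cis t)) 1 0 (2 * PI) Hdf deriv_cc contRC_cis (contRC_const 1) contRC_cisN (Rlt_le _ _ two_pi_pos)
      (fun t => Req_le _ _ (Cmod_cis t)) (fun _ => Req_le _ _ Cmod_1) (fun t => Req_le _ _ (eq_trans (Cmod_conj (cis t)) (Cmod_cis t))) z).
  apply (cderiv_scal (RtoC (/ (2 * PI)))) in H. eapply cderiv_ext; [|exact H].
  intros x. apply Cmult_2pi_cancel. cbv beta. rewrite Cmult_assoc, <- RtoC_mult, Rinv_r, Cmult_1_l by lra.
  rewrite cauchy_formula. apply CInt_ext. intros t. replace (cis t + x * 1)%C with (x + cis t)%C by ring. reflexivity.
Qed.

Lemma entire_mvt z h M : (forall t, 0 <= t <= 1 -> Cmod (df (z + RtoC t * h)%C) <= M) -> Cmod (f (z + h) - f z)%C <= Cmod h * M.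
Proof.
  intros HM. rewrite <- (segI_FTC f df z (z + h)%C Hdf deriv_cc).
  replace (Cmod h) with (Cmod (z + h - z)%C) by (f_equal; ring). apply segI_bound. apply deriv_cc.
  intros t Ht. replace (z + h - z)%C with h by ring. auto.
Qed.

End Entire.

(** The mean value inequality is used twice: for w |-> f w - df z * w, and then for df to bound its
    derivative df w - df z. *)
Lemma entire_taylor f df ddf z h M : (forall z, cderiv f z (df z)) -> (forall z, cderiv df z (ddf z)) ->
  (forall t, 0 <= t <= 1 -> Cmod (ddf (z + RtoC t * h)%C) <= M) -> Cmod (f (z + h) - f z - df z * h)%C <= Cmod h * (Cmod h * M).
Proof.
  intros H1 H2 HM.
  assert (HM0 : 0 <= M) by (specialize (HM 0 ltac:(lra)); eapply Rle_trans; [apply Cmod_ge_0|exact HM]).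
  replace (f (z + h) - f z - df z * h)%C with ((f (z + h) - df z * (z + h)) - (f z - df z * z))%C by ring.
  apply (entire_mvt (fun w => f w - df z * w)%C (fun w => df w - df z * 1)%C).
  - intros w. apply cderiv_minus. apply H1. apply cderiv_scal, cderiv_id.
  - intros t Ht. replace (df (z + RtoC t * h) - df z * 1)%C with (df (z + RtoC t * h) - df z)%C by ring.
    eapply Rle_trans. apply (entire_mvt df ddf H2 z (RtoC t * h)%C M).
    + intros s Hs. replace (z + RtoC s * (RtoC t * h))%C with (z + RtoC (s * t) * h)%C by (rewrite RtoC_mult; ring).
      apply HM. nra.
    + rewrite Cmod_mult, Cmod_R, Rabs_right by lra. apply Rmult_le_compat_r; auto. generalize (Cmod_ge_0 h); nra.
Qed.

(** * Integrals over the real line and the Gamma kernel *)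

(** The ends move independently, as in the two-sided convergence demanded by [is_Laplace]. *)
Definition lineCI (f : R -> C) (l : C) : Prop :=
  forall eps, 0 < eps -> exists N, 0 <= N /\ forall a b, a < - N -> N < b -> Cmod (CInt f a b - l)%C < eps.
Definition lineRI (f : R -> R) (l : R) : Prop :=
  forall eps, 0 < eps -> exists N, 0 <= N /\ forall a b, a < - N -> N < b -> Rabs (RInt f a b - l) < eps.

Lemma contRR_ex_RInt f a b : contRR f -> ex_RInt f a b.
Proof. intros H. apply (ex_RInt_continuous (V := R_CompleteNormedModule)). intros; apply H. Qed.

Lemma CInt_RtoC f a b : contRR f -> CInt (fun x => RtoC (f x)) a b = RtoC (RInt f a b).
Proof.
  intros H. apply CInt_unique. apply (is_RInt_fct_extend_pair (U := R_NormedModule) (V := R_NormedModule)).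
  - simpl. apply (RInt_correct (V := R_CompleteNormedModule)). now apply contRR_ex_RInt.
  - assert (Hz := is_RInt_const (V := R_NormedModule) a b 0).
    assert (E : scal (b - a) (0 : R_NormedModule) = 0) by (apply Rmult_0_r). rewrite E in Hz. exact Hz.
Qed.

Lemma lineCI_ext f g l : (forall x, f x = g x) -> lineCI f l -> lineCI g l.
Proof.
  intros H Hf eps He. destruct (Hf eps He) as [N [HN H1]]. exists N. split; [exact HN|]. intros a b Ha Hb.
  rewrite <- (CInt_ext f g) by auto. auto.
Qed.

Lemma lineCI_unique f l m : lineCI f l -> lineCI f m -> l = m.
Proof.
  intros Hl Hm. apply Ceq_minus. apply Cmod_eq_0. apply Rle_antisym; [|apply Cmod_ge_0].
  apply Rnot_lt_le. intros Hp. set (e := Cmod (l - m)%C) in *.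
  destruct (Hl (e / 2) ltac:(lra)) as [N [HN H1]]. destruct (Hm (e / 2) ltac:(lra)) as [N' [HN' H2]].
  specialize (H1 (- (N + N' + 1)) (N + N' + 1) ltac:(lra) ltac:(lra)).
  specialize (H2 (- (N + N' + 1)) (N + N' + 1) ltac:(lra) ltac:(lra)).
  set (X := CInt _ _ _) in *. assert (e <= Cmod (X - l)%C + Cmod (X - m)%C); [|lra].
  unfold e. replace (l - m)%C with (- (X - l) + (X - m))%C by ring. rewrite <- (Cmod_opp (X - l)%C). apply Cmod_triangle.
Qed.

Lemma lineCI_plus f g l m : contRC f -> contRC g -> lineCI f l -> lineCI g m -> lineCI (fun x => f x + g x)%C (l + m)%C.
Proof.
  intros Hf Hg Hl Hm eps He.
  destruct (Hl (eps / 2) ltac:(lra)) as [N [HN H1]]. destruct (Hm (eps / 2) ltac:(lra)) as [N' [HN' H2]].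
  exists (N + N'). split. lra. intros a b Ha Hb.
  specialize (H1 a b ltac:(lra) ltac:(lra)). specialize (H2 a b ltac:(lra) ltac:(lra)).
  rewrite CInt_plus by auto. replace (CInt f a b + CInt g a b - (l + m))%C with ((CInt f a b - l) + (CInt g a b - m))%C by ring.
  eapply Rle_lt_trans. apply Cmod_triangle. lra.
Qed.

Lemma lineCI_mult c f l : contRC f -> lineCI f l -> lineCI (fun x => c * f x)%C (c * l)%C.
Proof.
  intros Hf Hl eps He. assert (Hc := Cmod_ge_0 c).
  destruct (Hl (eps / (Cmod c + 1))) as [N [HN H1]]. apply Rdiv_lt_0_compat; lra.
  exists N. split; auto. intros a b Ha Hb. specialize (H1 a b Ha Hb). rewrite CInt_mult by auto.
  replace (c * CInt f a b - c * l)%C with (c * (CInt f a b - l))%C by ring. rewrite Cmod_mult.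
  apply Rle_lt_trans with ((Cmod c + 1) * Cmod (CInt f a b - l)%C).
  apply Rmult_le_compat_r. apply Cmod_ge_0. lra.
  apply Rmult_lt_compat_l with (r := Cmod c + 1) in H1; [|lra].
  replace ((Cmod c + 1) * (eps / (Cmod c + 1))) with eps in H1 by (field; lra). exact H1.
Qed.

Lemma lineCI_minus f g l m : contRC f -> contRC g -> lineCI f l -> lineCI g m -> lineCI (fun x => f x - g x)%C (l - m)%C.
Proof.
  intros Hf Hg Hl Hm. apply (lineCI_ext (fun x => f x + (-1) * g x)%C). intros; ring.
  replace (l - m)%C with (l + (-1) * m)%C by ring. apply lineCI_plus; auto with cont. now apply lineCI_mult.
Qed.

Lemma lineRI_GI f l : contRR f -> (lineRI f l <-> lineCI (fun x => RtoC (f x)) (RtoC l)).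
Proof.
  intros Hf. split; intros H eps He; destruct (H eps He) as [N [HN H1]]; exists N; split; auto; intros a b Ha Hb;
    specialize (H1 a b Ha Hb); rewrite CInt_RtoC, <- RtoC_minus, Cmod_R in *; auto.
Qed.

Lemma lineCI_GR f l : contRR f -> lineCI (fun x => RtoC (f x)) l -> lineRI f (Re l).
Proof.
  intros Hf H eps He. destruct (H eps He) as [N [HN H1]]. exists N; split; auto. intros a b Ha Hb.
  specialize (H1 a b Ha Hb). rewrite CInt_RtoC in H1 by auto. eapply Rle_lt_trans; [|exact H1].
  exact (re_le_Cmod (RtoC (RInt f a b) - l)%C).
Qed.

Lemma C_cauchy (s : nat -> C) : (forall eps, 0 < eps -> exists N, forall n m, (N <= n)%nat -> (N <= m)%nat -> Cmod (s n - s m)%C < eps) ->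
  exists l, forall eps, 0 < eps -> exists N, forall n, (N <= n)%nat -> Cmod (s n - l)%C < eps.
Proof.
  intros H.
  assert (Hr : ex_lim_seq_cauchy (fun n => Re (s n))).
  { intros eps. destruct (H eps (cond_pos eps)) as [N HN]. exists N. intros n m Hn Hm.
    eapply Rle_lt_trans; [|exact (HN n m Hn Hm)]. exact (re_le_Cmod (s n - s m)%C). }
  assert (Hi : ex_lim_seq_cauchy (fun n => Im (s n))).
  { intros eps. destruct (H eps (cond_pos eps)) as [N HN]. exists N. intros n m Hn Hm.
    eapply Rle_lt_trans; [|exact (HN n m Hn Hm)]. exact (im_Cmod_le (s n - s m)%C). }
  apply ex_lim_seq_cauchy_corr, Lim_seq_correct', is_lim_seq_spec in Hr, Hi.
  exists (Clim s). intros eps He. assert (He2 : 0 < eps / 2) by lra.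
  destruct (Hr (mkposreal _ He2)) as [N1 H1]. destruct (Hi (mkposreal _ He2)) as [N2 H2].
  exists (N1 + N2)%nat. intros n Hn. specialize (H1 n ltac:(lia)). specialize (H2 n ltac:(lia)). simpl in H1, H2.
  eapply Rle_lt_trans. apply Cmod_le_re_im.
  change (Rabs (Re (s n) - real (Lim_seq (fun n => Re (s n)))) + Rabs (Im (s n) - real (Lim_seq (fun n => Im (s n)))) < eps).
  lra.
Qed.

Lemma CInt_dom f v a b : contRC f -> contRR v -> (forall x, Cmod (f x) <= v x) -> Cmod (CInt f a b) <= Rabs (RInt v a b).
Proof.
  intros Hf Hv H.
  assert (Hle : forall a b, a <= b -> Cmod (CInt f a b) <= RInt v a b).
  { intros a' b' Hab. rewrite Cmod_norm. apply (norm_RInt_le (V := C_R_NormedModule) f v a' b'); auto.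
    intros x _. rewrite <- Cmod_norm. apply H. now apply CInt_correct.
    apply (RInt_correct (V := R_CompleteNormedModule)). now apply contRR_ex_RInt. }
  destruct (Rle_or_lt a b) as [Hab|Hab].
  - eapply Rle_trans. now apply Hle. apply Rle_abs.
  - rewrite (CInt_swap f b a) by auto. rewrite Cmod_opp. eapply Rle_trans. apply Hle; lra.
    assert (E := opp_RInt_swap (V := R_CompleteNormedModule) v a b (contRR_ex_RInt v a b Hv)).
    change (- RInt v a b = RInt v b a) in E. rewrite <- E, <- Rabs_Ropp. apply Rle_abs.
Qed.

Lemma RInt_split v a b c : contRR v -> RInt v a b + RInt v b c = RInt v a c.
Proof. intros Hv. apply (RInt_Chasles (V := R_CompleteNormedModule)); now apply contRR_ex_RInt. Qed.

Lemma lineCI_dom f v L : contRC f -> contRR v -> (forall x, Cmod (f x) <= v x) -> lineRI v L -> exists l, lineCI f l /\ Cmod l <= L.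
Proof.
  intros Hf Hv H HL.
  assert (Hc : forall eps, 0 < eps -> exists N, 0 <= N /\ forall a b a' b', a < - N -> N < b -> a' < -N -> N < b' ->
     Cmod (CInt f a b - CInt f a' b')%C < eps).
  (* Each of the two tails is dominated by the difference of two integrals of v, both within eps / 4
     of L. *)
  { intros eps He. destruct (HL (eps / 4) ltac:(lra)) as [N [HN H1]]. exists N. split; auto.
    intros a b a' b' Ha Hb Ha' Hb'.
    replace (CInt f a b - CInt f a' b')%C with (CInt f a a' + CInt f b' b)%C.
    2: { rewrite <- (CInt_Chasles f a a' b), <- (CInt_Chasles f a' b' b) by auto. ring. }
    eapply Rle_lt_trans. apply Cmod_triangle.
    assert (A := CInt_dom f v a a' Hf Hv H). assert (B := CInt_dom f v b' b Hf Hv H).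
    assert (D1 := H1 a b Ha Hb). assert (D2 := H1 a' b Ha' Hb). assert (D3 := H1 a b' Ha Hb').
    assert (E1 := RInt_split v a a' b Hv). assert (E2 := RInt_split v a b' b Hv).
    replace (RInt v a a') with ((RInt v a b - L) - (RInt v a' b - L)) in A by lra.
    replace (RInt v b' b) with ((RInt v a b - L) - (RInt v a b' - L)) in B by lra.
    generalize (Rabs_triang (RInt v a b - L) (- (RInt v a' b - L))) (Rabs_triang (RInt v a b - L) (- (RInt v a b' - L))).
    rewrite !Rabs_Ropp. unfold Rminus in *. lra. }
  destruct (C_cauchy (fun n => CInt f (- (INR n + 1)) (INR n + 1))) as [l Hl].
  { intros eps He. destruct (Hc eps He) as [N [HN H1]]. destruct (INR_unbounded N) as [n Hn].
    exists n. intros p q Hp Hq. apply le_INR in Hp, Hq. apply H1; lra. }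
  assert (HG : lineCI f l).
  { intros eps He. destruct (Hc (eps / 2) ltac:(lra)) as [N [HN H1]]. destruct (Hl (eps / 2) ltac:(lra)) as [M HM].
    exists N. split; auto. intros a b Ha Hb. destruct (INR_unbounded N) as [n Hn].
    specialize (HM (n + M)%nat ltac:(lia)). rewrite plus_INR in HM. assert (HM0 := pos_INR M).
    specialize (H1 a b (- (INR n + INR M + 1)) (INR n + INR M + 1) Ha Hb ltac:(lra) ltac:(lra)).
    eapply Rle_lt_trans.
    replace (CInt f a b - l)%C with ((CInt f a b - CInt f (- (INR n + INR M + 1)) (INR n + INR M + 1)) + (CInt f (- (INR n + INR M + 1)) (INR n + INR M + 1) - l))%C by ring.
    apply Cmod_triangle. lra. }
  exists l. split; auto. apply Rnot_lt_le. intros Hlt. set (e := (Cmod l - L) / 2).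
  assert (He : 0 < e) by (unfold e; lra).
  destruct (HG e He) as [N [HN H1]]. destruct (HL e He) as [N' [HN' H2]].
  specialize (H1 (- (N + N' + 1)) (N + N' + 1) ltac:(lra) ltac:(lra)).
  specialize (H2 (- (N + N' + 1)) (N + N' + 1) ltac:(lra) ltac:(lra)).
  assert (A := CInt_dom f v (- (N + N' + 1)) (N + N' + 1) Hf Hv H). set (X := CInt _ _ _) in *. set (Y := RInt _ _ _) in *.
  assert (B : 0 <= Y). { unfold Y. apply RInt_ge_0. lra. now apply contRR_ex_RInt. intros x _. eapply Rle_trans; [apply Cmod_ge_0|apply H]. }
  rewrite Rabs_right in A by lra. assert (D := Cmod_triangle' l X). rewrite Cmod_sym in D.
  apply Rabs_lt_between in H2. unfold e in *. lra.
Qed.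

Lemma lineRI_dom f v L : contRR f -> contRR v -> (forall x, Rabs (f x) <= v x) -> lineRI v L -> exists l, lineRI f l /\ Rabs l <= L.
Proof.
  intros Hf Hv H HL. destruct (lineCI_dom (fun x => RtoC (f x)) v L) as [l [H1 H2]]; auto with cont.
  intros x. rewrite Cmod_R. auto. exists (Re l). split. now apply lineCI_GR. eapply Rle_trans. apply re_le_Cmod. auto.
Qed.

Lemma lineRI_unique f l m : lineRI f l -> lineRI f m -> l = m.
Proof.
  intros Hl Hm. destruct (Req_dec l m) as [|Hn]; auto. exfalso.
  assert (He : 0 < Rabs (l - m)) by (apply Rabs_pos_lt; lra). set (e := Rabs (l - m)) in *.
  destruct (Hl (e / 2) ltac:(lra)) as [N [HN H1]]. destruct (Hm (e / 2) ltac:(lra)) as [N' [HN' H2]].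
  specialize (H1 (- (N + N' + 1)) (N + N' + 1) ltac:(lra) ltac:(lra)).
  specialize (H2 (- (N + N' + 1)) (N + N' + 1) ltac:(lra) ltac:(lra)).
  set (X := RInt _ _ _) in *. assert (e <= Rabs (X - l) + Rabs (X - m)); [|lra].
  unfold e. replace (l - m) with (- (X - l) + (X - m)) by ring. rewrite <- (Rabs_Ropp (X - l)). apply Rabs_triang.
Qed.

Lemma lineRI_plus f g l m : contRR f -> contRR g -> lineRI f l -> lineRI g m -> lineRI (fun x => f x + g x) (l + m).
Proof.
  intros Hf Hg Hl Hm. apply lineRI_GI; auto with cont. apply lineRI_GI in Hl; [|exact Hf]. apply lineRI_GI in Hm; [|exact Hg]. rewrite RtoC_plus.
  apply (lineCI_ext (fun x => RtoC (f x) + RtoC (g x))%C). intros; now rewrite RtoC_plus. apply lineCI_plus; auto with cont.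
Qed.
Lemma lineRI_scal c f l : contRR f -> lineRI f l -> lineRI (fun x => c * f x) (c * l).
Proof.
  intros Hf Hl. apply lineRI_GI; auto with cont. apply lineRI_GI in Hl; [|exact Hf]. rewrite RtoC_mult.
  apply (lineCI_ext (fun x => RtoC c * RtoC (f x))%C). intros; now rewrite RtoC_mult. apply lineCI_mult; auto with cont.
Qed.
Lemma lineRI_ext f g l : (forall x, f x = g x) -> lineRI f l -> lineRI g l.
Proof.
  intros H Hf eps He. destruct (Hf eps He) as [N [HN H1]]. exists N. split; auto. intros a b Ha Hb.
  rewrite <- (RInt_ext f g) by auto. auto.
Qed.

Lemma lineCI_FTC (P p : R -> C) (v : R -> R) : (forall x, is_derive (V := C_R_NormedModule) P x (p x)) -> contRC p ->
  (forall x, Cmod (P x) <= v x) -> (forall eps, 0 < eps -> exists N, 0 <= N /\ forall x, N < Rabs x -> v x < eps) -> lineCI p 0.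
Proof.
  intros HP Hp Hv Hlim eps He. destruct (Hlim (eps / 2) ltac:(lra)) as [N [HN H]]. exists N. split; auto.
  intros a b Ha Hb. rewrite (CInt_FTC P p a b HP Hp).
  replace (P b - P a - 0)%C with (P b - P a)%C by ring. eapply Rle_lt_trans. apply Cmod_triangle_minus.
  assert (A := H a). assert (B := H b). rewrite Rabs_left in A by lra. rewrite Rabs_right in B by lra.
  specialize (A ltac:(lra)). specialize (B ltac:(lra)). generalize (Hv a) (Hv b). lra.
Qed.

(** * The Gamma integrand t^(g-1) exp (-t) dt after t = exp x, and the Gamma function *)

Definition gker (g x : R) : R := exp (g * x - exp x).

Lemma gker_pos g x : 0 < gker g x.
Proof. apply exp_pos. Qed.
Lemma contRR_exp f : contRR f -> contRR (fun x => exp (f x)).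
Proof. intros H x. apply (continuous_comp f exp). apply H. apply (ex_derive_continuous exp). auto_derive; auto. Qed.
#[export] Hint Resolve contRR_exp : cont.
Lemma contRR_k g : contRR (gker g).
Proof. unfold gker. auto with cont. Qed.
#[export] Hint Resolve contRR_k : cont.
Lemma contRC_k g : contRC (fun x => RtoC (gker g x)).
Proof. auto with cont. Qed.
#[export] Hint Resolve contRC_k : cont.
Lemma gker_plus g d x : gker (g + d) x = exp (d * x) * gker g x.
Proof. unfold gker. rewrite <- exp_plus. f_equal. ring. Qed.

(** The maximum is at x = ln g; the tangent to exp there gives the inequality. *)
Lemma gker_bound g x : 0 < g -> gker g x <= exp (g * ln g - g).
Proof.
  intros Hg. unfold gker.
  assert (H : g * (1 + (x - ln g)) <= exp x).
  { replace (exp x) with (g * exp (x - ln g)). apply Rmult_le_compat_l. lra. apply exp_ineq1_le.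
    unfold Rminus. rewrite exp_plus, exp_Ropp, exp_ln by auto. field; lra. }
  destruct (Req_dec (g * x - exp x) (g * ln g - g)) as [->|]. lra. left. apply exp_increasing. nra.
Qed.

(** On the left exp (g x) decays; on the right [gker g] is exp (- x) times the bounded function
    [gker (g + 1)]. *)
Lemma gker_lim g : 0 < g -> forall eps, 0 < eps -> exists N, 0 <= N /\ forall x, N < Rabs x -> gker g x < eps.
Proof.
  intros Hg eps He. set (M := exp ((g + 1) * ln (g + 1) - (g + 1))). assert (HM : 0 < M) by apply exp_pos.
  set (N1 := Rabs (ln eps / g)). set (N2 := Rabs (ln (M / eps))).
  exists (N1 + N2). assert (P1 : 0 <= N1) by apply Rabs_pos. assert (P2 : 0 <= N2) by apply Rabs_pos. split. lra.
  intros x Hx. destruct (Rle_or_lt 0 x) as [H|H].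
  - rewrite Rabs_right in Hx by lra.
    assert (E : gker g x = exp (- x) * gker (g + 1) x) by (rewrite gker_plus, <- Rmult_assoc, <- exp_plus; replace (- x + 1 * x) with 0 by ring; rewrite exp_0; ring).
    rewrite E. assert (A := gker_bound (g + 1) x ltac:(lra)). fold M in A.
    apply Rle_lt_trans with (exp (- x) * M). apply Rmult_le_compat_l; auto. left; apply exp_pos.
    assert (B : exp (- x) < eps / M).
    { rewrite <- (exp_ln (eps / M)) by (apply Rdiv_lt_0_compat; lra). apply exp_increasing.
      rewrite ln_div by auto. assert (D := Rle_abs (ln (M / eps))). fold N2 in D. rewrite ln_div in D by auto. lra. }
    apply Rmult_lt_compat_r with (r := M) in B; auto. replace (eps / M * M) with eps in B by (field; lra). auto.
  - rewrite Rabs_left in Hx by lra. unfold gker. apply Rlt_trans with (exp (g * x)).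
    apply exp_increasing. generalize (exp_pos x); lra.
    rewrite <- (exp_ln eps) at 1 by auto. apply exp_increasing.
    assert (D : - (ln eps / g) <= N1) by (unfold N1; rewrite <- Rabs_Ropp; apply Rle_abs).
    assert (x < ln eps / g) by lra. apply Rmult_lt_compat_l with (r := g) in H0; auto.
    replace (g * (ln eps / g)) with (ln eps) in H0 by (field; lra). auto.
Qed.

(* Up to a constant, [gker g] is dominated by the derivative of this logistic function. *)
Definition lgs (g x : R) : R := - / (1 + exp (g * x)).
Definition dlgs (g x : R) : R := g * exp (g * x) * / (1 + exp (g * x)) * / (1 + exp (g * x)).

Lemma contRR_inv f : contRR f -> (forall x, 0 < f x) -> contRR (fun x => / f x).
Proof. intros H Hp x. apply (continuous_comp f Rinv). apply H. apply (continuous_Rinv (f x)). specialize (Hp x); lra. Qed.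

Lemma contRR_dlgs g : contRR (dlgs g).
Proof. unfold dlgs. assert (contRR (fun x => / (1 + exp (g * x)))). apply contRR_inv. auto with cont. intros x; generalize (exp_pos (g * x)); lra.
  auto 10 with cont. Qed.

Lemma lineRI_dlgs g : 0 < g -> lineRI (dlgs g) 1.
Proof.
  intros Hg eps He. set (N := Rabs (ln (eps / 2) / g)). assert (HN : 0 <= N) by apply Rabs_pos. exists N. split; auto.
  intros a b Ha Hb.
  assert (E : RInt (dlgs g) a b = lgs g b - lgs g a).
  { apply is_RInt_unique. apply (is_RInt_derive (V := R_CompleteNormedModule) (lgs g) (dlgs g)).
    - intros x _. unfold lgs, dlgs. assert (0 < exp (g * x)) by apply exp_pos. auto_derive. lra. field. lra.
    - intros x _. apply contRR_dlgs. }
  rewrite E. unfold lgs.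
  assert (D : - (ln (eps / 2) / g) <= N) by (unfold N; rewrite <- Rabs_Ropp; apply Rle_abs).
  assert (HA : exp (g * a) < eps / 2).
  { rewrite <- (exp_ln (eps / 2)) by lra. apply exp_increasing.
    assert (H0 : a < ln (eps / 2) / g) by lra. apply Rmult_lt_compat_l with (r := g) in H0; auto.
    replace (g * (ln (eps / 2) / g)) with (ln (eps / 2)) in H0 by (field; lra). auto. }
  assert (HB : exp (- (g * b)) < eps / 2).
  { rewrite <- (exp_ln (eps / 2)) by lra. apply exp_increasing.
    assert (H0 : - b < ln (eps / 2) / g) by lra. apply Rmult_lt_compat_l with (r := g) in H0; auto.
    replace (g * (ln (eps / 2) / g)) with (ln (eps / 2)) in H0 by (field; lra). lra. }
  assert (P1 := exp_pos (g * a)). assert (P2 := exp_pos (g * b)).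
  assert (Q1 : / (1 + exp (g * b)) < eps / 2).
  { eapply Rlt_trans; [|exact HB]. rewrite exp_Ropp. apply Rinv_lt_contravar. nra. lra. }
  assert (Q2 : 0 < / (1 + exp (g * b))) by (apply Rinv_0_lt_compat; lra).
  assert (Q3 : 1 - exp (g * a) <= / (1 + exp (g * a))).
  { apply Rmult_le_reg_r with (1 + exp (g * a)). lra. rewrite Rinv_l by lra. nra. }
  assert (Q4 : / (1 + exp (g * a)) <= 1). { rewrite <- Rinv_1. apply Rinv_le_contravar; lra. }
  apply Rabs_def1; lra.
Qed.

(** With y = exp (g x) and w = exp (- exp x) it suffices to bound w (1 + y)^2 <= 2 w + 2 w y^2. Here
    w <= 1, and w y^2 is [gker (2 * g)], hence at most [B]. *)
Lemma gker_dlgs g : 0 < g -> exists M, 0 < M /\ forall x, gker g x <= M * dlgs g x.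
Proof.
  intros Hg. set (B := exp (2 * g * ln (2 * g) - 2 * g)). assert (HB : 0 < B) by apply exp_pos.
  exists ((2 + 2 * B) / g). split. apply Rdiv_lt_0_compat; lra. intros x.
  assert (A := gker_bound (2 * g) x ltac:(lra)). fold B in A. set (y := exp (g * x)). assert (Hy : 0 < y) by apply exp_pos.
  set (w := exp (- exp x)). assert (Hw : 0 < w) by apply exp_pos.
  assert (Hw1 : w <= 1). { unfold w. rewrite <- exp_0. left. apply exp_increasing. generalize (exp_pos x); lra. }
  assert (E1 : gker g x = y * w). { unfold gker, y, w. rewrite <- exp_plus. f_equal. }
  assert (E2 : gker (2 * g) x = y * y * w). { unfold gker, y, w. rewrite <- !exp_plus. f_equal. ring. }
  rewrite E2 in A. rewrite E1. unfold dlgs. fold y.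
  replace ((2 + 2 * B) / g * (g * y * / (1 + y) * / (1 + y))) with (y * ((2 + 2 * B) * / ((1 + y) * (1 + y)))) by (field; lra).
  apply Rmult_le_compat_l. lra. apply Rmult_le_reg_r with ((1 + y) * (1 + y)). nra.
  rewrite Rmult_assoc, Rinv_l by nra. assert (H0 : 0 <= w * ((1 - y) * (1 - y))) by (apply Rmult_le_pos; [lra|apply Rle_0_sqr]). lra.
Qed.

(** Euler's Gamma function for g > 0, where [lineRI_k] shows that the integral converges. *)
Definition Gam (g : R) : R := epsilon (inhabits 0) (lineRI (gker g)).
Lemma lineRI_k g : 0 < g -> lineRI (gker g) (Gam g).
Proof.
  intros Hg. apply (epsilon_spec (inhabits 0) (lineRI (gker g))).
  destruct (gker_dlgs g Hg) as [M [HM H]]. destruct (lineRI_dom (gker g) (fun x => M * dlgs g x) (M * 1)) as [l [Hl _]].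
  - apply contRR_k.
  - assert (Hd := contRR_dlgs g). auto with cont.
  - intros x. rewrite Rabs_right. auto. left; apply gker_pos.
  - apply lineRI_scal. apply contRR_dlgs. now apply lineRI_dlgs.
  - eauto.
Qed.

Lemma Gam_pos g : 0 < g -> 0 < Gam g.
Proof.
  intros Hg. set (e := RInt (gker g) 0 1).
  assert (He : 0 < e). { apply RInt_gt_0. lra. intros; apply gker_pos. intros; apply contRR_k. }
  destruct (lineRI_k g Hg e He) as [N [HN H]]. specialize (H (- (N + 1)) (N + 2) ltac:(lra) ltac:(lra)).
  assert (E1 := RInt_split (gker g) (- (N + 1)) 0 (N + 2) (contRR_k g)). assert (E2 := RInt_split (gker g) 0 1 (N + 2) (contRR_k g)).
  assert (Hp : forall a b, a <= b -> 0 <= RInt (gker g) a b).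
  { intros a b Hab. apply RInt_ge_0; auto. apply contRR_ex_RInt, contRR_k. intros; left; apply gker_pos. }
  assert (A := Hp (- (N + 1)) 0 ltac:(lra)). assert (B := Hp 1 (N + 2) ltac:(lra)). fold e in E2. apply Rabs_lt_between in H. lra.
Qed.

Lemma gker_derive g x : is_derive (gker g) x (g * gker g x - gker (g + 1) x).
Proof. rewrite gker_plus, Rmult_1_l. unfold gker. auto_derive. auto. unfold Rminus. ring. Qed.

Lemma Gam_S g : 0 < g -> Gam (g + 1) = g * Gam g.
Proof.
  intros Hg.
  assert (H : lineCI (fun x => RtoC (g * gker g x - gker (g + 1) x)) 0).
  { apply (lineCI_FTC (fun x => RtoC (gker g x)) _ (gker g)).
    - intros x. apply (is_derive_pair (gker g) (fun _ => 0)). apply gker_derive. apply (is_derive_const (V := R_NormedModule)).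
    - auto with cont.
    - intros x. rewrite Cmod_R, Rabs_right. lra. left; apply gker_pos.
    - now apply gker_lim. }
  apply (lineCI_GR (fun x => g * gker g x - gker (g + 1) x)) in H; auto with cont. simpl in H.
  assert (H2 := lineRI_plus (fun x => g * gker g x - gker (g + 1) x) (gker (g + 1)) 0 (Gam (g + 1)) ltac:(auto with cont) (contRR_k _) H (lineRI_k (g + 1) ltac:(lra))).
  apply (lineRI_ext _ (fun x => g * gker g x)) in H2. 2: intros; ring.
  assert (H3 := lineRI_unique _ _ _ H2 (lineRI_scal g _ _ (contRR_k g) (lineRI_k g Hg))). lra.
Qed.

(** * The convolution operator *)

(** Naming the derivative by [C_derive] avoids carrying a witness for it through iterated
    derivatives. *)
Definition holo (F : C -> C) : Prop := forall z, cderiv F z (C_derive F z).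

Lemma cderiv_C_derive F z l : cderiv F z l -> C_derive F z = l.
Proof. intros H. apply is_C_derive_unique. now apply cderiv_is_derive. Qed.

Lemma holo_intro F dF : (forall z, cderiv F z (dF z)) -> holo F.
Proof. intros H z. rewrite (cderiv_C_derive F z (dF z) (H z)). apply H. Qed.

Lemma holo_derive F : holo F -> holo (C_derive F).
Proof. intros H. destruct (deriv_deriv F (C_derive F) H) as [d Hd]. eapply holo_intro; eauto. Qed.

Lemma holo_cc F : holo F -> contCC F.
Proof. intros H. eapply cderiv_cc. exact H. Qed.
#[export] Hint Resolve holo_cc holo_derive : cont.

Lemma holo_plus F G : holo F -> holo G -> holo (fun z => F z + G z)%C.
Proof. intros HF HG. eapply holo_intro. intros z. apply cderiv_plus; [apply HF|apply HG]. Qed.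
Lemma holo_minus F G : holo F -> holo G -> holo (fun z => F z - G z)%C.
Proof. intros HF HG. eapply holo_intro. intros z. apply cderiv_minus; [apply HF|apply HG]. Qed.
Lemma holo_scal c F : holo F -> holo (fun z => c * F z)%C.
Proof. intros HF. eapply holo_intro. intros z. apply cderiv_scal; apply HF. Qed.
Lemma holo_shift F a : holo F -> holo (fun z => F (z + a)%C).
Proof. intros HF. apply holo_intro with (fun z => C_derive F (z + a)%C). intros z. apply cderiv_shift; apply HF. Qed.

(* Real translations must cost only [exp (e * |x|)] with [e < g], since they are integrated
   against [gker g]; complex ones may cost an arbitrary exponential rate [c]. *)
Definition weight (e c : R) (w : C -> R) : Prop :=
  (forall z, 0 < w z) /\ (forall z (x : R), w (z + x)%C <= exp (e * Rabs x) * w z) /\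
  (forall z h, w (z + h)%C <= exp (c * Cmod h) * w z).
Definition wbound (w : C -> R) (K : R) (F : C -> C) : Prop := forall z, Cmod (F z) * w z <= K.

Lemma wbound_le w K F z : 0 < w z -> wbound w K F -> Cmod (F z) <= K / w z.
Proof.
  intros Hw H. apply Rmult_le_reg_r with (w z); auto. unfold Rdiv. rewrite Rmult_assoc, Rinv_l by lra. rewrite Rmult_1_r. apply H.
Qed.
Lemma wbound_pos w K F : (forall z, 0 < w z) -> wbound w K F -> 0 <= K.
Proof. intros Hw H. eapply Rle_trans; [|apply (H 0)]. apply Rmult_le_pos. apply Cmod_ge_0. left; apply Hw. Qed.
Lemma wbound_weak w K K' F : K <= K' -> wbound w K F -> wbound w K' F.
Proof. intros H HF z. eapply Rle_trans; eauto. Qed.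
Lemma wbound_plus w K L F G : (forall z, 0 < w z) -> wbound w K F -> wbound w L G -> wbound w (K + L) (fun z => F z + G z)%C.
Proof.
  intros Hw HF HG z. specialize (HF z). specialize (HG z). specialize (Hw z). assert (H := Cmod_triangle (F z) (G z)). nra.
Qed.
Lemma wbound_minus w K L F G : (forall z, 0 < w z) -> wbound w K F -> wbound w L G -> wbound w (K + L) (fun z => F z - G z)%C.
Proof.
  intros Hw HF HG z. specialize (HF z). specialize (HG z). specialize (Hw z). assert (H := Cmod_triangle_minus (F z) (G z)). nra.
Qed.
Lemma wbound_scal w a K F : wbound w K F -> wbound w (Cmod a * K) (fun z => a * F z)%C.
Proof. intros HF z. rewrite Cmod_mult, Rmult_assoc. apply Rmult_le_compat_l. apply Cmod_ge_0. apply HF. Qed.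

(* Only meaningful where the integral converges; elsewhere the value of [epsilon] is arbitrary. *)
Definition GamOp (g : R) (F : C -> C) (z : C) : C :=
  epsilon (inhabits (RtoC 0)) (lineCI (fun x => RtoC (gker g x) * F (z + RtoC x))%C).

(** Only the horizontal line through z matters; at real z this keeps the injectivity argument on the
    real axis. *)
Lemma GamOp_ext g F G z : (forall x : R, F (z + x)%C = G (z + x)%C) -> GamOp g F z = GamOp g G z.
Proof.
  intros H. unfold GamOp. apply (f_equal (fun f => epsilon (inhabits (RtoC 0)) (lineCI f))). apply functional_extensionality. intros x. now rewrite H.
Qed.

Lemma contRC_tr (F : C -> C) (a : C) : contCC F -> contRC (fun x => F (a + RtoC x)%C).
Proof. intros H. auto with cont. Qed.
#[export] Hint Resolve contRC_tr : cont.

Section Op.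
Variables (e c : R).
Hypotheses (He0 : 0 <= e) (Hc0 : 0 <= c).

Lemma weight_back w z h : weight e c w -> w z <= exp (c * Cmod h) * w (z + h)%C.
Proof.
  intros [_ [_ H]]. specialize (H (z + h)%C (- h)%C). rewrite Cmod_opp in H. replace (z + h + - h)%C with z in H by ring. exact H.
Qed.
Lemma weight_back_R w z (x : R) : weight e c w -> w z <= exp (e * Rabs x) * w (z + x)%C.
Proof.
  intros [_ [H _]]. specialize (H (z + x)%C (- x)). rewrite Rabs_Ropp in H.
  replace (z + x + (- x)%R)%C with z in H by (rewrite RtoC_opp; ring). exact H.
Qed.

Lemma wbound_at w K F z h : weight e c w -> wbound w K F -> Cmod (F (z + h)%C) <= exp (c * Cmod h) * (K / w z).
Proof.
  intros Hw HF. assert (H := weight_back w z h Hw). assert (HK : 0 <= K) by (eapply wbound_pos; [apply Hw|exact HF]).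
  assert (Hp : 0 < w z) by apply Hw. assert (Hp' : 0 < w (z + h)%C) by apply Hw.
  eapply Rle_trans. apply (wbound_le w K F); auto.
  apply Rmult_le_reg_r with (w (z + h)%C * w z). nra.
  replace (K / w (z + h)%C * (w (z + h)%C * w z)) with (K * w z) by (field; lra).
  replace (exp (c * Cmod h) * (K / w z) * (w (z + h)%C * w z)) with (K * (exp (c * Cmod h) * w (z + h)%C)) by (field; lra).
  apply Rmult_le_compat_l; auto.
Qed.
Lemma wbound_at_R w K F z (x : R) : weight e c w -> wbound w K F -> Cmod (F (z + x)%C) <= K / w z * exp (e * Rabs x).
Proof.
  intros Hw HF. assert (H := weight_back_R w z x Hw). assert (HK : 0 <= K) by (eapply wbound_pos; [apply Hw|exact HF]).
  assert (Hp : 0 < w z) by apply Hw. assert (Hp' : 0 < w (z + x)%C) by apply Hw.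
  eapply Rle_trans. apply (wbound_le w K F); auto.
  apply Rmult_le_reg_r with (w (z + x)%C * w z). nra.
  replace (K / w (z + x)%C * (w (z + x)%C * w z)) with (K * w z) by (field; lra).
  replace (K / w z * exp (e * Rabs x) * (w (z + x)%C * w z)) with (K * (exp (e * Rabs x) * w (z + x)%C)) by (field; lra).
  apply Rmult_le_compat_l; auto.
Qed.

(** Cauchy's estimate on the unit circle about z, along which the weight changes by a factor of at
    most exp c. *)
Lemma wbound_derive w K F : weight e c w -> holo F -> wbound w K F -> wbound w (exp c * K) (C_derive F).
Proof.
  intros Hw HF HB z. assert (Hp : 0 < w z) by apply Hw.
  apply Rle_trans with ((exp c * (K / w z)) * w z); [|right; field; lra].
  apply Rmult_le_compat_r. lra. apply (cauchy_bound F _ HF).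
  intros h Hh. eapply Rle_trans. apply (wbound_at w K F z h Hw HB). rewrite Hh, Rmult_1_r. lra.
Qed.

Lemma wbound_shift w K F (a : R) : weight e c w -> wbound w K F -> wbound w (exp (e * Rabs a) * K) (fun z => F (z + a)%C).
Proof.
  intros Hw HB z. assert (Hp : 0 < w z) by apply Hw.
  apply Rle_trans with ((K / w z * exp (e * Rabs a)) * w z); [|right; field; lra].
  apply Rmult_le_compat_r. lra. now apply wbound_at_R.
Qed.

Lemma exp_abs_le y : exp (Rabs y) <= exp y + exp (- y).
Proof. unfold Rabs. destruct (Rcase_abs y); generalize (exp_pos y) (exp_pos (- y)); lra. Qed.

Section Fixg.
Variable g : R.
Hypothesis Hg : e < g.
Let cst := Gam (g + e) + Gam (g - e).

(** exp (e |x|) is at most exp (e x) + exp (- e x), and each summand merely shifts the parameter of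
    the kernel; e < g keeps g - e positive. *)
Lemma gker_exp_le x : gker g x * exp (e * Rabs x) <= gker (g + e) x + gker (g - e) x.
Proof.
  unfold Rminus. rewrite !gker_plus. assert (H := gker_pos g x). assert (H1 := exp_abs_le (e * x)).
  replace (e * Rabs x) with (Rabs (e * x)) by (rewrite Rabs_mult, (Rabs_right e); lra).
  replace (- e * x) with (- (e * x)) by ring. nra.
Qed.

Lemma lineCI_k_dom (u : R -> C) K : contRC u -> 0 <= K -> (forall x, Cmod (u x) <= K * exp (e * Rabs x)) ->
  exists l, lineCI (fun x => RtoC (gker g x) * u x)%C l /\ Cmod l <= K * cst.
Proof.
  intros Hu HK H. apply (lineCI_dom _ (fun x => K * (gker (g + e) x + gker (g - e) x))).
  - auto with cont.
  - auto with cont.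
  - intros x. rewrite Cmod_mult, Cmod_R, Rabs_right by (left; apply gker_pos).
    apply Rle_trans with (gker g x * (K * exp (e * Rabs x))). apply Rmult_le_compat_l. left; apply gker_pos. apply H.
    replace (gker g x * (K * exp (e * Rabs x))) with (K * (gker g x * exp (e * Rabs x))) by ring.
    apply Rmult_le_compat_l; auto. apply gker_exp_le.
  - apply lineRI_scal. auto with cont. apply lineRI_plus; auto with cont; apply lineRI_k; lra.
Qed.

Lemma cst_pos : 0 < cst.
Proof. unfold cst. generalize (Gam_pos (g + e) ltac:(lra)) (Gam_pos (g - e) ltac:(lra)). lra. Qed.

Lemma GamOp_spec w K F z : weight e c w -> contCC F -> wbound w K F ->
  lineCI (fun x => RtoC (gker g x) * F (z + RtoC x))%C (GamOp g F z).
Proof.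
  intros Hw HF HB. unfold GamOp. apply (epsilon_spec (inhabits (RtoC 0))).
  destruct (lineCI_k_dom (fun x => F (z + RtoC x)%C) (K / w z)) as [l [Hl _]].
  - auto with cont.
  - apply Rmult_le_pos. eapply wbound_pos; [apply Hw|exact HB]. left; apply Rinv_0_lt_compat, Hw.
  - intros x. now apply wbound_at_R.
  - eauto.
Qed.

(** The weighted bound [K0] secures convergence, whereas the estimate uses M, a bound on the one
    line through z. For Taylor remainders M is of second order in h. *)
Lemma GamOp_le w K0 F z M : weight e c w -> contCC F -> wbound w K0 F -> 0 <= M -> (forall x : R, Cmod (F (z + x)%C) <= M * exp (e * Rabs x)) ->
  Cmod (GamOp g F z) <= M * cst.
Proof.
  intros Hw HF HB HM H. destruct (lineCI_k_dom (fun x => F (z + RtoC x)%C) M) as [l [Hl Hl2]]; auto.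
  - auto with cont.
  - rewrite (lineCI_unique _ _ _ (GamOp_spec w K0 F z Hw HF HB) Hl). auto.
Qed.

Lemma GamOp_bnd w K F : weight e c w -> contCC F -> wbound w K F -> wbound w (cst * K) (GamOp g F).
Proof.
  intros Hw HF HB z. assert (Hp : 0 < w z) by apply Hw.
  apply Rle_trans with ((K / w z * cst) * w z); [|right; field; lra].
  apply Rmult_le_compat_r. lra. apply (GamOp_le w K); auto.
  - apply Rmult_le_pos. eapply wbound_pos; [apply Hw|exact HB]. left; apply Rinv_0_lt_compat, Hw.
  - intros x. now apply wbound_at_R.
Qed.

Lemma GamOp_plus w K L F G z : weight e c w -> contCC F -> contCC G -> wbound w K F -> wbound w L G ->
  GamOp g (fun y => F y + G y)%C z = (GamOp g F z + GamOp g G z)%C.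
Proof.
  intros Hw HF HG HBF HBG. assert (Hp : forall z, 0 < w z) by apply Hw.
  assert (H := GamOp_spec w (K + L) (fun y => F y + G y)%C z Hw (contCC_plus _ _ HF HG) (wbound_plus _ _ _ _ _ Hp HBF HBG)).
  apply (lineCI_unique _ _ _ H). apply (lineCI_ext (fun x => RtoC (gker g x) * F (z + RtoC x) + RtoC (gker g x) * G (z + RtoC x))%C).
  intros x; ring. apply lineCI_plus; [auto with cont|auto with cont| |]. eapply GamOp_spec; eauto. eapply GamOp_spec; eauto.
Qed.

Lemma contCC_scal a F : contCC F -> contCC (fun z => a * F z)%C.
Proof.
  intros HF. apply contCC_eps. rewrite contCC_eps in HF. intros z eps Heps. assert (Ha := Cmod_ge_0 a).
  destruct (HF z (eps / (Cmod a + 1))) as [d [Hd H]]. apply Rdiv_lt_0_compat; lra.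
  exists d. split; auto. intros h Hh. specialize (H h Hh).
  replace (a * F (z + h) - a * F z)%C with (a * (F (z + h) - F z))%C by ring. rewrite Cmod_mult.
  apply Rle_lt_trans with ((Cmod a + 1) * Cmod (F (z + h) - F z)%C). apply Rmult_le_compat_r. apply Cmod_ge_0. lra.
  apply Rmult_lt_compat_l with (r := Cmod a + 1) in H; [|lra].
  replace ((Cmod a + 1) * (eps / (Cmod a + 1))) with eps in H by (field; lra). exact H.
Qed.

Lemma GamOp_scal w K a F z : weight e c w -> contCC F -> wbound w K F -> GamOp g (fun y => a * F y)%C z = (a * GamOp g F z)%C.
Proof.
  intros Hw HF HB.
  assert (H := GamOp_spec w (Cmod a * K) (fun y => a * F y)%C z Hw (contCC_scal a F HF) (wbound_scal _ _ _ _ HB)).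
  apply (lineCI_unique _ _ _ H). apply (lineCI_ext (fun x => a * (RtoC (gker g x) * F (z + RtoC x)))%C).
  intros x; ring. apply lineCI_mult; [auto with cont|]. eapply GamOp_spec; eauto.
Qed.

Lemma GamOp_minus w K L F G z : weight e c w -> contCC F -> contCC G -> wbound w K F -> wbound w L G ->
  GamOp g (fun y => F y - G y)%C z = (GamOp g F z - GamOp g G z)%C.
Proof.
  intros Hw HF HG HBF HBG. 
  rewrite (GamOp_ext g (fun y => F y - G y)%C (fun y => F y + (-1) * G y)%C) by (intros; ring).
  rewrite (GamOp_plus w K (Cmod (-1) * L)); auto using contCC_scal, wbound_scal. rewrite (GamOp_scal w L) by auto. ring.
Qed.

Lemma GamOp_shift F z h : GamOp g (fun y => F (y + h)%C) z = GamOp g F (z + h)%C.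
Proof.
  unfold GamOp. apply (f_equal (fun f => epsilon (inhabits (RtoC 0)) (lineCI f))). apply functional_extensionality. intros x. replace (z + x + h)%C with (z + h + x)%C by ring. reflexivity.
Qed.

Lemma wbound_shiftC w K F h : weight e c w -> wbound w K F -> wbound w (exp (c * Cmod h) * K) (fun z => F (z + h)%C).
Proof.
  intros Hw HB z. assert (Hp : 0 < w z) by apply Hw.
  apply Rle_trans with ((exp (c * Cmod h) * (K / w z)) * w z); [|right; field; lra].
  apply Rmult_le_compat_r. lra. now apply wbound_at.
Qed.

Lemma exp_mono x y : x <= y -> exp x <= exp y.
Proof. intros [H| ->]. left; now apply exp_increasing. lra. Qed.

(** By linearity the error is [GamOp] applied to the Taylor remainder of F, which on the line
    through z is at most Cmod h ^ 2 times M exp (e |x|). *)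
Lemma GamOp_deriv w K F z : weight e c w -> holo F -> wbound w K F -> cderiv (GamOp g F) z (GamOp g (C_derive F) z).
Proof.
  intros Hw HF HB eps Heps. assert (Hp : 0 < w z) by apply Hw.
  assert (HB1 := wbound_derive w K F Hw HF HB). assert (HF1 := holo_derive F HF).
  assert (HB2 := wbound_derive w _ _ Hw HF1 HB1).
  assert (HK : 0 <= K) by (eapply wbound_pos; [apply Hw|exact HB]).
  (* Two factors exp c come from two Cauchy estimates, the third from moving the base point z by t h
     with Cmod (t h) <= 1. *)
  set (M := exp c * (exp c * (exp c * K)) / w z).
  assert (HM : 0 <= M).
  { assert (0 < exp c) by apply exp_pos. apply Rmult_le_pos. repeat apply Rmult_le_pos; lra. left; apply Rinv_0_lt_compat, Hw. }
  assert (Hcst := cst_pos).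
  exists (Rmin 1 (eps / (M * cst + 1))). split. apply Rmin_pos. lra. apply Rdiv_lt_0_compat. lra. nra.
  intros h Hh. assert (Hh1 : Cmod h < 1) by (eapply Rlt_le_trans; [exact Hh|apply Rmin_l]).
  assert (Hh2 : Cmod h < eps / (M * cst + 1)) by (eapply Rlt_le_trans; [exact Hh|apply Rmin_r]).
  assert (Hh0 := Cmod_ge_0 h).
  set (G := fun y => (F (y + h) - F y - h * C_derive F y)%C).
  assert (E : GamOp g G z = (GamOp g F (z + h) - GamOp g F z - GamOp g (C_derive F) z * h)%C).
  { transitivity (GamOp g (fun y => F (y + h) - F y)%C z - GamOp g (fun y => h * C_derive F y)%C z)%C.
    apply (GamOp_minus w (exp (c * Cmod h) * K + K) (Cmod h * (exp c * K)) (fun y => F (y + h)%C - F y)%C (fun y => h * C_derive F y)%C); [exact Hw| | | |].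
    - apply contCC_minus; auto with cont. apply contCC_shift; auto with cont.
    - apply contCC_scal; auto with cont.
    - apply wbound_minus. apply Hw. now apply wbound_shiftC. auto.
    - now apply wbound_scal.
    - assert (E1 : GamOp g (fun y => F (y + h) - F y)%C z = (GamOp g F (z + h) - GamOp g F z)%C).
      { rewrite <- GamOp_shift. apply (GamOp_minus w (exp (c * Cmod h) * K) K (fun y => F (y + h)%C) F); auto with cont.
        apply contCC_shift; auto with cont. now apply wbound_shiftC. }
      rewrite E1, (GamOp_scal w (exp c * K)); auto with cont. ring. }
  rewrite <- E.
  apply Rle_trans with ((Cmod h * Cmod h * M) * cst).
  - apply (GamOp_le w ((exp (c * Cmod h) * K + K) + Cmod h * (exp c * K))); auto.
    + unfold G. apply contCC_minus; [apply contCC_minus|apply contCC_scal]; auto with cont. apply contCC_shift; auto with cont.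
    + unfold G. apply (wbound_minus w _ _ (fun y => F (y + h)%C - F y)%C (fun y => h * C_derive F y)%C). apply Hw.
      apply (wbound_minus w _ _ (fun y => F (y + h)%C) F). apply Hw. now apply wbound_shiftC. auto. now apply wbound_scal.
    + nra.
    + intros x. unfold G. replace (F (z + x + h) - F (z + x) - h * C_derive F (z + x))%C with (F (z + x + h) - F (z + x) - C_derive F (z + x) * h)%C by ring.
      rewrite !Rmult_assoc. apply (entire_taylor F (C_derive F) (C_derive (C_derive F))); auto.
      intros t Ht. replace (z + x + RtoC t * h)%C with (z + RtoC t * h + x)%C by ring.
      eapply Rle_trans. apply (wbound_at_R w _ _ _ x Hw HB2). apply Rmult_le_compat_r. left; apply exp_pos.
      unfold M. assert (Hwt := weight_back w z (RtoC t * h)%C Hw). assert (Hp2 : 0 < w (z + RtoC t * h)%C) by apply Hw.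
      assert (Hth : Cmod (RtoC t * h)%C <= 1). { rewrite Cmod_mult, Cmod_R, Rabs_right by lra. nra. }
      assert (Hexp : exp (c * Cmod (RtoC t * h)%C) <= exp c). { apply exp_mono. nra. }
      set (X := exp c * (exp c * K)) in *.
      assert (HX : 0 <= X). { unfold X. assert (0 < exp c) by apply exp_pos. repeat apply Rmult_le_pos; lra. }
      apply Rmult_le_reg_r with (w (z + RtoC t * h)%C * w z). nra.
      replace (X / w (z + RtoC t * h)%C * (w (z + RtoC t * h)%C * w z)) with (X * w z) by (field; lra).
      replace (exp c * X / w z * (w (z + RtoC t * h)%C * w z)) with (X * (exp c * w (z + RtoC t * h)%C)) by (field; lra).
      apply Rmult_le_compat_l; auto. eapply Rle_trans. exact Hwt. apply Rmult_le_compat_r; lra.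
  - replace (Cmod h * Cmod h * M * cst) with (Cmod h * (Cmod h * (M * cst))) by ring. rewrite (Rmult_comm eps).
    apply Rmult_le_compat_l; auto. assert (0 <= M * cst) by nra.
    apply Rle_trans with (Cmod h * (M * cst + 1)). nra.
    apply Rlt_le. apply Rmult_lt_compat_r with (r := M * cst + 1) in Hh2; [|lra].
    replace (eps / (M * cst + 1) * (M * cst + 1)) with eps in Hh2 by (field; lra). auto.
Qed.

Lemma GamOp_ent w K F : weight e c w -> holo F -> wbound w K F -> holo (GamOp g F).
Proof. intros Hw HF HB. eapply holo_intro. intros z. eapply GamOp_deriv; eauto. Qed.

End Fixg.

(** The difference of the integrands is the x-derivative of gker g x * F (z + x), whose boundary
    values vanish because it is dominated by multiples of [gker (g + e)] and [gker (g - e)]. *)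
Lemma GamOp_rec g w K F z : e < g -> weight e c w -> holo F -> wbound w K F ->
  GamOp (g + 1) F z = GamOp g (fun y => RtoC g * F y + C_derive F y)%C z.
Proof.
  intros Hg Hw HF HB. assert (HB1 := wbound_derive w K F Hw HF HB). assert (HF1 := holo_derive F HF).
  assert (S1 := GamOp_spec (g + 1) ltac:(lra) w K F z Hw (holo_cc F HF) HB).
  assert (HcG : contCC (fun y => RtoC g * F y + C_derive F y)%C) by (apply contCC_plus; [apply contCC_scal|]; auto with cont).
  assert (S2 := GamOp_spec g Hg w (Cmod g * K + exp c * K) (fun y => RtoC g * F y + C_derive F y)%C z Hw HcG
     (wbound_plus _ _ _ _ _ (proj1 Hw) (wbound_scal _ _ _ _ HB) HB1)).
  assert (Hrc : contRC (fun x => F (z + RtoC x)%C)) by auto with cont.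
  assert (Hrc1 : contRC (fun x => C_derive F (z + RtoC x)%C)) by auto with cont.
  assert (S3 : lineCI (fun x => RtoC (gker g x) * (RtoC g * F (z + RtoC x) + C_derive F (z + RtoC x)) - RtoC (gker (g + 1) x) * F (z + RtoC x))%C 0).
  { assert (HK : 0 <= K / w z).
    { apply Rmult_le_pos. eapply wbound_pos; [apply Hw|exact HB]. left; apply Rinv_0_lt_compat, Hw. }
    apply (lineCI_FTC (fun x => RtoC (gker g x) * F (z + RtoC x))%C _ (fun x => K / w z * (gker (g + e) x + gker (g - e) x))).
    - intros x. apply rderiv_eq with (RtoC (g * gker g x - gker (g + 1) x) * F (z + RtoC x) + RtoC (gker g x) * (1 * C_derive F (z + RtoC x)))%C.
      + apply (is_derive_Cmult (fun x => RtoC (gker g x)) (fun x => F (z + RtoC x)%C)). apply (is_derive_pair (gker g) (fun _ => 0)). apply gker_derive. apply (is_derive_const (V := R_NormedModule)).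
        apply (rderiv_chain F (fun x => z + RtoC x)%C). apply HF.
        eapply is_derive_ext; [|apply (is_derive_line z 1)]. intros t. simpl. ring.
      + rewrite RtoC_minus, RtoC_mult. ring.
    - auto 10 with cont.
    - intros x. rewrite Cmod_mult, Cmod_R, Rabs_right by (left; apply gker_pos).
      apply Rle_trans with (gker g x * (K / w z * exp (e * Rabs x))). apply Rmult_le_compat_l. left; apply gker_pos. now apply wbound_at_R.
      replace (gker g x * (K / w z * exp (e * Rabs x))) with (K / w z * (gker g x * exp (e * Rabs x))) by ring.
      apply Rmult_le_compat_l; auto. now apply gker_exp_le.
    - intros eps Heps. assert (HE : 0 < eps / (K / w z + 1) / 2) by (repeat apply Rdiv_lt_0_compat; lra).
      destruct (gker_lim (g + e) ltac:(lra) _ HE) as [N1 [HN1 H1]]. destruct (gker_lim (g - e) ltac:(lra) _ HE) as [N2 [HN2 H2]].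
      exists (N1 + N2). split. lra. intros x Hx. specialize (H1 x ltac:(lra)). specialize (H2 x ltac:(lra)).
      assert (P1 := gker_pos (g + e) x). assert (P2 := gker_pos (g - e) x).
      apply Rle_lt_trans with ((K / w z + 1) * (gker (g + e) x + gker (g - e) x)). nra.
      apply Rlt_le_trans with ((K / w z + 1) * (eps / (K / w z + 1) / 2 + eps / (K / w z + 1) / 2)).
      apply Rmult_lt_compat_l; lra. right; field. split. assert (0 < w z) by apply Hw. lra.
      assert (0 < w z) by apply Hw. intros Hq. assert (K / w z * w z = K) by (field; lra). nra. }
  symmetry. apply Ceq_minus. refine (lineCI_unique _ _ _ _ S3).
  apply (lineCI_minus (fun x => RtoC (gker g x) * (RtoC g * F (z + RtoC x) + C_derive F (z + RtoC x)))%C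
    (fun x => RtoC (gker (g + 1) x) * F (z + RtoC x))%C); [auto with cont|auto with cont|exact S2|exact S1].
Qed.
End Op.

(** * Inversion of the convolution operator *)

Lemma wbound_zero w K F : (forall z, 0 < w z) -> (forall n, wbound w (K * (/ 2) ^ n) F) -> forall z, F z = 0.
Proof.
  intros Hw H z. apply Cmod_eq_0. apply Rle_antisym; [|apply Cmod_ge_0]. apply Rnot_lt_le. intros Hp.
  specialize (Hw z). assert (Hp2 : 0 < Cmod (F z) * w z) by nra.
  destruct (half_pow_lim K _ Hp2) as [n Hn]. specialize (Hn n (Nat.le_refl _)). specialize (H n z). lra.
Qed.

(** With y = exp X the left side is at most |y - 1| (y + y^-2), which Young's inequality with
    parameter eta splits. Only the powers 2, 1, 0 and -4 of y remain, so that integration against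
    [gker g] yields Gamma values; (y - 1)^2 has a small integral for large g, and eta makes the rest
    small. *)
Lemma abs_exp_abs X eta : 0 < eta ->
  Rabs X * exp (Rabs X) <= / (2 * eta) * (exp (2 * X) - 2 * exp (1 * X) + 1) + eta * (exp (2 * X) + exp (- 4 * X)).
Proof.
  intros Heta. set (y := exp X). assert (Hy : 0 < y) by apply exp_pos.
  assert (E1 : exp (1 * X) = y) by (unfold y; f_equal; ring).
  assert (E2 : exp (2 * X) = y * y) by (unfold y; rewrite <- exp_plus; f_equal; ring).
  assert (Em : exp (- X) = / y) by (unfold y; apply exp_Ropp).
  assert (E4 : exp (- 4 * X) = (/ y * / y) * (/ y * / y)).
  { rewrite <- Em. rewrite <- !exp_plus. f_equal. ring. }
  rewrite E1, E2, E4. assert (Hi : 0 < / y) by now apply Rinv_0_lt_compat.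
  assert (A : Rabs X * exp (Rabs X) <= Rabs (y - 1) * (y + / y * / y)).
  { destruct (Rle_or_lt 0 X) as [H|H].
    - rewrite (Rabs_right X) by lra. fold y. assert (H1 := exp_ineq1_le X). fold y in H1. rewrite Rabs_right by lra.
      apply Rle_trans with ((y - 1) * y). apply Rmult_le_compat_r; lra. apply Rmult_le_compat_l. lra. nra.
    - rewrite (Rabs_left X) by lra. rewrite Em. assert (H1 := exp_ineq1_le (- X)). rewrite Em in H1.
      assert (H2 : y < 1). { unfold y. rewrite <- exp_0. now apply exp_increasing. }
      rewrite Rabs_left by lra.
      apply Rle_trans with ((/ y - 1) * / y). apply Rmult_le_compat_r; lra.
      replace ((/ y - 1) * / y) with ((1 - y) * (/ y * / y)) by (field; lra).
      replace (- (y - 1)) with (1 - y) by ring. apply Rmult_le_compat_l; nra. }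
  eapply Rle_trans. exact A. set (D := Rabs (y - 1)). set (S := / y * / y).
  assert (HD : D * D = y * y - 2 * y + 1). { unfold D. rewrite <- Rabs_mult, Rabs_right. ring. apply Rle_ge, Rle_0_sqr. }
  rewrite <- HD.
  assert (B : D * (y + S) <= / (2 * eta) * (D * D) + eta / 2 * ((y + S) * (y + S))).
  { assert (Q := Rle_0_sqr (D - eta * (y + S))). unfold Rsqr in Q.
    apply Rmult_le_reg_l with (2 * eta). lra.
    replace (2 * eta * (/ (2 * eta) * (D * D) + eta / 2 * ((y + S) * (y + S)))) with (D * D + eta * eta * ((y + S) * (y + S))) by (field; lra).
    nra. }
  assert (Q := Rle_0_sqr (y - S)). unfold Rsqr in Q. nra.
Qed.

(* With [X = x - ln g], the powers [exp (j * X)] turn [gker g] into multiples of [gker (g + j)],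
   whose integrals are explicit rational multiples of [Gam g]. *)
Lemma gker_tilt g j x : 0 < g -> exp (j * (x - ln g)) * gker g x = exp (- (j * ln g)) * gker (g + j) x.
Proof. intros Hg. rewrite gker_plus. rewrite <- Rmult_assoc, <- exp_plus. f_equal. f_equal. ring. Qed.

Lemma lineRI_scal_add a b f l : 0 < b -> contRR f /\ lineRI f l ->
  contRR (fun x => f x + a * gker b x) /\ lineRI (fun x => f x + a * gker b x) (l + a * Gam b).
Proof.
  intros Hb [Hr Hf]. split. auto with cont. apply (lineRI_plus f (fun x => a * gker b x)); [exact Hr|auto with cont|exact Hf|].
  apply lineRI_scal. apply contRR_k. now apply lineRI_k.
Qed.

Section Base.
Variables (e c g : R).
Hypotheses (He0 : 0 <= e) (He1 : e <= 1) (Hc0 : 0 <= c) (Hg : 8 + 144 * (exp c * exp c) <= g).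

(** Each half of the moment gets exp (- c) / 4 times Gam g. The second half costs 18 eta = exp (- c)
    / 4, where 18 = 2 + 16 comes from 1 + 1 / g <= 2 and g^4 Gam (g - 4) <= 16 Gam g, the latter
    valid for g >= 8. The first half costs 36 exp c / g, which forces g >= 144 exp (2 c). *)
Let eta := exp (- c) / 72.

(** The factor exp (- c) / 2 is chosen to cancel Cauchy's factor exp c in [GamRem_bnd] and leave the
    norm 1/2. *)
Lemma moment_bound : exists L, lineRI (fun x => gker g x * (Rabs (x - ln g) * exp (Rabs (x - ln g)))) L /\ L <= Gam g * (exp (- c) / 2).
Proof.
  assert (Hec := exp_pos c). assert (Hec2 : 0 < exp (- c)) by apply exp_pos.
  assert (Hg8 : 8 <= g) by nra. assert (Hg0 : 0 < g) by lra.
  assert (Heta : 0 < eta) by (unfold eta; lra).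
  set (E1 := exp (- (1 * ln g))). set (E2 := exp (- (2 * ln g))). set (E4 := exp (- (- 4 * ln g))).
  set (a1 := (/ (2 * eta) + eta) * E2). set (a2 := - 2 * / (2 * eta) * E1). set (a3 := / (2 * eta)). set (a4 := eta * E4).
  set (v := fun x => a1 * gker (g + 2) x + a2 * gker (g + 1) x + a3 * gker g x + a4 * gker (g + - 4) x).
  assert (Ev : forall x, v x = gker g x * (/ (2 * eta) * (exp (2 * (x - ln g)) - 2 * exp (1 * (x - ln g)) + 1) + eta * (exp (2 * (x - ln g)) + exp (- 4 * (x - ln g))))).
  { intros x. assert (T1 := gker_tilt g 1 x Hg0). assert (T2 := gker_tilt g 2 x Hg0). assert (T4 := gker_tilt g (-4) x Hg0).
    fold E1 in T1. fold E2 in T2. fold E4 in T4.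
    transitivity ((/ (2 * eta) + eta) * (E2 * gker (g + 2) x) + - 2 * / (2 * eta) * (E1 * gker (g + 1) x) + / (2 * eta) * gker g x + eta * (E4 * gker (g + - 4) x)).
    unfold v, a1, a2, a3, a4. ring. rewrite <- T1, <- T2, <- T4. ring. }
  assert (HL : contRR v /\ lineRI v (a1 * Gam (g + 2) + a2 * Gam (g + 1) + a3 * Gam g + a4 * Gam (g + - 4))).
  { unfold v. apply (lineRI_scal_add a4 (g + - 4) (fun x => a1 * gker (g + 2) x + a2 * gker (g + 1) x + a3 * gker g x)). lra.
    apply (lineRI_scal_add a3 g (fun x => a1 * gker (g + 2) x + a2 * gker (g + 1) x)). lra.
    apply (lineRI_scal_add a2 (g + 1) (fun x => a1 * gker (g + 2) x)). lra.
    split. auto with cont. apply lineRI_scal. apply contRR_k. apply lineRI_k. lra. }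
  destruct HL as [Hv HL].
  assert (Hrr : contRR (fun x => Rabs (x - ln g))).
  { intros x. apply (continuous_comp (fun x => x - ln g) Rabs). apply (contRR_minus (fun x => x) (fun _ => ln g) contRR_id (contRR_const _)). apply continuous_Rabs. }
  destruct (lineRI_dom (fun x => gker g x * (Rabs (x - ln g) * exp (Rabs (x - ln g)))) v
    (a1 * Gam (g + 2) + a2 * Gam (g + 1) + a3 * Gam g + a4 * Gam (g + - 4))) as [L [HL1 HL2]].
  - auto with cont.
  - exact Hv.
  - intros x. rewrite Rabs_right. rewrite Ev. apply Rmult_le_compat_l. left; apply gker_pos. now apply abs_exp_abs.
    apply Rle_ge. repeat apply Rmult_le_pos. left; apply gker_pos. apply Rabs_pos. left; apply exp_pos.
  - exact HL.
  - exists L. split. exact HL1. eapply Rle_trans. apply Rle_abs. eapply Rle_trans. exact HL2. clear HL2 HL1 HL Hv Ev v Hrr.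
    unfold a1, a2, a3, a4. clear a1 a2 a3 a4.
    assert (F2 : E2 = / g * / g).
    { unfold E2. replace (- (2 * ln g)) with (- ln g + - ln g) by ring. rewrite exp_plus, exp_Ropp, exp_ln by auto. reflexivity. }
    assert (F1 : E1 = / g). { unfold E1. rewrite Rmult_1_l, exp_Ropp, exp_ln by auto. reflexivity. }
    assert (F4 : E4 = g * g * (g * g)).
    { unfold E4. replace (- (- 4 * ln g)) with ((ln g + ln g) + (ln g + ln g)) by ring. rewrite !exp_plus, exp_ln by auto. reflexivity. }
    rewrite F1, F2, F4. clear F1 F2 F4 E1 E2 E4.
    assert (G1 := Gam_S g Hg0). assert (G2 := Gam_S (g + 1) ltac:(lra)). replace (g + 1 + 1) with (g + 2) in G2 by ring.
    assert (G3 := Gam_S (g - 1) ltac:(lra)). assert (G4 := Gam_S (g - 2) ltac:(lra)). assert (G5 := Gam_S (g - 3) ltac:(lra)). assert (G6 := Gam_S (g - 4) ltac:(lra)).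
    replace (g - 1 + 1) with g in G3 by ring. replace (g - 2 + 1) with (g - 1) in G4 by ring.
    replace (g - 3 + 1) with (g - 2) in G5 by ring. replace (g - 4 + 1) with (g - 3) in G6 by ring.
    rewrite G2, G1. replace (g + - 4) with (g - 4) by ring. 
    set (Z := Gam g) in *. assert (HZ : 0 < Z) by (apply Gam_pos; lra). set (Y := Gam (g - 4)) in *. assert (HY : 0 < Y) by (apply Gam_pos; lra).
    assert (EZ : Z = (g - 1) * (g - 2) * (g - 3) * (g - 4) * Y) by (rewrite G3, G4, G5, G6; ring).
    assert (B4 : g * g * (g * g) * Y <= 16 * Z).
    { rewrite EZ. rewrite <- !Rmult_assoc. apply Rmult_le_compat_r. lra.
      assert (T1 : g * g <= 4 * ((g - 1) * (g - 4))) by nra. assert (T2 : g * g <= 4 * ((g - 2) * (g - 3))) by nra.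
      assert (T3 : 0 <= g * g) by nra. assert (T4 : (g * g) * (g * g) <= (4 * ((g - 1) * (g - 4))) * (4 * ((g - 2) * (g - 3)))) by (apply Rmult_le_compat; auto). lra. }
    (* The terms with / (2 eta) combine to (g + 1) / g - 2 + 1 = 1 / g: this is the mean of (exp X -
       1)^2 for the normalised kernel. *)
    replace ((/ (2 * eta) + eta) * (/ g * / g) * ((g + 1) * (g * Z)) + - 2 * / (2 * eta) * / g * (g * Z) + / (2 * eta) * Z + eta * (g * g * (g * g)) * Y) with
      (Z * (/ (2 * eta) * / g) + eta * (Z * (1 + / g) + g * g * (g * g) * Y)) by (field; lra).
    assert (Hig : / g <= 1). { rewrite <- Rinv_1. apply Rinv_le_contravar; lra. }
    assert (Hig0 : 0 < / g) by (apply Rinv_0_lt_compat; lra).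
    assert (C1 : eta * (Z * (1 + / g) + g * g * (g * g) * Y) <= Z * (exp (- c) / 4)).
    { apply Rle_trans with (eta * (18 * Z)). apply Rmult_le_compat_l. lra. nra. unfold eta. right; field. }
    assert (C2 : / (2 * eta) * / g <= exp (- c) / 4).
    { unfold eta. rewrite exp_Ropp. rewrite <- Rinv_mult.
      replace (/ exp c / 4) with (/ (4 * exp c)) by (field; lra). apply Rinv_le_contravar. lra.
      replace (2 * (/ exp c / 72) * g) with (g / (36 * exp c)) by (field; lra).
      apply Rmult_le_reg_r with (36 * exp c). lra. unfold Rdiv. rewrite (Rmult_assoc g), Rinv_l by lra. nra. }
    assert (C3 : Z * (/ (2 * eta) * / g) <= Z * (exp (- c) / 4)) by (apply Rmult_le_compat_l; lra). lra.
Qed.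

Lemma base_eg : e < g.
Proof. assert (Hec := exp_pos c). nra. Qed.

(** How far the normalised operator, translated back by ln g, is from the identity. *)
Definition GamRem (F : C -> C) (z : C) : C := (F z - RtoC (/ Gam g) * GamOp g F (z + RtoC (- ln g)))%C.

Lemma Gam_g_pos : 0 < Gam g.
Proof. apply Gam_pos. generalize base_eg; lra. Qed.

Lemma GamRem_ent w K F : weight e c w -> holo F -> wbound w K F -> holo (GamRem F).
Proof.
  intros Hw HF HB. unfold GamRem. apply holo_minus; auto. apply (holo_scal (RtoC (/ Gam g)) (fun z => GamOp g F (z + RtoC (- ln g)))%C). apply holo_shift.
  apply (GamOp_ent e c He0 Hc0 g base_eg w K F); assumption.
Qed.

Lemma GamRem_minus w K L F G : weight e c w -> holo F -> holo G -> wbound w K F -> wbound w L G ->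
  forall z, (GamRem (fun z => F z - G z) z = GamRem F z - GamRem G z)%C.
Proof.
  intros Hw HF HG HBF HBG z. unfold GamRem. rewrite (GamOp_minus e c He0 g base_eg w K L); auto with cont. ring.
Qed.

(** Gam g times the remainder is the integral of gker g x * (F z - F (z + X)) with X = x - ln g. The
    mean value inequality bounds the difference by a multiple of |X| exp (e |X|), and e <= 1 reduces
    this to the moment already estimated. *)
Lemma GamRem_bnd w K F : weight e c w -> holo F -> wbound w K F -> wbound w (K / 2) (GamRem F).
Proof.
  intros Hw HF HB z. assert (Hp : 0 < w z) by apply Hw. assert (HG := Gam_g_pos).
  assert (HK : 0 <= K) by (eapply wbound_pos; [apply Hw|exact HB]).
  assert (HB1 := wbound_derive e c w K F Hw HF HB).
  assert (S1 := GamOp_spec e c He0 g base_eg w K F (z + RtoC (- ln g))%C Hw (holo_cc F HF) HB).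
  assert (S2 : lineCI (fun x => F z * RtoC (gker g x))%C (F z * RtoC (Gam g))%C).
  { apply lineCI_mult. auto with cont. apply lineRI_GI. auto with cont. apply lineRI_k. generalize base_eg; lra. }
  assert (Hrc : contRC (fun x => F (z + RtoC (- ln g) + RtoC x)%C)) by auto with cont.
  assert (S3 : lineCI (fun x => RtoC (gker g x) * (F z - F (z + RtoC (- ln g) + RtoC x)))%C (F z * RtoC (Gam g) - GamOp g F (z + RtoC (- ln g)))%C).
  { apply (lineCI_ext (fun x => F z * RtoC (gker g x) - RtoC (gker g x) * F (z + RtoC (- ln g) + RtoC x))%C). intros; ring.
    apply (lineCI_minus (fun x => F z * RtoC (gker g x))%C (fun x => RtoC (gker g x) * F (z + RtoC (- ln g) + RtoC x))%C); auto with cont. }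
  destruct moment_bound as [L [HL1 HL2]].
  assert (Hrr : contRR (fun x => Rabs (x - ln g))).
  { intros x. apply (continuous_comp (fun x => x - ln g) Rabs). apply (contRR_minus (fun x => x) (fun _ => ln g) contRR_id (contRR_const _)). apply continuous_Rabs. }
  set (M := exp c * K / w z).
  assert (HM : 0 <= M). { unfold M. apply Rmult_le_pos. apply Rmult_le_pos; auto. left; apply exp_pos. left; apply Rinv_0_lt_compat, Hw. }
  destruct (lineCI_dom (fun x => RtoC (gker g x) * (F z - F (z + RtoC (- ln g) + RtoC x)))%C
    (fun x => M * (gker g x * (Rabs (x - ln g) * exp (Rabs (x - ln g))))) (M * L)) as [l [Hl1 Hl2]].
  - auto with cont.
  - auto 10 with cont.
  - intros x. rewrite Cmod_mult, Cmod_R, Rabs_right by (left; apply gker_pos).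
    replace (M * (gker g x * (Rabs (x - ln g) * exp (Rabs (x - ln g))))) with (gker g x * (Rabs (x - ln g) * (M * exp (Rabs (x - ln g))))) by ring.
    apply Rmult_le_compat_l. left; apply gker_pos. rewrite Cmod_sym.
    replace (z + RtoC (- ln g) + RtoC x)%C with (z + RtoC (x - ln g))%C by (unfold Rminus; rewrite RtoC_plus; ring).
    rewrite <- (Cmod_R (x - ln g)) at 1.
    apply (entire_mvt F (C_derive F) HF). intros t Ht. rewrite <- RtoC_mult.
    eapply Rle_trans. apply (wbound_at_R e c w _ _ z (t * (x - ln g)) Hw HB1). unfold M. apply Rmult_le_compat_l. exact HM.
    apply exp_mono. rewrite Rabs_mult, (Rabs_right t) by lra. assert (H := Rabs_pos (x - ln g)).
    rewrite <- Rmult_assoc. rewrite <- (Rmult_1_l (Rabs (x - ln g))) at 2. apply Rmult_le_compat_r; auto. nra.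
  - apply lineRI_scal; auto with cont.
  - rewrite (lineCI_unique _ _ _ Hl1 S3) in Hl2. 
    replace (GamRem F z) with (RtoC (/ Gam g) * (F z * RtoC (Gam g) - GamOp g F (z + RtoC (- ln g))))%C.
    2: { unfold GamRem. transitivity ((RtoC (/ Gam g) * RtoC (Gam g)) * F z - RtoC (/ Gam g) * GamOp g F (z + RtoC (- ln g)))%C. ring.
         rewrite <- RtoC_mult, Rinv_l by lra. ring. }
    assert (Hi : 0 < / Gam g) by now apply Rinv_0_lt_compat.
    rewrite Cmod_mult, Cmod_R, Rabs_right by lra.
    apply Rle_trans with (/ Gam g * (M * (Gam g * (exp (- c) / 2))) * w z).
    apply Rmult_le_compat_r. lra. apply Rmult_le_compat_l. lra. eapply Rle_trans. exact Hl2. now apply Rmult_le_compat_l.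
    unfold M. rewrite exp_Ropp. right. field. assert (0 < exp c) by apply exp_pos. lra.
Qed.

End Base.

(** * Series of entire functions with geometric bounds *)

Fixpoint psum (u : nat -> C -> C) (n : nat) (z : C) : C :=
  match n with O => 0 | S m => (psum u m z + u m z)%C end.
Definition gsum (u : nat -> C -> C) (z : C) : C := Clim (fun n => psum u n z).

Lemma psum_ent u n : (forall m, holo (u m)) -> holo (psum u n).
Proof. intros H. induction n. apply holo_intro with (fun _ => RtoC 0). intros z. exact (cderiv_const 0 z). apply (holo_plus (psum u n) (u n)); auto. Qed.

Lemma C_derive_plus F G z : holo F -> holo G -> C_derive (fun z => F z + G z)%C z = (C_derive F z + C_derive G z)%C.
Proof. intros HF HG. apply cderiv_C_derive. apply cderiv_plus; [apply HF|apply HG]. Qed.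

Lemma psum_step u n z : (psum u (S n) z - psum u n z = u n z)%C.
Proof. simpl. ring. Qed.

Lemma gsum_dist w K u n : (forall z, 0 < w z) -> (forall m, wbound w (K * (/ 2) ^ m) (u m)) ->
  wbound w (4 * K * (/ 2) ^ n) (fun z => gsum u z - psum u n z)%C.
Proof.
  intros Hw H z. specialize (Hw z).
  assert (A := geom_lim (fun n => psum u n z) (K / w z)). cbv beta in A.
  assert (B : forall n, Cmod (psum u (S n) z - psum u n z)%C <= K / w z * (/ 2) ^ n).
  { intros m. rewrite psum_step. replace (K / w z * (/ 2) ^ m) with ((K * (/2)^m) / w z) by (field; lra). now apply wbound_le. }
  specialize (A B n). fold (gsum u z) in A. apply Rmult_le_compat_r with (r := w z) in A; [|lra].
  eapply Rle_trans. exact A. right. field. lra.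
Qed.

Lemma psum_bnd w K u n : (forall z, 0 < w z) -> (forall m, wbound w (K * (/ 2) ^ m) (u m)) -> wbound w (2 * K) (psum u n).
Proof.
  intros Hw H. assert (HK : 0 <= K). { specialize (H O). simpl in H. rewrite Rmult_1_r in H. eapply wbound_pos; eauto. }
  assert (G : wbound w (2 * K * (1 - (/ 2) ^ n)) (psum u n)).
  { induction n. intros z. simpl. rewrite Cmod_0. lra.
    eapply wbound_weak; [|apply (wbound_plus w _ _ (psum u n) (u n) Hw IHn (H n))]. simpl. lra. }
  eapply wbound_weak; [|exact G]. assert (0 < (/ 2) ^ n) by (apply pow_lt; lra). nra.
Qed.

(** Termwise differentiation: the partial sums satisfy a quadratic Taylor estimate whose constant
    does not depend on n, and this estimate survives the limit. *)
Lemma gsum_ent e c w K u : 0 <= c -> weight e c w -> (forall m, holo (u m)) -> (forall m, wbound w (K * (/ 2) ^ m) (u m)) -> holo (gsum u).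
Proof.
  intros Hc0 Hw Hu H. assert (Hwp : forall z, 0 < w z) by apply Hw.
  assert (Hec := exp_pos c).
  assert (HK : 0 <= K). { assert (H0 := H O). simpl in H0. rewrite Rmult_1_r in H0. eapply wbound_pos; eauto. }
  set (du := fun n => C_derive (u n)).
  assert (Hdu : forall m, wbound w (exp c * K * (/2)^m) (du m)).
  { intros m. rewrite Rmult_assoc. apply (wbound_derive e c); auto. }
  assert (Ed : forall n z, C_derive (psum u n) z = psum du n z).
  { induction n; intros z. simpl. apply cderiv_C_derive. exact (cderiv_const 0 z).
    simpl. rewrite <- IHn. apply (C_derive_plus (psum u n) (u n)); auto. now apply psum_ent. }
  apply holo_intro with (gsum du). intros z.
  set (M := exp c * (exp c * (exp c * (2 * K)) / w z)).
  assert (HM0 : 0 <= M). { unfold M. apply Rmult_le_pos. lra. apply Rmult_le_pos. repeat apply Rmult_le_pos; lra. left; apply Rinv_0_lt_compat, Hwp. }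
  assert (Hn : forall n h, Cmod h <= 1 -> Cmod (psum u n (z + h) - psum u n z - psum du n z * h)%C <= Cmod h * (Cmod h * M)).
  { intros n h Hh. rewrite <- Ed. assert (HE := psum_ent u n Hu). assert (HE1 := holo_derive _ HE).
    assert (HB := psum_bnd w K u n Hwp H). assert (HB1 := wbound_derive e c w _ _ Hw HE HB). assert (HB2 := wbound_derive e c w _ _ Hw HE1 HB1).
    apply (entire_taylor _ _ (C_derive (C_derive (psum u n)))); auto. intros t Ht.
    eapply Rle_trans. apply (wbound_at e c w _ _ z (RtoC t * h)%C Hw HB2). unfold M. apply Rmult_le_compat_r.
    apply Rmult_le_pos. repeat apply Rmult_le_pos; lra. left; apply Rinv_0_lt_compat, Hwp.
    apply exp_mono. rewrite Cmod_mult, Cmod_R, Rabs_right by lra. assert (Hh0 := Cmod_ge_0 h). assert (t * Cmod h <= 1) by nra. nra. }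
  assert (Hlim : forall h, Cmod h <= 1 -> Cmod (gsum u (z + h) - gsum u z - gsum du z * h)%C <= Cmod h * (Cmod h * M)).
  { intros h Hh. apply Rnot_lt_le. intros Hlt. set (X := (gsum u (z + h) - gsum u z - gsum du z * h)%C) in *.
    (* W / 2^n bounds the total distance of the three limits from their partial sums; for large n it
       is smaller than the supposed excess. *)
    set (W := 4 * K / w (z + h)%C + 4 * K / w z + 4 * (exp c * K) / w z).
    destruct (half_pow_lim W (Cmod X - Cmod h * (Cmod h * M)) ltac:(lra)) as [n Hn']. specialize (Hn' n (Nat.le_refl _)).
    specialize (Hn n h Hh). assert (Q1 := gsum_dist w K u n Hwp H (z + h)%C). assert (Q2 := gsum_dist w K u n Hwp H z).
    assert (Q3 := gsum_dist w (exp c * K) du n Hwp Hdu z).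
    assert (R1 : Cmod (gsum u (z + h) - psum u n (z + h))%C <= 4 * K / w (z + h)%C * (/2)^n).
    { apply Rmult_le_reg_r with (w (z + h)%C). apply Hwp. eapply Rle_trans. exact Q1. right; field. specialize (Hwp (z + h)%C); lra. }
    assert (R2 : Cmod (gsum u z - psum u n z)%C <= 4 * K / w z * (/2)^n).
    { apply Rmult_le_reg_r with (w z). apply Hwp. eapply Rle_trans. exact Q2. right; field. specialize (Hwp z); lra. }
    assert (R3 : Cmod (gsum du z - psum du n z)%C <= 4 * (exp c * K) / w z * (/2)^n).
    { apply Rmult_le_reg_r with (w z). apply Hwp. eapply Rle_trans. exact Q3. right; field. specialize (Hwp z); lra. }
    assert (R3' : Cmod ((gsum du z - psum du n z) * h)%C <= 4 * (exp c * K) / w z * (/2)^n).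
    { rewrite Cmod_mult. generalize (Cmod_ge_0 (gsum du z - psum du n z)%C) (Cmod_ge_0 h). nra. }
    assert (T : Cmod X <= Cmod (psum u n (z + h) - psum u n z - psum du n z * h)%C + Cmod (gsum u (z + h) - psum u n (z + h))%C
       + Cmod (gsum u z - psum u n z)%C + Cmod ((gsum du z - psum du n z) * h)%C).
    { replace X with ((psum u n (z + h) - psum u n z - psum du n z * h) + (gsum u (z + h) - psum u n (z + h)) - (gsum u z - psum u n z) - ((gsum du z - psum du n z) * h))%C by (unfold X; ring).
      eapply Rle_trans. apply Cmod_triangle_minus. apply Rplus_le_compat_r. eapply Rle_trans. apply Cmod_triangle_minus. apply Rplus_le_compat_r. apply Cmod_triangle. }
    unfold W in Hn'. lra. }
  intros eps Heps. exists (Rmin 1 (eps / (M + 1))). split. apply Rmin_pos. lra. apply Rdiv_lt_0_compat; lra.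
  intros h Hh. assert (Hh1 : Cmod h < 1) by (eapply Rlt_le_trans; [exact Hh|apply Rmin_l]).
  assert (Hh2 : Cmod h < eps / (M + 1)) by (eapply Rlt_le_trans; [exact Hh|apply Rmin_r]).
  eapply Rle_trans. apply Hlim. lra. rewrite (Rmult_comm eps). apply Rmult_le_compat_l. apply Cmod_ge_0.
  apply Rmult_lt_compat_r with (r := M + 1) in Hh2; [|lra]. replace (eps / (M + 1) * (M + 1)) with eps in Hh2 by (field; lra).
  generalize (Cmod_ge_0 h). nra.
Qed.

(** * Surjectivity and injectivity for all g > e *)

Section Main.
Variables (e c : R).
Hypotheses (He0 : 0 <= e) (He1 : e <= 1) (Hc0 : 0 <= c).

(** F is fixed before the weight w, so that one preimage inherits the decay of every order; C0
    precedes G, so that it serves all members of a sequence. *)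
Definition GamOp_onto (g : R) : Prop := exists C0, 0 <= C0 /\ forall G w0 K0, holo G -> weight e c w0 -> wbound w0 K0 G ->
  exists F, holo F /\ (forall z, GamOp g F z = G z) /\ forall w K, weight e c w -> wbound w K G -> wbound w (C0 * K) F.
(** Restricted to real points because a Laplace transform determines [GamOp g F] only there. *)
Definition GamOp_inj (g : R) : Prop := forall F w0 K0, holo F -> weight e c w0 -> wbound w0 K0 F ->
  (forall x : R, GamOp g F x = 0) -> forall x : R, F x = 0.

Section BaseMain.
Variable g : R.
Hypothesis (Hg : 8 + 144 * (exp c * exp c) <= g).

Let Qi (G : C -> C) (m : nat) : C -> C := Nat.iter m (GamRem g) G.

Lemma Qi_props G : holo G -> forall w K, weight e c w -> wbound w K G -> forall m, holo (Qi G m) /\ wbound w (K * (/ 2) ^ m) (Qi G m).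
Proof.
  intros HG w K Hw HB m. induction m as [|m [IH1 IH2]]. split; auto. simpl. now rewrite Rmult_1_r.
  split. apply (GamRem_ent e c g He0 He1 Hc0 Hg w _ _ Hw IH1 IH2).
  change (Qi G (S m)) with (GamRem g (Qi G m)). replace (K * (/2) ^ S m) with (K * (/2)^m / 2) by (simpl; field). now apply (GamRem_bnd e c).
Qed.

(** The Neumann series H solves H - [GamRem] H = G with G z = G' (z - ln g) / Gam g; read at z + ln
    g, this says that A_g H = G'. *)
Lemma GamOp_onto_base : GamOp_onto g.
Proof.
  assert (HGm := Gam_g_pos e c g He0 He1 Hg).
  exists (4 * (/ Gam g * exp (e * Rabs (ln g)))). split.
  { apply Rmult_le_pos. lra. apply Rmult_le_pos. left; now apply Rinv_0_lt_compat. left; apply exp_pos. }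
  intros G' w0 K0 HG' Hw0 HB0.
  set (a := RtoC (/ Gam g)). set (G := fun z => (a * G' (z + RtoC (- ln g)))%C).
  assert (HG : holo G) by (apply (holo_scal a (fun z => G' (z + RtoC (- ln g)))%C); now apply holo_shift).
  assert (HBG : forall w K, weight e c w -> wbound w K G' -> wbound w (/ Gam g * exp (e * Rabs (ln g)) * K) G).
  { intros w K Hw HB. rewrite Rmult_assoc. replace (/ Gam g) with (Cmod a).
    2: { unfold a. rewrite Cmod_R, Rabs_right; auto. left. now apply Rinv_0_lt_compat. }
    apply wbound_scal. rewrite <- (Rabs_Ropp (ln g)). now apply (wbound_shift e c). }
  set (u := Qi G). set (H := gsum u).
  assert (Hu : forall w K, weight e c w -> wbound w K G -> forall m, wbound w (K * (/ 2) ^ m) (u m)).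
  { intros w K Hw HB m. apply (Qi_props G HG w K Hw HB m). }
  set (K1 := / Gam g * exp (e * Rabs (ln g)) * K0). assert (HB1 := HBG w0 K0 Hw0 HB0). fold K1 in HB1.
  assert (Hue : forall m, holo (u m)) by (intros m; apply (Qi_props G HG w0 K1 Hw0 HB1 m)).
  assert (Hwp : forall z, 0 < w0 z) by apply Hw0.
  assert (Hu0 := Hu w0 K1 Hw0 HB1).
  assert (HH : holo H) by (apply (gsum_ent e c w0 K1 u); auto).
  assert (HHB : forall w K, weight e c w -> wbound w K G -> wbound w (4 * K) H).
  { intros w K Hw HB. assert (A := gsum_dist w K u 0 (proj1 Hw) (Hu w K Hw HB)). simpl in A. rewrite Rmult_1_r in A.
    intros z. specialize (A z). cbv beta in A. replace (gsum u z - 0)%C with (H z) in A by (unfold H; ring). exact A. }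
  assert (HS : forall n z, psum u (S n) z = (G z + GamRem g (psum u n) z)%C).
  { induction n; intros z.
    - simpl. unfold u, Qi. simpl. unfold GamRem. rewrite (GamOp_ext g (fun _ => 0) (fun y => G y - G y)%C) by (intros; ring).
      rewrite (GamOp_minus e c He0 g (base_eg e c g He0 He1 Hg) w0 K1 K1); auto with cont. ring.
    - change (psum u (S (S n)) z) with (psum u (S n) z + u (S n) z)%C. rewrite IHn.
      assert (E : GamRem g (u n) z = (GamRem g (psum u (S n)) z - GamRem g (psum u n) z)%C).
      { transitivity (GamRem g (fun y => psum u (S n) y - psum u n y)%C z).
        - apply (f_equal (fun F => GamRem g F z)). apply functional_extensionality. intros y. simpl. ring.
        - apply (GamRem_minus e c g He0 He1 Hg w0 (2 * K1) (2 * K1) (psum u (S n)) (psum u n)); auto using psum_ent, psum_bnd. }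
      change (u (S n) z) with (GamRem g (u n) z). rewrite E. ring. }
  assert (HQ : forall z, (GamRem g H z - H z + G z = 0)%C).
  (* For every n the residual is at most 2 K1 / 2^n from [GamRem] of the tail after n terms, plus 2
     K1 / 2^n from the tail after n + 1 terms. *)
  { apply (wbound_zero w0 (4 * K1) _ Hwp). intros n.
    assert (A := gsum_dist w0 K1 u n Hwp Hu0). assert (B := gsum_dist w0 K1 u (S n) Hwp Hu0).
    assert (A2 := GamRem_bnd e c g He0 He1 Hg w0 _ _ Hw0 (holo_minus _ _ HH (psum_ent u n Hue)) A).
    assert (D := wbound_minus w0 _ _ _ _ Hwp A2 B). intros z. specialize (D z). cbv beta in D.
    rewrite (GamRem_minus e c g He0 He1 Hg w0 (4 * K1) (2 * K1) H (psum u n)) in D; auto using psum_ent, psum_bnd.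
    rewrite HS in D. fold H in D. 
    replace (GamRem g H z - GamRem g (psum u n) z - (H z - (G z + GamRem g (psum u n) z)))%C with (GamRem g H z - H z + G z)%C in D by ring.
    eapply Rle_trans. exact D. simpl. right. field. }
  exists H. split; auto. split.
  - intros z. specialize (HQ (z + RtoC (ln g))%C). unfold GamRem, G in HQ. fold a in HQ.
    replace (z + RtoC (ln g) + RtoC (- ln g))%C with z in HQ by (rewrite RtoC_opp; ring).
    assert (Ea : (a * (G' z - GamOp g H z) = 0)%C) by (rewrite <- HQ; ring).
    symmetry. apply Ceq_minus. replace (G' z - GamOp g H z)%C with (RtoC (Gam g) * (a * (G' z - GamOp g H z)))%C. rewrite Ea; ring.
    unfold a. rewrite Cmult_assoc, <- RtoC_mult, Rinv_r by lra. ring.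
  - intros w K Hw HB. rewrite Rmult_assoc. apply HHB; auto.
Qed.

(** If A_g F vanishes on R then [GamRem] fixes the values of F on R, the translation by ln g being
    real. Every iterate therefore agrees with F there, while its weighted bound halves each time. *)
Lemma GamOp_inj_base : GamOp_inj g.
Proof.
  intros F w0 K0 HF Hw0 HB0 H0 x.
  assert (HQ : forall m, forall y : R, Qi F m y = F y).
  { induction m; intros y. reflexivity. change (Qi F (S m) y) with (GamRem g (Qi F m) y). unfold GamRem. rewrite IHm.
    rewrite <- RtoC_plus. rewrite (GamOp_ext g (Qi F m) F). rewrite H0. ring.
    intros t. rewrite <- RtoC_plus. apply IHm. }
  apply Cmod_eq_0. apply Rle_antisym; [|apply Cmod_ge_0]. apply Rnot_lt_le. intros Hp.
  assert (Hw := proj1 Hw0 x). assert (Hp2 : 0 < Cmod (F x) * w0 x) by nra.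
  destruct (half_pow_lim K0 _ Hp2) as [n Hn]. specialize (Hn n (Nat.le_refl _)).
  destruct (Qi_props F HF w0 K0 Hw0 HB0 n) as [_ A]. specialize (A x). rewrite HQ in A. lra.
Qed.
End BaseMain.

Lemma GamOp_onto_desc g : e < g -> GamOp_onto (g + 1) -> GamOp_onto g.
Proof.
  intros Hg [C0 [HC0 HS]]. exists ((Cmod g + exp c) * C0). assert (Hec := exp_pos c). assert (Hgm := Cmod_ge_0 g). split.
  apply Rmult_le_pos; lra.
  intros G w0 K0 HG Hw0 HB0. destruct (HS G w0 K0 HG Hw0 HB0) as [H [HH [HA HB]]].
  exists (fun z => RtoC g * H z + C_derive H z)%C. split; [|split].
  - apply (holo_plus (fun z => RtoC g * H z)%C (C_derive H)). now apply holo_scal. now apply holo_derive.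
  - intros z. rewrite <- (GamOp_rec e c He0 g w0 (C0 * K0)); auto.
  - intros w K Hw HBw. specialize (HB w K Hw HBw).
    replace ((Cmod g + exp c) * C0 * K) with (Cmod g * (C0 * K) + exp c * (C0 * K)) by ring.
    apply (wbound_plus w _ _ (fun z => RtoC g * H z)%C (C_derive H)). apply Hw. now apply wbound_scal. now apply (wbound_derive e c).
Qed.

Lemma zero_on_R_derive F l x : cderiv F (RtoC x) l -> (forall x : R, F x = 0) -> l = 0.
Proof.
  intros HF H0. apply Cmod_eq_0. apply Rle_antisym; [|apply Cmod_ge_0]. apply Rnot_lt_le. intros Hp.
  destruct (HF (Cmod l / 2) ltac:(lra)) as [d [Hd H]].
  specialize (H (RtoC (d / 2))). rewrite Cmod_R, Rabs_right in H by lra. specialize (H ltac:(lra)).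
  rewrite <- RtoC_plus, !H0 in H. replace (0 - 0 - l * RtoC (d / 2))%C with (- (l * RtoC (d / 2)))%C in H by ring.
  rewrite Cmod_opp, Cmod_mult, Cmod_R, Rabs_right in H by lra. nra.
Qed.

(** A_g commutes with D, so on R the recursion gives A_(g+1) F = g A_g F + (A_g F)', and both terms
    vanish. *)
Lemma GamOp_inj_desc g : e < g -> GamOp_inj (g + 1) -> GamOp_inj g.
Proof.
  intros Hg HI F w0 K0 HF Hw0 HB0 H0. apply (HI F w0 K0); auto. intros x.
  assert (HB1 := wbound_derive e c w0 K0 F Hw0 HF HB0).
  rewrite (GamOp_rec e c He0 g w0 K0); auto.
  rewrite (GamOp_plus e c He0 g Hg w0 (Cmod g * K0) (exp c * K0) (fun y => RtoC g * F y)%C (C_derive F)); auto with cont.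
  rewrite (GamOp_scal e c He0 g Hg w0 K0); auto with cont. rewrite H0.
  rewrite (zero_on_R_derive (GamOp g F) (GamOp g (C_derive F) x) x); auto. ring.
  eapply (GamOp_deriv e c); eauto.
  apply contCC_scal; auto with cont. now apply wbound_scal.
Qed.

(** Finitely many unit steps lead from any g > e to beyond the threshold g0, however large the
    latter is in terms of c. *)
Lemma desc_ind (P : R -> Prop) g0 : (forall g, g0 <= g -> P g) -> (forall g, e < g -> P (g + 1) -> P g) -> forall g, e < g -> P g.
Proof.
  intros Hb Hd g Hg. assert (H : forall n g, e < g -> g0 <= g + INR n -> P g).
  { induction n; intros g' Hg' Hn. apply Hb. simpl in Hn. lra. apply Hd; auto. apply IHn. lra. rewrite S_INR in Hn. lra. }
  destruct (INR_unbounded (g0 - g)) as [n Hn]. apply (H n); lra.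
Qed.

Lemma GamOp_onto_all g : e < g -> GamOp_onto g.
Proof. apply desc_ind with (8 + 144 * (exp c * exp c)). apply GamOp_onto_base. apply GamOp_onto_desc. Qed.
Lemma GamOp_inj_all g : e < g -> GamOp_inj g.
Proof. apply desc_ind with (8 + 144 * (exp c * exp c)). apply GamOp_inj_base. apply GamOp_inj_desc. Qed.
End Main.

(** * The space Z in terms of weighted bounds *)

(* The factor [stripD e n] makes [(1 + stripD e n * |z|)^n] grow at rate at most [e] under
   translations, for every [n]. *)
Definition stripD (e : R) (n : nat) : R := e / (INR n + 1).
Definition stripW (e r : R) (n : nat) (z : C) : R := (1 + stripD e n * Cmod z) ^ n * exp (- (r * Rabs (Im z))).

Lemma stripD_props e n : 0 < e -> e <= 1 -> 0 < stripD e n /\ stripD e n <= 1 /\ INR n * stripD e n <= e.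
Proof.
  intros He He1. assert (Hn := pos_INR n). unfold stripD. split; [|split].
  - apply Rdiv_lt_0_compat; lra.
  - apply Rmult_le_reg_r with (INR n + 1). lra. unfold Rdiv. rewrite Rmult_assoc, Rinv_l by lra. nra.
  - apply Rmult_le_reg_r with (INR n + 1). lra. replace (INR n * (e / (INR n + 1)) * (INR n + 1)) with (INR n * e) by (field; lra). nra.
Qed.

Lemma pow_exp_le a n : 0 <= a -> (1 + a) ^ n <= exp (INR n * a).
Proof.
  intros Ha. induction n. simpl. rewrite Rmult_0_l, exp_0. lra.
  rewrite S_INR. replace ((INR n + 1) * a) with (a + INR n * a) by ring. rewrite exp_plus. simpl.
  apply Rmult_le_compat. lra. apply pow_le; lra. apply exp_ineq1_le. exact IHn.
Qed.

Lemma stripW_pos e r n z : 0 < e -> e <= 1 -> 0 < stripW e r n z.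
Proof.
  intros He He1. destruct (stripD_props e n He He1) as [H1 [H2 H3]]. apply Rmult_lt_0_compat. apply pow_lt.
  assert (H := Cmod_ge_0 z). nra. apply exp_pos.
Qed.

(** Submultiplicativity of 1 + d |z| leaves the factor (1 + d |h|)^n <= exp (n d |h|), and [stripD]
    is chosen so that n d <= e. *)
Lemma stripW_pow_shift e n z h : 0 < e -> e <= 1 -> (1 + stripD e n * Cmod (z + h)%C) ^ n <= exp (e * Cmod h) * (1 + stripD e n * Cmod z) ^ n.
Proof.
  intros He He1. destruct (stripD_props e n He He1) as [H1 [H2 H3]].
  assert (A := Cmod_ge_0 z). assert (B := Cmod_ge_0 h). assert (D := Cmod_triangle z h). assert (D0 := Cmod_ge_0 (z + h)%C).
  set (d := stripD e n) in *.
  apply Rle_trans with (((1 + d * Cmod h) * (1 + d * Cmod z)) ^ n).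
  - apply pow_incr. split. nra. assert (0 <= d * Cmod h * (d * Cmod z)) by (apply Rmult_le_pos; nra). nra.
  - rewrite Rpow_mult_distr. apply Rmult_le_compat_r. apply pow_le; nra.
    eapply Rle_trans. apply pow_exp_le. nra. apply exp_mono. rewrite <- Rmult_assoc. apply Rmult_le_compat_r; auto.
Qed.

(** A real translation leaves Im z unchanged, so r enters only the rate for complex translations.
    Hence the condition e < g can be met whatever the type r. *)
Lemma stripW_wt e r n : 0 < e -> e <= 1 -> 0 <= r -> weight e (e + r) (stripW e r n).
Proof.
  intros He He1 Hr. split; [|split].
  - intros z. now apply stripW_pos.
  - intros z x. unfold stripW. assert (H := stripW_pow_shift e n z x He He1). rewrite Cmod_R in H.
    replace (Im (z + x)%C) with (Im z) by (destruct z; unfold Im; simpl; ring).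
    rewrite <- Rmult_assoc. apply Rmult_le_compat_r; auto. left; apply exp_pos.
  - intros z h. unfold stripW. assert (H := stripW_pow_shift e n z h He He1).
    replace ((e + r) * Cmod h) with (e * Cmod h + r * Cmod h) by ring. rewrite exp_plus.
    replace (exp (e * Cmod h) * exp (r * Cmod h) * ((1 + stripD e n * Cmod z) ^ n * exp (- (r * Rabs (Im z))))) with
      ((exp (e * Cmod h) * (1 + stripD e n * Cmod z) ^ n) * (exp (r * Cmod h) * exp (- (r * Rabs (Im z))))) by ring.
    destruct (stripD_props e n He He1) as [H1 [H2 H3]].
    apply Rmult_le_compat; auto. apply pow_le. assert (D0 := Cmod_ge_0 (z + h)%C). nra. left; apply exp_pos.
    rewrite <- exp_plus. apply exp_mono.
    assert (A : Rabs (Im z) <= Rabs (Im (z + h)%C) + Cmod h).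
    { replace (Im z) with (Im (z + h)%C + - Im h) by (destruct z, h; unfold Im; simpl; ring).
      eapply Rle_trans. apply Rabs_triang. rewrite Rabs_Ropp. generalize (im_Cmod_le h). lra. }
    nra.
Qed.

Lemma Rpower_neg_INR x n : 0 < x -> Rpower x (- INR n) = / x ^ n.
Proof. intros H. now rewrite Rpower_Ropp, Rpower_pow. Qed.

Lemma stripW_bnd e r M Phi n : 0 < e -> e <= 1 -> Z_bound r M Phi -> wbound (stripW e r n) (M (INR n)) Phi.
Proof.
  intros He He1 H z. specialize (H (INR n) z). destruct (stripD_props e n He He1) as [H1 [H2 H3]].
  assert (Hz := Cmod_ge_0 z). assert (Hz1 : 0 < 1 + Cmod z) by lra. rewrite Rpower_neg_INR in H by auto.
  assert (Hp : 0 < (1 + Cmod z) ^ n) by (now apply pow_lt).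
  unfold stripW. apply Rle_trans with (Cmod (Phi z) * ((1 + Cmod z) ^ n * exp (- (r * Rabs (Im z))))).
  - apply Rmult_le_compat_l. apply Cmod_ge_0. apply Rmult_le_compat_r. left; apply exp_pos. apply pow_incr. nra.
  - apply Rle_trans with (M (INR n) * / (1 + Cmod z) ^ n * exp (r * Rabs (Im z)) * ((1 + Cmod z) ^ n * exp (- (r * Rabs (Im z))))).
    apply Rmult_le_compat_r; auto. apply Rmult_le_pos. lra. left; apply exp_pos.
    rewrite exp_Ropp. right. field. split. apply Rgt_not_eq, exp_pos. lra.
Qed.

Definition natup (kappa : R) : nat := Z.to_nat (up (Rabs kappa)).
Lemma natup_le kappa : kappa <= INR (natup kappa).
Proof.
  unfold natup. assert (H := archimed (Rabs kappa)). assert (Hp := Rabs_pos kappa).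
  rewrite INR_IZR_INZ, Z2Nat.id. generalize (Rle_abs kappa); lra.
  apply le_IZR. lra.
Qed.

(** The real exponent kappa is rounded up to a natural number; the power of 1 / d is the price of 1
    + |z| <= (1 + d |z|) / d. *)
Definition Mof (e : R) (K : nat -> R) (kappa : R) : R := K (natup kappa) * (/ stripD e (natup kappa)) ^ natup kappa.

Lemma stripW_Z_bound e r K Phi : 0 < e -> e <= 1 -> (forall n, wbound (stripW e r n) (K n) Phi) -> Z_bound r (Mof e K) Phi.
Proof.
  intros He He1 H kappa z. unfold Mof. assert (Hk := natup_le kappa). set (n := natup kappa) in *.
  specialize (H n). assert (HW := stripW_pos e r n z He He1).
  assert (HK : 0 <= K n) by (eapply wbound_pos; [|exact H]; intros; now apply stripW_pos).
  specialize (H z). destruct (stripD_props e n He He1) as [H1 [H2 H3]]. assert (Hz := Cmod_ge_0 z).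
  set (d := stripD e n) in *. 
  assert (Hpow : 0 < (1 + d * Cmod z) ^ n) by (apply pow_lt; nra).
  assert (Hpow2 : 0 < (1 + Cmod z) ^ n) by (apply pow_lt; lra).
  assert (Hd : 0 < d ^ n) by (now apply pow_lt).
  apply Rle_trans with (K n * (/ d) ^ n * / (1 + Cmod z) ^ n * exp (r * Rabs (Im z))).
  - apply Rmult_le_reg_r with (stripW e r n z); auto. eapply Rle_trans. exact H. unfold stripW. fold d.
    rewrite exp_Ropp, pow_inv.
    replace (K n * / d ^ n * / (1 + Cmod z) ^ n * exp (r * Rabs (Im z)) * ((1 + d * Cmod z) ^ n * / exp (r * Rabs (Im z)))) with
      (K n * ((1 + d * Cmod z) ^ n * / (d ^ n * (1 + Cmod z) ^ n))).
    2: { field. repeat split; try lra. apply Rgt_not_eq, exp_pos. }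
    rewrite <- (Rmult_1_r (K n)) at 1. apply Rmult_le_compat_l; auto.
    rewrite <- Rpow_mult_distr. apply Rmult_le_reg_r with ((d * (1 + Cmod z)) ^ n). apply pow_lt; nra.
    rewrite Rmult_assoc, Rinv_l, Rmult_1_l, Rmult_1_r. apply pow_incr. nra.
    apply Rgt_not_eq, pow_lt; nra.
  - apply Rmult_le_compat_r. left; apply exp_pos. apply Rmult_le_compat_l.
    apply Rmult_le_pos; auto. apply pow_le. left; now apply Rinv_0_lt_compat.
    rewrite <- Rpower_neg_INR by lra. apply Rle_Rpower; lra.
Qed.

Lemma Z_bound_mono r r' M Phi : r <= r' -> Z_bound r M Phi -> Z_bound r' M Phi.
Proof.
  intros Hr H kappa z. eapply Rle_trans. apply H. apply Rmult_le_compat_l.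
  (* The bound at z = 0 shows that M kappa is nonnegative. *)
  - apply Rmult_le_pos; [|left; apply exp_pos]. specialize (H kappa 0).
    rewrite Cmod_0, Rplus_0_r in H. unfold Rpower in H. rewrite ln_1, Rmult_0_r, exp_0 in H. unfold Im in H. simpl in H.
    rewrite Rabs_R0, Rmult_0_r, exp_0 in H. generalize (Cmod_ge_0 (Phi 0)). lra.
  - apply exp_mono. apply Rmult_le_compat_r; auto. apply Rabs_pos.
Qed.

Lemma stripW_refl e r n z : stripW e r n (- z)%C = stripW e r n z.
Proof. unfold stripW. rewrite Cmod_opp, im_opp, Rabs_Ropp. reflexivity. Qed.

Lemma holo_refl F : holo F -> holo (fun z => F (- z)%C).
Proof.
  intros HF. apply holo_intro with (fun z => - C_derive F (- z))%C. intros z eps He.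
  destruct (HF (- z)%C eps He) as [d [Hd H]]. exists d. split; auto. intros h Hh.
  specialize (H (- h)%C). rewrite Cmod_opp in H. specialize (H Hh).
  replace (- (z + h))%C with (- z + - h)%C by ring.
  replace (F (- z + - h) - F (- z) - - C_derive F (- z) * h)%C with (F (- z + - h) - F (- z) - C_derive F (- z) * - h)%C by ring. exact H.
Qed.

Lemma wbound_refl e r n K F : wbound (stripW e r n) K F -> wbound (stripW e r n) K (fun z => F (- z)%C).
Proof. intros H z. specialize (H (- z)%C). rewrite stripW_refl in H. exact H. Qed.

Lemma cderiv_Re F (x : R) l : cderiv F x l -> is_derive (fun t : R => Re (F (RtoC t))) x (Re l).
Proof.
  intros H. apply is_derive_locally. intros eps. destruct (H eps (cond_pos eps)) as [d [Hd H1]].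
  exists (mkposreal d Hd). intros y Hy. change R in (type of y). change (Rabs (y - x) < d) in Hy.
  specialize (H1 (RtoC (y - x))). rewrite Cmod_R in H1. specialize (H1 Hy).
  change (Rabs (Re (F y) - Re (F x) - (y - x) * Re l) <= eps * Rabs (y - x)).
  eapply Rle_trans; [|exact H1]. eapply Rle_trans; [|apply re_le_Cmod].
  rewrite <- RtoC_plus. replace (x + (y - x)) with y by ring. right. f_equal. destruct l; unfold Re; simpl; ring.
Qed.

(** The n-th real derivative is the real part of the n-th complex derivative, which keeps all
    weighted bounds by [wbound_derive]; the induction carries it along as [Pn]. *)
Lemma schwartz_Re e r Phi : 0 < e -> e <= 1 -> 0 <= r -> holo Phi -> (forall n, exists K, wbound (stripW e r n) K Phi) ->
  schwartz_R (fun x => Re (Phi (RtoC x))).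
Proof.
  intros He He1 Hr HF HB. set (u := fun x : R => Re (Phi (RtoC x))).
  assert (H : forall n, exists Pn, holo Pn /\ (forall m, exists K, wbound (stripW e r m) K Pn) /\
     (forall x, ex_derive_n u n x) /\ forall x, Derive_n u n x = Re (Pn (RtoC x))).
  { induction n as [|n [P [HP [HPB [Hex HD]]]]].
    - exists Phi. repeat split; auto.
    - exists (C_derive P). split. now apply holo_derive. split.
      + intros m. destruct (HPB m) as [K HK]. exists (exp (e + r) * K). apply (wbound_derive e); auto. now apply stripW_wt.
      + assert (Hd : forall x, is_derive (Derive_n u n) x (Re (C_derive P x))).
        { intros x. apply (is_derive_ext (fun t : R => Re (P (RtoC t)))). intros t; now rewrite HD. apply cderiv_Re, HP. }
        split. intros x. exists (Re (C_derive P x)). apply Hd. intros x. simpl. apply is_derive_unique, Hd. }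
  split.
  - intros n x. destruct (H n) as [P [_ [_ [Hex _]]]]. apply Hex.
  - intros m n. destruct (H n) as [P [HP [HPB [_ HD]]]]. destruct (HPB m) as [K HK].
    destruct (stripD_props e m He He1) as [H1 [H2 H3]].
    exists ((/ stripD e m) ^ m * K). intros x. rewrite HD. specialize (HK x). unfold stripW in HK. rewrite im_RtoC, Rabs_R0, Rmult_0_r, Ropp_0, exp_0, Rmult_1_r, Cmod_R in HK.
    apply Rle_trans with ((/ stripD e m) ^ m * (Cmod (P x) * (1 + stripD e m * Rabs x) ^ m)).
    + replace ((/ stripD e m) ^ m * (Cmod (P x) * (1 + stripD e m * Rabs x) ^ m)) with ((/ stripD e m * (1 + stripD e m * Rabs x)) ^ m * Cmod (P x)) by (rewrite Rpow_mult_distr; ring).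
      assert (Hx := Rabs_pos x). assert (Hi : 0 < / stripD e m) by now apply Rinv_0_lt_compat.
      apply Rmult_le_compat. now apply pow_le. apply Rabs_pos. 2: apply re_le_Cmod.
      apply pow_incr. split; auto. replace (/ stripD e m * (1 + stripD e m * Rabs x)) with (/ stripD e m + Rabs x) by (field; lra). lra.
    + apply Rmult_le_compat_l; auto. apply pow_le. left; now apply Rinv_0_lt_compat.
Qed.

Lemma schwartz_ext u v : (forall x, u x = v x) -> schwartz_R u -> schwartz_R v.
Proof. intros H. replace v with u. auto. now apply functional_extensionality. Qed.

(** The imaginary part is handled as the real part of - Ci times Phi. *)
Lemma Z_bound_schwartz r M Phi phi : 0 <= r -> holo Phi -> Z_bound r M Phi -> (forall x : R, Phi x = phi x) -> schwartz phi.
Proof.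
  intros Hr HF HB Hphi. assert (HW : forall n, exists K, wbound (stripW 1 r n) K Phi).
  { intros n. exists (M (INR n)). apply stripW_bnd; auto; lra. }
  split.
  - apply schwartz_ext with (fun x => Re (Phi (RtoC x))). intros; now rewrite Hphi. apply (schwartz_Re 1 r); auto; lra.
  - apply schwartz_ext with (fun x => Re (- Ci * Phi (RtoC x))%C). intros x. rewrite <- Hphi. destruct (Phi x); unfold Re, Im; simpl; ring.
    apply (schwartz_Re 1 r (fun z => - Ci * Phi z)%C); auto; try lra. now apply holo_scal.
    intros n. destruct (HW n) as [K HK]. exists (Cmod (- Ci) * K). now apply wbound_scal.
Qed.

Lemma entire_ent Phi : entire Phi <-> holo Phi.
Proof.
  split.
  - intros H. intros z. apply cderiv_is_derive. apply C_derive_correct; auto.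
  - intros H z. exists (C_derive Phi z). apply cderiv_is_derive. apply H.
Qed.

(** * Compact sets and convergence in weighted norms *)

Lemma square_compact L : compact_set (fun z => Rabs (Re z) <= L /\ Rabs (Im z) <= L).
Proof.
  intros I U Uo Uc.
  set (K := fun z : C => Rabs (Re z) <= L /\ Rabs (Im z) <= L).
  (* Each point of the square gets a radius within which one member of the cover works; the other
     points get the dummy radius 1. This gauge is what [compactness_list] takes, and the finitely
     many centres it returns name the subcover. *)
  assert (Hd : forall t : Compactness.Tn 2 R, exists d : posreal, K (fst t, fst (snd t)) ->
     exists i, forall y : C, Rabs (fst y - fst t) < d -> Rabs (snd y - fst (snd t)) < d -> U i y).
  { intros [t1 [t2 []]]. simpl. destruct (excluded_middle_informative (K (t1, t2))) as [HK|HK].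
    - destruct (Uc _ HK) as [i Hi]. destruct (Uo i _ Hi) as [d H]. exists d. intros _. exists i. intros [y1 y2] H1 H2. apply H. split; assumption.
    - exists (mkposreal 1 Rlt_0_1). tauto. }
  set (dl := fun t => proj1_sig (constructive_indefinite_description _ (Hd t))).
  assert (Hdl : forall t, K (fst t, fst (snd t)) ->
     exists i, forall y : C, Rabs (fst y - fst t) < dl t -> Rabs (snd y - fst (snd t)) < dl t -> U i y).
  { intros t. unfold dl. destruct (constructive_indefinite_description _ (Hd t)); auto. }
  assert (HC := compactness_list 2 (- L, (- L, tt)) (L, (L, tt)) dl). apply NNPP in HC.
  destruct HC as [l Hl].
  assert (Hfin : forall l : list (Compactness.Tn 2 R), exists l' : list I, forall t, In t l -> K (fst t, fst (snd t)) ->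
     exists i, In i l' /\ forall y : C, Rabs (fst y - fst t) < dl t -> Rabs (snd y - fst (snd t)) < dl t -> U i y).
  { clear l Hl. induction l as [|t l [l' IH]].
    - exists nil. intros t [].
    - destruct (excluded_middle_informative (K (fst t, fst (snd t)))) as [HK|HK].
      + destruct (Hdl t HK) as [i Hi]. exists (i :: l'). intros s [<-|Hs] HKs. exists i. split; [now left|auto].
        destruct (IH s Hs HKs) as [j [Hj H]]. exists j. split; [now right|auto].
      + exists l'. intros s [<-|Hs] HKs. contradiction. auto. }
  destruct (Hfin l) as [l' Hl']. exists l'. intros [z1 z2] [Hz1 Hz2]. simpl in Hz1, Hz2.
  apply Rabs_le_between in Hz1, Hz2. 
  destruct (Hl (z1, (z2, tt))) as [[t1 [t2 []]] [Ht [[Hb1 [Hb2 _]] [Hc1 [Hc2 _]]]]]. simpl. unfold Re, Im in *; simpl in *. tauto.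
  destruct (Hl' _ Ht) as [i [Hi H]]. split; apply Rabs_le_between; simpl; tauto.
  exists i. split; auto. 
Qed.

Lemma compact_bounded K : compact_set K -> exists L, 0 <= L /\ forall z, K z -> Cmod z <= L.
Proof.
  intros H. destruct (H nat (fun n z => Cmod z < INR n)) as [l Hl].
  - intros n z Hz. assert (Hs : 0 < sqrt 2) by (apply sqrt_lt_R0; lra).
    assert (Hp : 0 < (INR n - Cmod z) / sqrt 2) by (apply Rdiv_lt_0_compat; lra).
    exists (mkposreal _ Hp). intros y Hy. apply ball_Cmod in Hy. simpl in Hy.
    replace (sqrt 2 * ((INR n - Cmod z) / sqrt 2)) with (INR n - Cmod z) in Hy by (field; lra).
    generalize (Cmod_triangle' y z). lra.
  - intros z _. destruct (INR_unbounded (Cmod z)) as [n Hn]. exists n. lra.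
  - assert (Hm : exists N, forall n, In n l -> (n <= N)%nat).
    { clear. induction l as [|a l [N IH]]. exists O. intros n []. exists (a + N)%nat. intros n [<-|Hn]. lia. specialize (IH n Hn). lia. }
    destruct Hm as [N HN]. exists (INR N). split. apply pos_INR. intros z Hz. destruct (Hl z Hz) as [n [Hn Hlt]].
    specialize (HN n Hn). apply le_INR in HN. lra.
Qed.

(** Under a common [Z_bound] this is equivalent to uniform convergence on compact sets, but it is a
    statement in one norm over all of C, to which operator bounds apply directly. The exponent 0
    leaves only the factor exp (- r |Im z|) in the weight. *)
Definition cvgW (e r : R) (Phi : nat -> C -> C) : Prop :=
  forall eps, 0 < eps -> exists N, forall k, (N <= k)%nat -> wbound (stripW e r 0) eps (Phi k).

Lemma cvg_cvgW e r M Phi : 0 <= r -> (forall k, Z_bound r M (Phi k)) -> cvg0_unif_compact Phi -> cvgW e r Phi.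
Proof.
  intros Hr HB Hc eps He.
  assert (HM : 0 <= M 1).
  { specialize (HB O 1 0). rewrite Cmod_0, Rplus_0_r in HB. unfold Rpower in HB. rewrite ln_1, Rmult_0_r, exp_0 in HB. unfold Im in HB. simpl in HB.
    rewrite Rabs_R0, Rmult_0_r, exp_0 in HB. generalize (Cmod_ge_0 (Phi O 0)). lra. }
  (* Beyond this radius the decay of order kappa = 1 alone brings the weighted value below eps. *)
  set (L := M 1 / eps). assert (HL : 0 <= L) by (apply Rmult_le_pos; auto; left; now apply Rinv_0_lt_compat).
  destruct (Hc _ (square_compact L) eps He) as [N HN]. exists N. intros k0 Hk z.
  unfold stripW. simpl. rewrite Rmult_1_l. set (E := exp (- (r * Rabs (Im z)))).
  assert (HE : 0 < E) by apply exp_pos.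
  assert (HE1 : E <= 1). { unfold E. rewrite <- exp_0. apply exp_mono. assert (0 <= r * Rabs (Im z)) by (apply Rmult_le_pos; auto; apply Rabs_pos). lra. }
  destruct (Rle_or_lt (Cmod z) L) as [Hz|Hz].
  - specialize (HN k0 Hk z). assert (Cmod (Phi k0 z) < eps).
    { apply HN. split; eapply Rle_trans; [apply re_le_Cmod|exact Hz|apply im_Cmod_le|exact Hz]. }
    generalize (Cmod_ge_0 (Phi k0 z)). nra.
  - specialize (HB k0 1 z). rewrite Rpower_Ropp, Rpower_1 in HB by lra.
    apply Rle_trans with (M 1 * / (1 + Cmod z) * exp (r * Rabs (Im z)) * E). apply Rmult_le_compat_r; lra.
    unfold E. rewrite Rmult_assoc, <- exp_plus, Rplus_opp_r, exp_0, Rmult_1_r.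
    apply Rmult_le_reg_r with (1 + Cmod z). lra. rewrite Rmult_assoc, Rinv_l by lra. rewrite Rmult_1_r.
    replace (M 1) with (eps * L) by (unfold L; field; lra). apply Rmult_le_compat_l; lra.
Qed.

Lemma cvgW_cvg e r Phi : 0 <= r -> cvgW e r Phi -> cvg0_unif_compact Phi.
Proof.
  intros Hr H K HK eps He. destruct (compact_bounded K HK) as [L [HL HLK]].
  assert (Hp : 0 < exp (- (r * L))) by apply exp_pos.
  destruct (H (eps / 2 * exp (- (r * L)))) as [N HN]. nra. exists N. intros k0 Hk z Hz. specialize (HN k0 Hk z).
  unfold stripW in HN. simpl in HN. rewrite Rmult_1_l in HN.
  assert (A : exp (- (r * L)) <= exp (- (r * Rabs (Im z)))).
  { apply exp_mono. generalize (im_Cmod_le z) (HLK z Hz). nra. }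
  assert (B := Cmod_ge_0 (Phi k0 z)).
  assert (D : Cmod (Phi k0 z) * exp (- (r * L)) <= eps / 2 * exp (- (r * L))) by nra.
  apply Rmult_le_reg_r in D; auto. lra.
Qed.

(** * The convolution operator on Z *)

Section Zop.
Variables (g r : R).
Hypotheses (Hg : 0 < g) (Hr : 0 < r).
(** The Neumann series asks for e <= 1, the convergence of the integrals for e < g. *)
Let e := Rmin 1 (g / 2).
Let c := e + r.

Lemma e_props : 0 < e /\ e <= 1 /\ e < g.
Proof. unfold e. split; [|split]. apply Rmin_pos; lra. apply Rmin_l. eapply Rle_lt_trans. apply Rmin_r. lra. Qed.

Definition LapOp (F : C -> C) (z : C) : C := GamOp g F (- z)%C.

Lemma LapOp_ent M F : holo F -> Z_bound r M F -> holo (LapOp F).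
Proof.
  intros HF HB. destruct e_props as [E1 [E2 E3]]. apply holo_refl.
  apply (GamOp_ent e c ltac:(lra) ltac:(unfold c; lra) g E3 (stripW e r 0) (M (INR 0))); auto. apply stripW_wt; lra. apply stripW_bnd; auto.
Qed.

(** [C0] and [Mop] are chosen before F, so that a sequence with common constants has images with
    common constants; likewise for the inverse below. *)
Lemma LapOp_forward : exists C0 (Mop : (R -> R) -> R -> R), 0 <= C0 /\ forall F M, holo F -> Z_bound r M F ->
  Z_bound r (Mop M) (LapOp F) /\ forall K, wbound (stripW e r 0) K F -> wbound (stripW e r 0) (C0 * K) (LapOp F).
Proof.
  destruct e_props as [E1 [E2 E3]].
  exists (Gam (g + e) + Gam (g - e)), (fun M => Mof e (fun n => (Gam (g + e) + Gam (g - e)) * M (INR n))). split.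
  left. apply cst_pos; lra.
  intros F M HF HB.
  assert (A : forall n K, wbound (stripW e r n) K F -> wbound (stripW e r n) ((Gam (g + e) + Gam (g - e)) * K) (LapOp F)).
  { intros n K H. apply wbound_refl. apply (GamOp_bnd e c); auto with cont; try lra. apply stripW_wt; lra. }
  split; auto. apply stripW_Z_bound; auto. intros n. apply A. now apply stripW_bnd.
Qed.

Lemma LapOp_backward : exists C0 (Mop : (R -> R) -> R -> R), 0 <= C0 /\ forall G M, holo G -> Z_bound r M G ->
  exists F, holo F /\ (forall z, LapOp F z = G z) /\ Z_bound r (Mop M) F /\ forall K, wbound (stripW e r 0) K G -> wbound (stripW e r 0) (C0 * K) F.
Proof.
  destruct e_props as [E1 [E2 E3]].
  destruct (GamOp_onto_all e c ltac:(lra) E2 ltac:(unfold c; lra) g E3) as [C0 [HC0 HS]].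
  exists C0, (fun M => Mof e (fun n => C0 * M (INR n))). split; auto.
  intros G M HG HB.
  destruct (HS (fun z => G (- z)%C) (stripW e r 0) (M (INR 0))) as [F [HF [HA HBd]]].
  now apply holo_refl. apply stripW_wt; lra. apply wbound_refl. now apply stripW_bnd.
  assert (A : forall n K, wbound (stripW e r n) K G -> wbound (stripW e r n) (C0 * K) F).
  { intros n K H. apply HBd. apply stripW_wt; lra. now apply wbound_refl. }
  exists F. split; auto. split; [|split]; auto.
  - intros z. unfold LapOp. rewrite HA. f_equal. ring.
  - apply stripW_Z_bound; auto. intros n. apply A. now apply stripW_bnd.
Qed.

Lemma LapOp_inj M F : holo F -> Z_bound r M F -> (forall x : R, LapOp F x = 0) -> forall x : R, F x = 0.
Proof.
  intros HF HB H0. destruct e_props as [E1 [E2 E3]].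
  apply (GamOp_inj_all e c ltac:(lra) E2 ltac:(unfold c; lra) g E3 F (stripW e r 0) (M (INR 0))); auto. apply stripW_wt; lra. now apply stripW_bnd.
  intros x. rewrite <- (H0 (- x)). unfold LapOp. rewrite RtoC_opp. f_equal. ring.
Qed.

Lemma LapOp_lin M1 M2 a b F G z : holo F -> holo G -> Z_bound r M1 F -> Z_bound r M2 G ->
  LapOp (fun z => a * F z + b * G z)%C z = (a * LapOp F z + b * LapOp G z)%C.
Proof.
  intros HF HG HB1 HB2. destruct e_props as [E1 [E2 E3]]. unfold LapOp.
  assert (B1 := stripW_bnd e r M1 F 0 E1 E2 HB1). assert (B2 := stripW_bnd e r M2 G 0 E1 E2 HB2). assert (Hw := stripW_wt e r 0 E1 E2 (Rlt_le _ _ Hr)).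
  rewrite (GamOp_plus e c ltac:(lra) g E3 (stripW e r 0) (Cmod a * M1 (INR 0)) (Cmod b * M2 (INR 0)) (fun z => a * F z)%C (fun z => b * G z)%C); auto using contCC_scal, wbound_scal, holo_cc.
  rewrite (GamOp_scal e c ltac:(lra) g E3 (stripW e r 0) (M1 (INR 0)) a F), (GamOp_scal e c ltac:(lra) g E3 (stripW e r 0) (M2 (INR 0)) b G); auto using holo_cc.
Qed.

Lemma LapOp_GI M F (x : R) : holo F -> Z_bound r M F -> lineCI (fun t => RtoC (gker g t) * F (RtoC (- x) + RtoC t))%C (LapOp F x).
Proof.
  intros HF HB. destruct e_props as [E1 [E2 E3]]. unfold LapOp. rewrite RtoC_opp.
  apply (GamOp_spec e c ltac:(lra) g E3 (stripW e r 0) (M (INR 0))); auto using holo_cc. apply stripW_wt; lra. now apply stripW_bnd.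
Qed.
End Zop.

(** * The Laplace transform and its adjoint *)

(** [Zg_repr] with the entire extension in place of its restriction to R. *)
Definition represents (g : R) (f : posreal -> C) (Phi : C -> C) : Prop :=
  forall t : posreal, f t = (RtoC (Rpower t (g - 1 / 2)) * Phi (RtoC (ln t)))%C.

Lemma Laplace_integral g r M Phi (f : posreal -> C) (lambda : posreal) : 0 < g -> 0 < r -> holo Phi -> Z_bound r M Phi ->
  represents (g - 1 / 2) f Phi ->
  is_RInt_gen (V := C_R_NormedModule) (fun t : R => Cmult (RtoC (exp (- (t * lambda)))) (extend0 f t))
      (at_right 0) (Rbar_locally p_infty) (RtoC (Rpower lambda (- g)) * LapOp g Phi (RtoC (ln lambda)))%C.
Proof.
  intros Hg Hr HF HB Hrep. destruct lambda as [lam Hlam]. simpl.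
  assert (HGI := LapOp_GI g r Hg Hr M Phi (ln lam) HF HB).
  set (K := fun t => (RtoC (gker g t) * Phi (RtoC (- ln lam) + RtoC t))%C) in *.
  assert (HK : contRC K) by (unfold K; assert (contCC Phi) by auto using holo_cc; auto with cont).
  set (P := Rpower lam (- g)). assert (HP : 0 < P) by apply exp_pos.
  assert (HI : forall a b, 0 < a -> 0 < b -> is_RInt (V := C_R_NormedModule)
     (fun t : R => Cmult (RtoC (exp (- (t * lam)))) (extend0 f t)) a b (RtoC P * CInt K (ln (a * lam)) (ln (b * lam)))%C).
  { intros a b Ha Hb.
    assert (Hmin : 0 < Rmin a b) by (now apply Rmin_pos).
    assert (H := is_RInt_comp (V := CN) K (fun t => ln (t * lam)) (fun t => / t) a b).
    assert (H1 : forall x, Rmin a b <= x <= Rmax a b -> continuous (K : R -> CN) (ln (x * lam))) by (intros; apply HK).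
    assert (H2 : forall x, Rmin a b <= x <= Rmax a b -> is_derive (fun t => ln (t * lam)) x (/ x) /\ continuous (fun t => / t) x).
    { intros x Hx. split. auto_derive. apply Rmult_lt_0_compat; lra. field. lra. apply continuous_Rinv. lra. }
    specialize (H H1 H2). apply (is_RInt_scal (V := C_R_NormedModule) _ _ _ P) in H.
    rewrite <- scal_R_Cmult. eapply (is_RInt_ext (V := C_R_NormedModule)); [|exact H].
    intros x Hx. assert (Hx0 : 0 < x) by lra.
    transitivity (RtoC P * (RtoC (/ x) * K (ln (x * lam))))%C. { rewrite <- !scal_R_Cmult. reflexivity. }
    unfold K.
    unfold extend0. destruct (Rlt_dec 0 x) as [Hx1|]; [|lra]. rewrite (Hrep (mkposreal x Hx1)). simpl.
    rewrite <- RtoC_plus. replace (- ln lam + ln (x * lam)) with (ln x) by (rewrite ln_mult by auto; ring).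
    rewrite !Cmult_assoc, <- !RtoC_mult. f_equal. f_equal.
    unfold P, gker, Rpower. rewrite exp_ln by (now apply Rmult_lt_0_compat). rewrite ln_mult by auto.
    rewrite <- (exp_ln (/ x)) by (now apply Rinv_0_lt_compat). rewrite ln_Rinv by auto.
    rewrite <- !exp_plus. f_equal. field. }
  unfold is_RInt_gen. rewrite filterlimi_locally. intros eps.
  assert (HeP : 0 < eps / P) by (apply Rdiv_lt_0_compat; [apply cond_pos|auto]).
  destruct (HGI _ HeP) as [N [HN H]].
  (* Under x = ln (t * lam) the ranges x < - N and x > N become the neighbourhoods a < exp (- N) /
     lam of 0 and b > exp N / lam of infinity. *)
  assert (HL : 0 < exp (- N) / lam) by (apply Rdiv_lt_0_compat; auto; apply exp_pos).
  apply Filter_prod with (Q := fun a => 0 < a /\ a < exp (- N) / lam) (R := fun b => exp N / lam < b).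
  - exists (mkposreal _ HL). intros y Hy Hy0. change (Rabs (y - 0) < exp (- N) / lam) in Hy. split; auto.
    rewrite Rminus_0_r in Hy. generalize (Rle_abs y). lra.
  - exists (exp N / lam). auto.
  - intros a b [Ha Ha2] Hb. simpl.
    assert (HL2 : 0 < exp N / lam) by (apply Rdiv_lt_0_compat; auto; apply exp_pos).
    exists (RtoC P * CInt K (ln (a * lam)) (ln (b * lam)))%C. split. apply HI; lra.
    apply Cmod_ball.
    assert (A1 : ln (a * lam) < - N).
    { rewrite <- (ln_exp (- N)). apply ln_increasing. now apply Rmult_lt_0_compat.
      apply Rmult_lt_compat_r with (r := lam) in Ha2; auto. replace (exp (- N) / lam * lam) with (exp (- N)) in Ha2 by (field; lra). auto. }
    assert (A2 : N < ln (b * lam)).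
    { rewrite <- (ln_exp N) at 1. apply ln_increasing. apply exp_pos.
      apply Rmult_lt_compat_r with (r := lam) in Hb; auto. replace (exp N / lam * lam) with (exp N) in Hb by (field; lra). auto. }
    specialize (H _ _ A1 A2).
    replace (RtoC P * CInt K (ln (a * lam)) (ln (b * lam)) - RtoC P * LapOp g Phi (RtoC (ln lam)))%C with
      (RtoC P * (CInt K (ln (a * lam)) (ln (b * lam)) - LapOp g Phi (RtoC (ln lam))))%C by ring.
    rewrite Cmod_mult, Cmod_R, Rabs_right by lra.
    apply Rmult_lt_compat_l with (r := P) in H; auto. replace (P * (eps / P)) with (pos eps) in H by (field; lra). exact H.
Qed.

Section Laplace.
Variable g : R.
Hypothesis Hg : 0 < g.

Lemma is_Laplace_value r M Phi f h : 0 < r -> holo Phi -> Z_bound r M Phi -> represents (g - 1 / 2) f Phi ->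
  (is_Laplace f h <-> represents (1 / 2 - g) h (LapOp g Phi)).
Proof.
  intros Hr HF HB Hrep.
  (* The index 1/2 - g carries the prefactor lambda^(- g), just as the index g - 1/2 carries t^(g -
     1). *)
  assert (E : forall t, Rpower t (1 / 2 - g - 1 / 2) = Rpower t (- g)) by (intros t; f_equal; field).
  split.
  - intros H lam. specialize (H lam). rewrite E.
    assert (H2 := Laplace_integral g r M Phi f lam Hg Hr HF HB Hrep).
    rewrite <- (is_RInt_gen_unique (V := CN) _ _ H). rewrite <- (is_RInt_gen_unique (V := CN) _ _ H2). reflexivity.
  - intros H lam. rewrite H, E. now apply (Laplace_integral g r M).
Qed.

Lemma represents_inj h f Phi Psi : represents h f Phi -> represents h f Psi -> forall x : R, Phi x = Psi x.
Proof.
  intros H1 H2 x. specialize (H1 (mkposreal (exp x) (exp_pos x))). specialize (H2 (mkposreal (exp x) (exp_pos x))).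
  simpl in *. rewrite ln_exp in *. rewrite H1 in H2. set (p := Rpower (exp x) (h - 1 / 2)) in *.
  assert (Hp : 0 < p) by apply exp_pos.
  assert (E : forall w, (RtoC (/ p) * (RtoC p * w))%C = w).
  { intros w. rewrite Cmult_assoc, <- RtoC_mult, Rinv_l by lra. ring. }
  rewrite <- (E (Phi x)), <- (E (Psi x)), H2. reflexivity.
Qed.

Lemma Z_bound_lin r M1 M2 a b F G : Z_bound r M1 F -> Z_bound r M2 G ->
  Z_bound r (fun kappa => Cmod a * M1 kappa + Cmod b * M2 kappa) (fun z => a * F z + b * G z)%C.
Proof.
  intros H1 H2 kappa z. specialize (H1 kappa z). specialize (H2 kappa z).
  eapply Rle_trans. apply Cmod_triangle. rewrite !Cmod_mult.
  assert (A := Cmod_ge_0 a). assert (B := Cmod_ge_0 b).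
  apply Rmult_le_compat_l with (r := Cmod a) in H1; auto. apply Rmult_le_compat_l with (r := Cmod b) in H2; auto. lra.
Qed.

(** F and G may come with different types; both are of type Rmax r1 r2, and there injectivity
    applies to their difference. *)
Lemma LapOp_inj2 r1 r2 M1 M2 F G : 0 < r1 -> 0 < r2 -> holo F -> holo G -> Z_bound r1 M1 F -> Z_bound r2 M2 G ->
  (forall x : R, LapOp g F x = LapOp g G x) -> forall x : R, F x = G x.
Proof.
  intros H1 H2 HF HG HB1 HB2 H x. set (r := Rmax r1 r2).
  assert (Hr : 0 < r) by (eapply Rlt_le_trans; [exact H1|apply Rmax_l]).
  apply (Z_bound_mono r1 r) in HB1; [|apply Rmax_l]. apply (Z_bound_mono r2 r) in HB2; [|apply Rmax_r].
  assert (E : (1 * F x + (-1) * G x = 0)%C).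
  { apply (LapOp_inj g r Hg Hr _ (fun z => 1 * F z + (-1) * G z)%C) with (2 := Z_bound_lin r M1 M2 1 (-1) F G HB1 HB2).
    - apply (holo_plus (fun z => 1 * F z)%C (fun z => (-1) * G z)%C); now apply holo_scal.
    - intros y. rewrite (LapOp_lin g r Hg Hr M1 M2); auto. rewrite H. ring. }
  apply Ceq_minus. rewrite <- E. ring.
Qed.

Lemma Zg_data h (f : Zg h) : exists Phi r M, 0 < r /\ holo Phi /\ Z_bound r M Phi /\ represents h f Phi.
Proof.
  destruct (proj2_sig f) as [F [[_ [Phi [[HE HR] [r [M [Hr HB]]]]]] Hf]]. exists Phi, r, M. simpl. repeat split; auto.
  now apply entire_ent. intros t. rewrite HR. apply Hf.
Qed.

Lemma Z_space_of r M Phi : 0 < r -> holo Phi -> Z_bound r M Phi -> Z_space (fun x => Phi (RtoC x)).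
Proof.
  intros Hr HF HB. split. apply (Z_bound_schwartz r M Phi); auto; lra.
  exists Phi. split. split. now apply entire_ent. reflexivity. eauto.
Qed.

Lemma Zg_make h r M Phi : 0 < r -> holo Phi -> Z_bound r M Phi -> exists f : Zg h, represents h f Phi.
Proof.
  intros Hr HF HB.
  assert (H : exists F : R -> C, Z_space F /\ Zg_repr h (fun t : posreal => RtoC (Rpower t (h - 1 / 2)) * Phi (RtoC (ln t)))%C F).
  { exists (fun x => Phi (RtoC x)). split. now apply (Z_space_of r M). intros t. reflexivity. }
  exists (exist (fun f => exists F : R -> C, Z_space F /\ Zg_repr h f F) _ H). intros t. reflexivity.
Qed.

(** Extensionality and proof irrelevance give Leibniz equality, in which the uniqueness claims of
    the theorem are stated. *)
Lemma Zg_eq h (f f' : Zg h) : (forall t, f t = f' t) -> f = f'.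
Proof.
  intros H. destruct f as [f Hf], f' as [f' Hf']. simpl in H. assert (E : f = f') by now apply functional_extensionality.
  subst f'. f_equal. apply proof_irrelevance.
Qed.

Lemma Laplace_total (f : Zg (g - 1 / 2)) : exists h : Zg (1 / 2 - g), is_Laplace f h.
Proof.
  destruct (Zg_data _ f) as [Phi [r [M [Hr [HF [HB Hrep]]]]]].
  destruct (LapOp_forward g r Hg Hr) as [C0 [Mop [_ H]]]. destruct (H Phi M HF HB) as [HB' _].
  destruct (Zg_make (1 / 2 - g) r _ (LapOp g Phi) Hr (LapOp_ent g r Hg Hr M Phi HF HB) HB') as [h Hh].
  exists h. now apply (is_Laplace_value r M Phi f h).
Qed.

Lemma Laplace_fun (f : Zg (g - 1 / 2)) (h h' : Zg (1 / 2 - g)) : is_Laplace f h -> is_Laplace f h' -> h = h'.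
Proof.
  intros H H'. destruct (Zg_data _ f) as [Phi [r [M [Hr [HF [HB Hrep]]]]]].
  apply (is_Laplace_value r M Phi f h) in H; auto. apply (is_Laplace_value r M Phi f h') in H'; auto.
  apply Zg_eq. intros t. rewrite H, H'. reflexivity.
Qed.

Lemma Laplace_surj (h : Zg (1 / 2 - g)) : exists f : Zg (g - 1 / 2), is_Laplace f h.
Proof.
  destruct (Zg_data _ h) as [Psi [r [M [Hr [HF [HB Hrep]]]]]].
  destruct (LapOp_backward g r Hg Hr) as [C0 [Mop [_ H]]]. destruct (H Psi M HF HB) as [Phi [HP [HT [HBP _]]]].
  destruct (Zg_make (g - 1 / 2) r _ Phi Hr HP HBP) as [f Hf].
  exists f. apply (is_Laplace_value r _ Phi f h Hr HP HBP Hf). intros t. rewrite HT. apply Hrep.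
Qed.

(** Serves to recognise an F obtained by inverting the operator as a representative of a given f
    with Laplace transform h. *)
Lemma Laplace_inj_rep f h Phi r M F r' M' : 0 < r -> holo Phi -> Z_bound r M Phi -> represents (g - 1 / 2) f Phi ->
  0 < r' -> holo F -> Z_bound r' M' F -> represents (1 / 2 - g) h (LapOp g F) -> is_Laplace f h -> forall x : R, Phi x = F x.
Proof.
  intros Hr HF HB Hrep Hr' HF' HB' Hh HL. apply (is_Laplace_value r M Phi f h Hr HF HB Hrep) in HL.
  apply (LapOp_inj2 r r' M M' Phi F Hr Hr' HF HF' HB HB'). now apply (represents_inj (1 / 2 - g) h).
Qed.

Lemma Laplace_inj (f f' : Zg (g - 1 / 2)) (h : Zg (1 / 2 - g)) : is_Laplace f h -> is_Laplace f' h -> f = f'.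
Proof.
  intros H H'. destruct (Zg_data _ f) as [Phi [r [M [Hr [HF [HB Hrep]]]]]].
  destruct (Zg_data _ f') as [Phi' [r' [M' [Hr' [HF' [HB' Hrep']]]]]].
  apply (is_Laplace_value r' M' Phi' f' h) in H'; auto.
  assert (E := Laplace_inj_rep f h Phi r M Phi' r' M' Hr HF HB Hrep Hr' HF' HB' H' H).
  apply Zg_eq. intros t. rewrite Hrep, Hrep', E. reflexivity.
Qed.

(** An equivalence, so that it yields linearity of the transform and of its inverse at once; the
    direction from the images back rests on injectivity. *)
Lemma Laplace_lin a b (f1 f2 f3 : Zg (g - 1 / 2)) (h1 h2 h3 : Zg (1 / 2 - g)) :
  is_Laplace f1 h1 -> is_Laplace f2 h2 -> is_Laplace f3 h3 ->
  ((forall t : posreal, f3 t = Cplus (Cmult a (f1 t)) (Cmult b (f2 t))) <->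
   (forall t : posreal, h3 t = Cplus (Cmult a (h1 t)) (Cmult b (h2 t)))).
Proof.
  intros L1 L2 L3.
  destruct (Zg_data _ f1) as [P1 [r1 [M1 [Hr1 [HF1 [HB1 Hrep1]]]]]].
  destruct (Zg_data _ f2) as [P2 [r2 [M2 [Hr2 [HF2 [HB2 Hrep2]]]]]].
  set (r := Rmax r1 r2). assert (Hr : 0 < r) by (eapply Rlt_le_trans; [exact Hr1|apply Rmax_l]).
  apply (Z_bound_mono r1 r) in HB1; [|apply Rmax_l]. apply (Z_bound_mono r2 r) in HB2; [|apply Rmax_r].
  set (P := fun z => (a * P1 z + b * P2 z)%C).
  assert (HP : holo P) by (apply (holo_plus (fun z => a * P1 z)%C (fun z => b * P2 z)%C); now apply holo_scal).
  assert (HPB := Z_bound_lin r M1 M2 a b P1 P2 HB1 HB2). fold P in HPB.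
  apply (is_Laplace_value r M1 P1 f1 h1) in L1; auto. apply (is_Laplace_value r M2 P2 f2 h2) in L2; auto.
  assert (HT : forall z, LapOp g P z = (a * LapOp g P1 z + b * LapOp g P2 z)%C) by (intros z; now apply (LapOp_lin g r Hg Hr M1 M2)).
  split; intros H.
  - assert (R3 : represents (g - 1 / 2) f3 P). { intros t. rewrite H, Hrep1, Hrep2. unfold P. ring. }
    apply (is_Laplace_value r _ P f3 h3 Hr HP HPB R3) in L3. intros t. rewrite L1, L2, L3, HT. ring.
  - assert (R3 : represents (1 / 2 - g) h3 (LapOp g P)). { intros t. rewrite H, L1, L2, HT. ring. }
    destruct (Zg_data _ f3) as [P3 [r3 [M3 [Hr3 [HF3 [HB3 Hrep3]]]]]].
    assert (E := Laplace_inj_rep f3 h3 P3 r3 M3 P r _ Hr3 HF3 HB3 Hrep3 Hr HP HPB R3 L3).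
    intros t. rewrite Hrep1, Hrep2, Hrep3, E. unfold P. ring.
Qed.

Lemma Zg_cvg0_iff h (f : nat -> Zg h) : Zg_cvg0 h f <-> exists Phi r M, 0 < r /\ (forall k, holo (Phi k)) /\
  (forall k, Z_bound r M (Phi k)) /\ (forall k, represents h (f k) (Phi k)) /\ cvg0_unif_compact Phi.
Proof.
  split.
  - intros [F [HF [HZ [Phi [HA [[r [M [Hr HB]]] Hc]]]]]]. exists Phi, r, M. repeat split; auto.
    + intros n. apply entire_ent. apply HA.
    + intros n t. rewrite (proj2 (HA n)). apply HF.
  - intros [Phi [r [M [Hr [HF [HB [Hrep Hc]]]]]]]. exists (fun k x => Phi k (RtoC x)). split.
    + intros n t. apply Hrep.
    + split. intros n. now apply (Z_space_of r M). exists Phi. split; [|split; eauto].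
      intros n. split. now apply entire_ent. reflexivity.
Qed.

(** Compact convergence is traded for the weighted norm, in which the operator is bounded by [C0],
    and traded back; [Mop M] supplies the common constants of the images. *)
Lemma Laplace_cont (f : nat -> Zg (g - 1 / 2)) (h : nat -> Zg (1 / 2 - g)) : (forall k, is_Laplace (f k) (h k)) ->
  Zg_cvg0 _ f -> Zg_cvg0 _ h.
Proof.
  intros HL H. apply Zg_cvg0_iff in H. destruct H as [Phi [r [M [Hr [HF [HB [Hrep Hc]]]]]]].
  destruct (LapOp_forward g r Hg Hr) as [C0 [Mop [HC0 HT]]].
  apply Zg_cvg0_iff. exists (fun n => LapOp g (Phi n)), r, (Mop M). split; auto. split; [|split; [|split]].
  - intros n. now apply (LapOp_ent g r Hg Hr M).
  - intros n. now apply HT.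
  - intros n. now apply (is_Laplace_value r M (Phi n) (f n) (h n)).
  - apply (cvgW_cvg (Rmin 1 (g / 2)) r). lra.
    intros eps Heps. destruct (cvg_cvgW (Rmin 1 (g / 2)) r M Phi ltac:(lra) HB Hc (eps / (C0 + 1))) as [N HN].
    apply Rdiv_lt_0_compat; lra. exists N. intros n Hn. apply wbound_weak with (C0 * (eps / (C0 + 1))).
    + apply Rle_trans with ((C0 + 1) * (eps / (C0 + 1))). apply Rmult_le_compat_r. left; apply Rdiv_lt_0_compat; lra. lra. right; field; lra.
    + apply (HT (Phi n) M); auto.
Qed.

Lemma Laplace_inv_cont (f : nat -> Zg (g - 1 / 2)) (h : nat -> Zg (1 / 2 - g)) : (forall k, is_Laplace (f k) (h k)) ->
  Zg_cvg0 _ h -> Zg_cvg0 _ f.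
Proof.
  intros HL H. apply Zg_cvg0_iff in H. destruct H as [Psi [r [M [Hr [HF [HB [Hrep Hc]]]]]]].
  destruct (LapOp_backward g r Hg Hr) as [C0 [Mop [HC0 HT]]].
  (* The entire functions that come with f n need not have common constants. Preimages of the Psi n
     with controlled bounds are chosen instead and then shown to represent f n. *)
  set (Q := fun n (F : C -> C) => holo F /\ (forall z, LapOp g F z = Psi n z) /\ Z_bound r (Mop M) F /\
     forall K, wbound (stripW (Rmin 1 (g / 2)) r 0) K (Psi n) -> wbound (stripW (Rmin 1 (g / 2)) r 0) (C0 * K) F).
  assert (HQ : forall n, exists F, Q n F) by (intros n; apply (HT (Psi n) M); auto).
  set (Phi := fun n => proj1_sig (constructive_indefinite_description _ (HQ n))).
  assert (HPhi : forall n, Q n (Phi n)) by (intros n; apply (proj2_sig (constructive_indefinite_description _ (HQ n)))).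
  clearbody Phi.
  apply Zg_cvg0_iff. exists Phi, r, (Mop M). split; auto. split; [|split; [|split]].
  - intros n. apply HPhi.
  - intros n. apply HPhi.
  - intros n. destruct (HPhi n) as [E1 [E2 [E3 _]]].
    destruct (Zg_data _ (f n)) as [P [r' [M' [Hr' [HF' [HB' Hrep']]]]]].
    assert (R3 : represents (1 / 2 - g) (h n) (LapOp g (Phi n))). { intros t. rewrite E2. apply Hrep. }
    assert (E := Laplace_inj_rep (f n) (h n) P r' M' (Phi n) r _ Hr' HF' HB' Hrep' Hr E1 E3 R3 (HL n)).
    intros t. rewrite Hrep', E. reflexivity.
  - apply (cvgW_cvg (Rmin 1 (g / 2)) r). lra.
    intros eps Heps. destruct (cvg_cvgW (Rmin 1 (g / 2)) r M Psi ltac:(lra) HB Hc (eps / (C0 + 1))) as [N HN].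
    apply Rdiv_lt_0_compat; lra. exists N. intros n Hn. apply wbound_weak with (C0 * (eps / (C0 + 1))).
    + apply Rle_trans with ((C0 + 1) * (eps / (C0 + 1))). apply Rmult_le_compat_r. left; apply Rdiv_lt_0_compat; lra. lra. right; field; lra.
    + apply (HPhi n); auto.
Qed.

(** * The transform as a map and its action on the duals *)

Definition Lap (f : Zg (g - 1 / 2)) : Zg (1 / 2 - g) := proj1_sig (constructive_indefinite_description _ (Laplace_total f)).
Lemma Lap_spec (f : Zg (g - 1 / 2)) : is_Laplace f (Lap f).
Proof. unfold Lap. apply (proj2_sig (constructive_indefinite_description _ (Laplace_total f))). Qed.
Definition Lapinv (h : Zg (1 / 2 - g)) : Zg (g - 1 / 2) := proj1_sig (constructive_indefinite_description _ (Laplace_surj h)).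
Lemma Lapinv_spec (h : Zg (1 / 2 - g)) : is_Laplace (Lapinv h) h.
Proof. unfold Lapinv. apply (proj2_sig (constructive_indefinite_description _ (Laplace_surj h))). Qed.

Lemma dual_eq d (h h' : Zg_dual d) : (forall f, pairing h f = pairing h' f) -> h = h'.
Proof.
  intros H. destruct h as [h Hh], h' as [h' Hh']. unfold pairing in H. simpl in H.
  assert (E : h = h') by now apply functional_extensionality. subst h'. f_equal. apply proof_irrelevance.
Qed.

(** The adjoint of a linear, sequentially continuous T maps the dual of the target to that of the
    source. It is applied to the Laplace transform and to its inverse. *)
Lemma dual_comp (d d' : R) (T : Zg d -> Zg d') (s : Zg_dual d') :
  (forall a b (f1 f2 f3 : Zg d), (forall t : posreal, f3 t = Cplus (Cmult a (f1 t)) (Cmult b (f2 t))) ->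
     forall t : posreal, T f3 t = Cplus (Cmult a (T f1 t)) (Cmult b (T f2 t))) ->
  (forall f : nat -> Zg d, Zg_cvg0 d f -> Zg_cvg0 d' (fun n => T (f n))) ->
  exists h : Zg_dual d, forall f, pairing h f = pairing s (T f).
Proof.
  intros Hl Hc. destruct s as [s [Hs1 Hs2]].
  assert (H : antilinear d (fun f => s (T f)) /\ continuous_functional d (fun f => s (T f))).
  { split. intros a b f1 f2 f3 H. apply Hs1. now apply Hl. intros f Hf. apply (Hs2 (fun n => T (f n))). now apply Hc. }
  exists (exist (fun h => antilinear d h /\ continuous_functional d h) _ H). reflexivity.
Qed.
End Laplace.

(* The first conjunct says that the relation h = L^* sigma is the graph of a
   map L^* defined on all of Z_(1/2 - gamma)'; the second says that this map is
   a bijection onto Z_(gamma - 1/2)'. *)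
Theorem proposition4p11 (gamma : R) (Hgamma : 0 < gamma) :
  (forall sigma : Zg_dual (1 / 2 - gamma),
     exists! h : Zg_dual (gamma - 1 / 2), is_sigma_function gamma h sigma) /\
  (forall h : Zg_dual (gamma - 1 / 2),
     exists! sigma : Zg_dual (1 / 2 - gamma), is_sigma_function gamma h sigma).
Proof.
  split.
  - intros sigma. destruct (dual_comp _ _ (Lap gamma Hgamma) sigma) as [h Hh].
    + intros a b f1 f2 f3. apply (Laplace_lin gamma Hgamma a b f1 f2 f3); apply Lap_spec.
    + intros f Hf. apply (Laplace_cont gamma Hgamma f); auto. intros n; apply Lap_spec.
    + exists h. split.
      * intros F. exists (Lap gamma Hgamma F). split. apply Lap_spec. apply Hh.
      * intros h' H'. apply dual_eq. intros f. destruct (H' f) as [LF [HL HE]].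
        rewrite HE, Hh. f_equal. apply (Laplace_fun gamma Hgamma f). apply Lap_spec. exact HL.
  (* The sigma-function is the adjoint of the inverse transform applied to h. *)
  - intros h. destruct (dual_comp _ _ (Lapinv gamma Hgamma) h) as [sigma Hs].
    + intros a b f1 f2 f3. apply (Laplace_lin gamma Hgamma a b _ _ _ f1 f2 f3); apply Lapinv_spec.
    + intros f Hf. apply (Laplace_inv_cont gamma Hgamma _ f); auto. intros n; apply Lapinv_spec.
    + exists sigma. split.
      * intros F. exists (Lap gamma Hgamma F). split. apply Lap_spec. rewrite Hs. f_equal.
        apply (Laplace_inj gamma Hgamma _ _ (Lap gamma Hgamma F)). apply Lap_spec. apply Lapinv_spec.
      (* Every test function f is the transform of [Lapinv f], so the relation prescribes the value
         of a sigma-function at f. *)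
      * intros s' H'. apply dual_eq. intros f. destruct (H' (Lapinv gamma Hgamma f)) as [LF [HL HE]].
        rewrite Hs, HE. f_equal. apply (Laplace_fun gamma Hgamma (Lapinv gamma Hgamma f)). exact HL. apply Lapinv_spec.
Qed.
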